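(* Let $0\le r\le4$ be an integer. Then the dual problem of $$\text{Minimize}\quad \tfrac12\|u-f\|_{L^2(\Omega_0)}^2+\beta\,|u|_{DTV(\Omega)}\quad\text{over }u\in\mathcal{DG}_r(\Omega)$$ is $$\text{Minimize}\quad\tfrac12\|\operatorname{div}p+f\|_{L^2(\Omega_0)}^2\quad\text{s.t. } p\in\beta\,\mathbf P,$$ where $$\beta\,\mathbf P=\big\{p\in\mathcal{RT}^0_{r+1}(\Omega):\ |\sigma_{T,i}(p)|_{s^*}\le\beta\,c_{T,i}\text{ for all }T\text{ and all }i,\ |\sigma_{E,j}(p)|\le\beta\,|n_E|_s\,c_{E,j}\text{ for all }E\text{ and all }j\big\}.$$
   Context: $\Omega\subset\mathbb R^2$ is a bounded domain with polygonal boundary, triangulated by a geometrically conforming mesh (no hanging nodes) of non-degenerate triangles $T$; $E$ ranges over the interior edges. $\Omega_0\subset\Omega$ is the domain where data is available, and $\Omega\setminus\Omega_0$ is a union of triangles of the mesh (possibly empty). $\beta>0$, $s\in[1,\infty]$ with conjugate exponent $s^*=s/(s-1)$, and $|\cdot|_s$ is the $s$-norm on $\mathbb R^2$. On each interior edge $E$, $n_E$ is a fixed normal vector of unit Euclidean length with arbitrary orientation. $P_m(T)$ denotes the bivariate polynomials of total degree at most $m$ on $T$, and $P_m(E)$ the univariate polynomials of degree at most $m$ on $E$; $P_{-1}(T)=\{0\}$. $\mathcal{DG}_r(\Omega)=\{u\in L^2(\Omega): u|_T\in P_r(T)\text{ for all }T\}$, and $\mathcal{DG}_r(\Omega_0)$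 is defined likewise using the triangles in $\Omega_0$. The data satisfies $f\in\mathcal{DG}_r(\Omega_0)$. $\varphi_{T,i}$, $i=1,\dots,r(r+1)/2$, is the standard nodal (Lagrange) basis of $P_{r-1}(T)$ with nodes $X_{T,i}$ forming the uniform lattice on $T$ (for $P_0(T)$: the barycenter; for $r=0$ there are no such indices). $\varphi_{E,j}$, $j=1,\dots,r+1$, is the standard nodal basis of $P_r(E)$ with equispaced nodes $X_{E,j}$ (including end points if $r\ge1$; the midpoint if $r=0$). The interpolation operators are $\mathcal I_T\{v\}=\sum_iv(X_{T,i})\varphi_{T,i}$ and $\mathcal I_E\{v\}=\sum_jv(X_{E,j})\varphi_{E,j}$. The weights are $c_{T,i}=\int_T\varphi_{T,i}\,dx$ and $c_{E,j}=\int_E\varphi_{E,j}\,dS$. For an interior edge $E$ between $T_1,T_2$ with outer unit normals $n_1,n_2=-n_1$ along $E$, the scalar jump is $[\![u]\!]_E=(u|_{T_1}n_1+u|_{T_2}n_2)\cdot n_E\in P_r(E)$. The discrete TV-seminorm is $|u|_{DTV(\Omega)}=\sum_T\int_T\mathcal I_T\{|\nabla u|_s\}\,dx+\sum_E\int_E\mathcal I_E\{|[\![u]\!]_E|\,|n_E|_s\}\,dS$. $\mathcal{RT}_{r+1}(\Omega)=\{p\in H(\operatorname{div};\Omega): p|_T\in P_r(T)^2+x\,P_r(T)\ \forall T\}$ is the Raviart–Thomas finite element space, where $H(\operatorname{div};\Omega)=\{p\in L^2(\Omega)^2:\operatorname{div}p\in L^2(\Omega)\}$, and $\mathcal{RT}^0_{r+1}(\Omega)$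 is the subspace with $p\cdot n=0$ on $\partial\Omega$. Its degrees of freedom are $\sigma_{T,i}(p)=\int_T\varphi_{T,i}\,p\,dx\in\mathbb R^2$ and $\sigma_{E,j}(p)=\int_E\varphi_{E,j}(p\cdot n_E)\,dS\in\mathbb R$. Meaning of ''dual problem'' (Fenchel dual). Put $U=\mathcal{DG}_r(\Omega)$, identified with its dual space via the $L^2(\Omega)$ inner product, $Y=\prod_TP_{r-1}(T)^2\times\prod_EP_r(E)$, $\Lambda:U\to Y$ with $(\Lambda u)_T=\nabla u|_T$ and $(\Lambda u)_E=[\![u]\!]_E$, $G(d)=\sum_T\int_T\mathcal I_T\{|d_T|_s\}\,dx+\sum_E|n_E|_s\int_E\mathcal I_E\{|d_E|\}\,dS$ for $d\in Y$, and $F(u)=\frac12\|u-f\|^2_{L^2(\Omega_0)}$, so that the primal objective is $F(u)+\beta G(\Lambda u)$. The dual space $Y^*$ is identified with $\mathcal{RT}^0_{r+1}(\Omega)$ via $\langle p,d\rangle=\sum_T\int_Tp\cdot d_T\,dx+\sum_E\int_E(p\cdot n_E)\,d_E\,dS$. The dual problem is to minimize $F^*(-\Lambda^*p)+\beta G^*(p/\beta)$ over $p\in\mathcal{RT}^0_{r+1}(\Omega)$, where $F^*$, $G^*$ are the convex conjugates and $\Lambda^*$ is the adjoint of $\Lambda$; additive constants in the objective that do not depend on $p$ are disregarded.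
   Formalization: The edge terms in the pairing <p,d> carry a minus sign (with plus, the adjoint of Λ is not -div), and the dual has the extra constraint div p = 0 a.e. on Ω\Ω_0 (vacuous if Ω_0 = Ω), without which the Fenchel dual objective is +∞; as printed the claim fails on both points. *)

(* Defs.v *)
(* MathComp-Analysis.  All functions on the plane are functions on R * R;
   integrals are Lebesgue integrals. *)
From HB Require Import structures.
From mathcomp Require Import all_boot all_order all_algebra.
From mathcomp Require Import all_classical all_reals all_analysis.

Set Implicit Arguments.
Unset Strict Implicit.
Unset Printing Implicit Defensive.
Import Order.TTheory GRing.Theory Num.Theory.
Import numFieldNormedType.Exports.
Local Open Scope classical_set_scope.
Local Open Scope ring_scope.

Section Plane.
Context {R : realType}.
Implicit Types (x y : R * R) (v : R * R -> R) (D : set (R * R)).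

Definition mu2 := ((@lebesgue_measure R) \x (@lebesgue_measure R))%E.

Definition dot x y : R := x.1 * y.1 + x.2 * y.2.
Definition det2 x y : R := x.1 * y.2 - x.2 * y.1.

(* The s-norm on R^2; only 1 <= s <= +oo is meaningful. *)
Definition snorm (s : \bar R) x : R :=
  match s with
  | a%:E => (`|x.1| `^ a + `|x.2| `^ a) `^ a^-1
  | _ => Num.max `|x.1| `|x.2|
  end.

Definition norm2 x : R := Num.sqrt (dot x x).

Definition d1 v x : R := derive1 (fun t : R => v (t, x.2)) x.1.
Definition d2 v x : R := derive1 (fun t : R => v (x.1, t)) x.2.
Definition grad v x : R * R := (d1 v x, d2 v x).

Fixpoint Ck (n : nat) v : Prop :=
  match n with
  | 0 => continuous v
  | m.+1 => [/\ forall x, derivable (fun t : R => v (t, x.2)) x.1 1,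
                forall x, derivable (fun t : R => v (x.1, t)) x.2 1,
                Ck m (d1 v) & Ck m (d2 v)]
  end.

Definition test_function D v :=
  [/\ forall n, Ck n v,
      compact (closure [set x | v x != 0])
    & closure [set x | v x != 0] `<=` D].

(* g is a representative, measurable on the whole plane, of a class in L^2(D). *)
Definition L2 D (g : R * R -> R) :=
  measurable_fun [set: R * R] g /\
  mu2.-integrable D (EFin \o (fun x => g x ^+ 2)).

(* Polynomial functions of (total) degree < m; hence P_r is [Plt2 r.+1],
   P_(r-1) is [Plt2 r], and P_(-1) = {0} is [Plt2 0]. *)
Definition Plt2 (m : nat) : set (R * R -> R) :=
  [set v | exists c : nat -> nat -> R, forall x,
     v x = \sum_(i < m) \sum_(j < m - i) c i j * x.1 ^+ i * x.2 ^+ j].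
Definition Plt1 (m : nat) : set (R -> R) :=
  [set w | exists c : nat -> R, forall t, w t = \sum_(i < m) c i * t ^+ i].

(* The nodal basis of the function space V for the given nodes: a basis of V
   dual to the evaluations at the nodes.  It is unique if it exists. *)
Definition nodal_basis (X : Type) (I : finType) (V : set (X -> R))
    (node : I -> X) (phi : I -> X -> R) :=
  [/\ forall i, V (phi i),
      forall i j : I, phi i (node j) = (i == j)%:R
    & forall w, V w -> forall z, w z = \sum_i w (node i) * phi i z].

(* Convex conjugate of h : V -> R (V given as a subset of a type) at a linear
   functional l on V. *)
Definition conjugate (X : Type) (V : set X) (h l : X -> R) : \bar R :=
  ereal_sup [set (l w - h w)%:E | w in V].

End Plane.

Record mesh (R : realType) := Mesh {
  ntri : nat;
  vtx : 'I_ntri -> 'I_3 -> R * R }.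

Section Mesh.
Context {R : realType}.
Variable M : mesh R.
Implicit Types (T : 'I_(ntri M)) (x : R * R).

Definition tri T : set (R * R) :=
  [set x | exists w : 'I_3 -> R,
     [/\ forall i, 0 <= w i, \sum_i w i = 1 & x = \sum_i w i *: vtx T i]].

(* (T, i) stands for the side of T opposite to its i-th vertex. *)
Definition half := ('I_(ntri M) * 'I_3)%type.
Definition ha (h : half) : R * R := vtx h.1 (ordS h.2).
Definition hb (h : half) : R * R := vtx h.1 (ord_pred h.2).
Definition gam (h : half) (t : R) : R * R := ha h + t *: (hb h - ha h).
Definition side (h : half) : set (R * R) := gam h @` `[0, 1].

(* Outer unit normal of h.1 along h; (y, -x) is normal to (x, y) and is
   oriented away from the opposite vertex. *)
Definition nout (h : half) : R * R :=
  let e := hb h - ha h in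
  let m := (e.2, - e.1) in
  (- Num.sg (dot m (vtx h.1 h.2 - ha h)) / norm2 e) *: m.

(* The domain is the interior of the union of the closed triangles. *)
Definition Omega : set (R * R) := interior (\bigcup_(T in setT) tri T).

Definition triangulation :=
  [/\ (0 < ntri M)%N,
      forall T, det2 (vtx T 1 - vtx T 0) (vtx T 2 - vtx T 0) != 0,
      forall T T', T != T' ->
        [\/ tri T `&` tri T' = set0,
            exists i j, vtx T i = vtx T' j /\ tri T `&` tri T' = [set vtx T i]
          | exists i j, side (T, i) = side (T', j) /\
                        tri T `&` tri T' = side (T, i)]
    & connected Omega].

(* An interior edge is recorded by the two triangles T1, T2 that share it
   (first the one with the smaller index) and its position in each of them.
   The edge is parametrized by [gam e.1] over [0, 1]; functions on it are
   functions of this parameter. *)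
Definition edge := (half * half)%type.
Definition interior_edge (e : edge) : bool :=
  (e.1.1 < e.2.1)%N && `[< side e.1 = side e.2 >].
Definition boundary_side (h : half) : Prop :=
  forall h' : half, h'.1 != h.1 -> side h' <> side h.

Definition intT T (v : R * R -> R) : R := \int[mu2]_(x in tri T) v x.
Definition intE (e : edge) (v : R -> R) : R :=
  norm2 (hb e.1 - ha e.1) * \int[lebesgue_measure]_(t in `[0, 1]) v t.

Definition unit_normals (nE : edge -> R * R) :=
  forall e, interior_edge e ->
    norm2 (nE e) = 1 /\ dot (nE e) (hb e.1 - ha e.1) = 0.

(* Element of a broken space: u T is the polynomial representing u on T.
   Distinct triangles overlap in null sets only, so that the integral over a
   union of triangles of such a u is the sum of the integrals of the u T. *)
Definition broken := 'I_(ntri M) -> R * R -> R.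
Definition field := 'I_(ntri M) -> R * R -> R * R.

Definition DG (r : nat) : set broken := [set u | forall T, Plt2 r.+1 (u T)].
Definition DG_on (D : {set 'I_(ntri M)}) (r : nat) : set broken :=
  [set f | forall T, T \in D -> Plt2 r.+1 (f T)].

(* Lattice of order m.-1 of a triangle, m(m+1)/2 points; the barycentric
   coordinates are those of [bary]. *)
Definition lattice (m : nat) := {i : 'I_m * 'I_m | (i.1 + i.2 < m)%N}.
Definition bary (m : nat) (i : lattice m) (k : 'I_3) : R :=
  if (m <= 1)%N then 3^-1 else
  let a := (val i).1 : nat in let b := (val i).2 : nat in
  nth 0 [:: a%:R; b%:R; (m.-1 - a - b)%N%:R] k / m.-1%:R.
Definition nodeT T (m : nat) (i : lattice m) : R * R :=
  \sum_k bary i k *: vtx T k.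

(* r + 1 equispaced parameters of [0, 1]. *)
Definition nodeE (r : nat) (j : 'I_r.+1) : R :=
  if r == 0%N then 2^-1 else j%:R / r%:R.

Section Spaces.
Variables (r : nat) (s : \bar R) (nE : edge -> R * R).
(* The nodal bases of P_(r-1)(T), and of P_r(E) in the edge parameter. *)
Variables (phi : 'I_(ntri M) -> lattice r -> R * R -> R)
          (psi : 'I_r.+1 -> R -> R).
Implicit Types (u : broken) (p : field) (e : edge).

Definition IT T (v : R * R -> R) x : R := \sum_i v (nodeT T i) * phi T i x.
Definition IE (v : R -> R) (t : R) : R := \sum_j v (nodeE j) * psi j t.
Definition cT T i : R := intT T (phi T i).
Definition cE e j : R := intE e (psi j).

Definition jump u e (t : R) : R :=
  let x := gam e.1 t in
  dot (u e.1.1 x *: nout e.1 + u e.2.1 x *: nout e.2) (nE e).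

Definition DTV u : R :=
  \sum_T intT T (IT T (fun x => snorm s (grad (u T) x))) +
  \sum_(e | interior_edge e)
    intE e (IE (fun t => `|jump u e t| * snorm s (nE e))).

Definition sqnorm (D : {set 'I_(ntri M)}) u : R :=
  \sum_(T in D) intT T (fun x => u T x ^+ 2).

Definition primal (D : {set 'I_(ntri M)}) (beta : R) (f u : broken) : R :=
  2^-1 * sqnorm D (fun T x => u T x - f T x) + beta * DTV u.

(* g is (a representative of) the distributional divergence of p on Omega, and
   it is square integrable. *)
Definition div_is p (g : R * R -> R) :=
  L2 Omega g /\
  forall v, test_function Omega v ->
    \sum_T intT T (fun x => dot (p T x) (grad v x)) =
    - \int[mu2]_(x in Omega) (g x * v x).

Definition Hdiv : set field :=
  [set p | (forall T, L2 (tri T) (fun x => (p T x).1) /\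
                      L2 (tri T) (fun x => (p T x).2)) /\
           exists g, div_is p g].

Definition RT : set field :=
  [set p | Hdiv p /\
    forall T, exists q : (R * R -> R) * (R * R -> R) * (R * R -> R),
      [/\ Plt2 r.+1 q.1.1, Plt2 r.+1 q.1.2, Plt2 r.+1 q.2
        & forall x, p T x = (q.1.1 x, q.1.2 x) + q.2 x *: x]].

Definition RT0 : set field :=
  [set p | RT p /\ forall h, boundary_side h ->
             forall t, 0 <= t <= 1 -> dot (p h.1 (gam h t)) (nout h) = 0].

(* Normal component on an interior edge; it is taken from the first triangle,
   which is immaterial for p in H(div). *)
Definition ntrace p e (t : R) : R := dot (p e.1.1 (gam e.1 t)) (nE e).

Definition sigmaT p T i : R * R :=
  (intT T (fun x => phi T i x * (p T x).1),
   intT T (fun x => phi T i x * (p T x).2)).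
Definition sigmaE p e j : R := intE e (fun t => psi j t * ntrace p e t).

Definition betaP (beta : R) : set field :=
  [set p | [/\ RT0 p,
     forall T i, snorm (hoelder_conjugate s) (sigmaT p T i) <= beta * cT T i
   & forall e, interior_edge e -> forall j,
       `|sigmaE p e j| <= beta * snorm s (nE e) * cE e j]].

Definition Yprod := (field * (edge -> R -> R))%type.
Definition Yset : set Yprod :=
  [set d | (forall T, Plt2 r (fun x => (d.1 T x).1) /\
                      Plt2 r (fun x => (d.1 T x).2)) /\
           (forall e, interior_edge e -> Plt1 r.+1 (d.2 e))].

Definition Lam u : Yprod := (fun T => grad (u T), jump u).

Definition G (d : Yprod) : R :=
  \sum_T intT T (IT T (fun x => snorm s (d.1 T x))) +
  \sum_(e | interior_edge e)
    snorm s (nE e) * intE e (IE (fun t => `|d.2 e t|)).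

Definition F (D : {set 'I_(ntri M)}) (f u : broken) : R :=
  2^-1 * sqnorm D (fun T x => u T x - f T x).

(* Identification of RT0 with the dual of Yset.  With [[u]] = u1 n1 + u2 n2 and
   outer normals n1, n2, elementwise integration by parts gives
     sum_T int_T p . grad u - sum_E int_E (p . nE) [[u]] = - int (div p) u
   (the singular part of the distributional gradient of u is - [[u]]), so that
   the minus sign of the edge terms is the one for which the adjoint of [Lam]
   is - div. *)
Definition pairing p (d : Yprod) : R :=
  \sum_T intT T (fun x => dot (p T x) (d.1 T x)) -
  \sum_(e | interior_edge e) intE e (fun t => ntrace p e t * d.2 e t).

(* F^*(- Lam^* p) + beta G^*(p / beta).  Lam^* p is the functional
   u |-> pairing p (Lam u) on DG. *)
Definition dual_objective (D : {set 'I_(ntri M)}) (beta : R) (f : broken) p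
    : \bar R :=
  (conjugate (DG r) (F D f) (fun u => (- pairing p (Lam u))%R) +
   beta%:E * conjugate Yset G (pairing (fun T x => (beta^-1 *: p T x)%R)))%E.

(* g vanishes almost everywhere on Omega \ Omega0, where the primal problem has
   no data term; elsewhere in the dual space F^* is +oo.  Vacuous when D is the
   whole mesh. *)
Definition zero_off (D : {set 'I_(ntri M)}) (g : R * R -> R) :=
  forall T, T \notin D -> {ae mu2, forall x, tri T x -> g x = 0}.

End Spaces.
End Mesh.

(* Main.v *)
Require Import Defs.
From mathcomp Require Import all_boot all_order all_algebra.
From mathcomp Require Import all_classical all_reals all_analysis.
From mathcomp Require Import measurable_realfun zify ring lra.
Import Order.TTheory GRing.Theory Num.Theory.
Import numFieldNormedType.Exports.
Set Implicit Arguments.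
Unset Strict Implicit.
Unset Printing Implicit Defensive.
Local Open Scope classical_set_scope.
Local Open Scope ring_scope.

(** The dual objective is the sum of two conjugates that are computed separately.

The conjugate of [G] (lemmas [conjugate_G0] and [conjugate_G_pinfty]).  In the
nodal bases the pairing and [G] are sums over the nodes, and each node carries
its own independent value [d]: a vector, paired with the degree of freedom
[sigma_(T,i)] and penalized by [c_(T,i) |d|_s], or a number, paired with
[sigma_(E,j)] and penalized by [|n_E|_s c_(E,j) |d|].  Both expressions are positively homogeneous in [d], so the
supremum is [0] or [+oo], and it is [0] exactly when every degree of freedom
is bounded in the dual norm by its weight.  For the vectors this is the
sharpness of the two-term Hoelder inequality ([snorm_dual]).

The conjugate of the data term (lemmas [conjugate_F_zero_off] and
[conjugate_F_pinfty]).  If the adjoint of [Lam] is [- div], the value at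
[- Lam^* p] is the supremum over [u] of [int (div p) u - 1/2 |u - f|^2].  On a triangle
that carries data, completing the square gives
[1/2 |div p + f|^2 - 1/2 |f|^2], attained at [u = f + div p], which lies in the
finite element space because [div p] has degree at most [r] ([RT_div]); the
constant is therefore [- 1/2 |f|^2].  On the other triangles the functional is
linear in [u] and bounded only if [div p] vanishes there.

What remains is the identity [<p, Lam u> = - sum_T int_T (div p) u]
([pairing_Lam]).  Its starting point is Gauss' theorem on a triangle
([gauss_x], [gauss_y], [gauss_tri]), summed over the mesh ([gauss_broken]).  The
divergence of [p] is given in the sense of distributions, so two facts have to
be extracted from test functions.  Test functions supported in one open
triangle show that [g] is almost everywhere the elementwise divergence
([ae_pdiv], by [fundamental_lemma]).  Test functions supported near an inner
point of an interior side show that the normal components of [p] from the two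
triangles agree ([ntr_shared]).  Then the boundary terms of Gauss' theorem can
be collected ([sum_partner]): on a boundary side they vanish, and an interior
side belongs to exactly two triangles, which lie on opposite sides of it
([opposite], [shared_unique], [nout_opposite]), so that its two contributions
combine into the jump of [u]. *)

(** * Measure and continuity on the plane *)

Section PlaneMeasure.
Context {R : realType}.
Implicit Types (x y : R * R) (v : R * R -> R) (U D : set (R * R)).

Definition orect (a b c d : R) : set (R * R) := `]a, b[ `*` `]c, d[.
Definition crect (a b c d : R) : set (R * R) := `[a, b] `*` `[c, d].

Lemma measurable_orect a b c d : measurable (orect a b c d).
Proof. by apply: measurableX. Qed.

Lemma measurable_crect a b c d : measurable (crect a b c d).
Proof. by apply: measurableX. Qed.

Lemma compact_crect a b c d : compact (crect a b c d).
Proof. by apply: compact_setX; exact: segment_compact. Qed.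

Lemma mu2_crect_lty a b c d : (mu2 (crect a b c d) < +oo)%E.
Proof.
rewrite /mu2 product_measure1E//= !lebesgue_measure_itv/=.
by case: ifP => _; case: ifP => _; rewrite ?mule0 ?mul0e ?ltry.
Qed.

(** Rectangles with rational corners form a countable basis of the plane.  This
makes open sets measurable for the product sigma-algebra, and it lets null sets
be tested on countably many rectangles. *)
Lemma open_rat_rect U x : open U -> U x ->
  exists q : rat * rat * (rat * rat),
    orect (ratr q.1.1) (ratr q.1.2) (ratr q.2.1) (ratr q.2.2) x /\
    crect (ratr q.1.1) (ratr q.1.2) (ratr q.2.1) (ratr q.2.2) `<=` U.
Proof.
move=> oU Ux; have /nbhs_ballP[e /= e0 eU] : nbhs x U by apply: open_nbhs_nbhs.
have lo (t : R) : t - e < t by rewrite ltrBlDr ltrDl.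
have hi (t : R) : t < t + e by rewrite ltrDl.
have [q1 /[!in_itv]/= /andP[q1a q1b]] := rat_in_itvoo (lo x.1).
have [q2 /[!in_itv]/= /andP[q2a q2b]] := rat_in_itvoo (hi x.1).
have [q3 /[!in_itv]/= /andP[q3a q3b]] := rat_in_itvoo (lo x.2).
have [q4 /[!in_itv]/= /andP[q4a q4b]] := rat_in_itvoo (hi x.2).
exists ((q1, q2), (q3, q4)); split => /=.
  by split; rewrite /= in_itv/=; apply/andP; split.
move=> y [/= /[!in_itv]/= /andP[y1 y2] /andP[y3 y4]]; apply: eU.
split; rewrite /ball/= ltr_distlC; apply/andP; split; lra.
Qed.

Lemma open_measurable2 U : open U -> measurable U.
Proof.
move=> oU.
pose rr (q : rat * rat * (rat * rat)) : set (R * R) :=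
  crect (ratr q.1.1) (ratr q.1.2) (ratr q.2.1) (ratr q.2.2).
have -> : U = \bigcup_q (if `[< rr q `<=` U >] then rr q else set0).
  apply/seteqP; split => [x Ux|x [q _]]; last by case: asboolP => // h /h.
  have [q [xq qU]] := open_rat_rect oU Ux.
  exists q => //; case: asboolP => // _; case: xq.
  by rewrite /rr/= /crect !in_itv/= => /andP[a1 a2] /andP[a3 a4];
    split; rewrite /= in_itv/= !ltW.
apply: countable_bigcupT_measurable; first exact: countableP.
by move=> q; case: asboolP => // _; apply: measurable_crect.
Qed.

Lemma continuous_measurable2 v : continuous v -> measurable_fun [set: R * R] v.
Proof.
move=> cv; apply: (measurability _ (RGenOpens.measurableE R)).
move=> _ [_ [a [b ->]] <-]; rewrite setTI; apply: open_measurable2.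
by have /continuousP := cv; apply; exact: interval_open.
Qed.

Lemma continuous_integrable2 (a b c d : R) D v : measurable D ->
  D `<=` crect a b c d -> continuous v -> mu2.-integrable D (EFin \o v).
Proof.
move=> mD Dr cv; apply: (@integrableS _ _ _ mu2 (crect a b c d)) => //.
  exact: measurable_crect.
apply: measurable_bounded_integrable.
- exact: measurable_crect.
- exact: mu2_crect_lty.
- by apply: measurable_funTS; exact: continuous_measurable2.
- have /compact_bounded : compact (v @` crect a b c d).
    apply: continuous_compact; last exact: compact_crect.
    exact: continuous_subspaceT.
  move=> [M [Mr h]]; exists M; split => // N MN y ry.
  by apply: (h N MN); exists y.
Qed.

End PlaneMeasure.

(** * Integration on the line and Fubini *)

Section Calculus1.
Context {R : realType}.
Implicit Types (a b c d t : R) (k W : R -> R).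
Local Notation mu := (@lebesgue_measure R).

Lemma integrable_itv a b k : continuous k -> mu.-integrable `[a, b] (EFin \o k).
Proof.
move=> ck; apply: continuous_compact_integrable; first exact: segment_compact.
exact: continuous_subspaceT.
Qed.

Lemma integral_derive a b W k : a <= b -> (forall t, derivable W t 1) ->
  derive1 W = k -> continuous k -> \int[mu]_(t in `[a, b]) k t = W b - W a.
Proof.
rewrite le_eqVlt => /predU1P[->|ab] dW Wk ck.
  by rewrite set_itv1 Rintegral_set1 subrr.
have cW : continuous W by move=> t; apply/differentiable_continuous/derivable1_diffP.
rewrite /Rintegral (@continuous_FTC2 _ k W)//.
- exact: continuous_subspaceT.
- split; first by move=> t _; exact: dW.
  + exact: cvg_at_right_filter (cW a).
  + exact: cvg_at_left_filter (cW b).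
- by move=> t _; rewrite Wk.
Qed.

Lemma is_derive_affine c d t : is_derive t 1 (fun t : R => c + t * d) d.
Proof. apply: is_derive_eq. by rewrite scaler0 !add0r mul1r /GRing.scale/= mulr1. Qed.

(** Turns an integral over the heights of a side into an integral over its
parameter. *)
Lemma integral_affine c d k : c <= d -> continuous k ->
  \int[mu]_(y in `[c, d]) k y =
  (d - c) * \int[mu]_(t in `[0, 1]) k (c + t * (d - c)).
Proof.
rewrite le_eqVlt => /predU1P[->|cd] ck.
  by rewrite set_itv1 Rintegral_set1 subrr mul0r.
pose A (t : R) := c + t * (d - c).
have dA t : is_derive t 1 A (d - c) by exact: is_derive_affine.
have cA : continuous A.
  by move=> t; apply/differentiable_continuous/derivable1_diffP.
have A'E : derive1 A = cst (d - c).
  by apply/funext => t; rewrite derive1E derive_val.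
have ckA : continuous (k \o A) by move=> t; apply: continuous_comp; [exact: cA|exact: ck].
rewrite -RintegralZl//; last exact: integrable_itv.
have A0 : A 0 = c by rewrite /A mul0r addr0.
have A1 : A 1 = d by rewrite /A mul1r addrC subrK.
rewrite /Rintegral; congr fine.
have := @integration_by_substitution_increasing _ A k 0 1.
rewrite A0 A1 A'E => ->//.
- by apply: eq_integral => t _; rewrite /= mulrC.
- by move=> x y _ _ xy; rewrite /A ltrD2l ltr_pM2r// subr_gt0.
- by move=> x _; exact: cst_continuous.
- exact: is_cvg_cst.
- exact: is_cvg_cst.
- split; first by move=> t _; exact: ex_derive.
  + exact: cvg_at_right_filter (cA 0).
  + exact: cvg_at_left_filter (cA 1).
- exact: continuous_subspaceT.
Qed.

Lemma integral_reverse k : continuous k ->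
  \int[mu]_(t in `[0, 1]) k t = \int[mu]_(t in `[0, 1]) k (1 - t).
Proof.
move=> ck; rewrite (@Rintegration_by_substitution_onem _ k 1) ?ler01 ?lexx//.
  by rewrite unstable.onem1.
exact: continuous_subspaceT.
Qed.

End Calculus1.

Section PlaneFubini.
Context {R : realType}.
Local Notation mu := (@lebesgue_measure R).
Implicit Types (k : R * R -> R).

Lemma Rfubini_y k : mu2.-integrable setT (EFin \o k) ->
  \int[mu2]_z k z = fine (\int[mu]_y \int[mu]_x (k (x, y))%:E)%E.
Proof. by move=> ik; rewrite /Rintegral -(integral21_prod_meas1 ik). Qed.

Lemma Rfubini_swap k : mu2.-integrable setT (EFin \o k) ->
  \int[mu2]_z k z = fine (\int[mu]_x \int[mu]_y (k (x, y))%:E)%E.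
Proof. by move=> ik; rewrite /Rintegral -(integral12_prod_meas1 ik). Qed.

End PlaneFubini.

(** * Gauss' theorem on a triangle *)

Section Triangle.
Context {R : realType}.
Implicit Types (A B C x : R * R) (w : R * R -> R).
Local Notation mu := (@lebesgue_measure R).

Definition tri3 A B C : set (R * R) :=
  [set x | exists a b c : R, [/\ 0 <= a, 0 <= b, 0 <= c, a + b + c = 1 &
     x = a *: A + b *: B + c *: C]].

Lemma det2_bary A B C x : det2 (B - A) (C - A) =
  det2 (B - x) (C - x) + det2 (C - x) (A - x) + det2 (A - x) (B - x).
Proof. by rewrite /det2 /=; ring. Qed.

(** Cramer's rule: the three determinants are the barycentric coordinates of [x],
multiplied by the determinant of the triangle. *)
Lemma bary_sum A B C x : det2 (B - A) (C - A) *: x =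
  det2 (B - x) (C - x) *: A + det2 (C - x) (A - x) *: B + det2 (A - x) (B - x) *: C.
Proof.
case: A B C x => [A1 A2] [B1 B2] [Ck1 C2] [x1 x2].
by rewrite /det2 /=; congr pair; rewrite /= /GRing.scale/=; ring.
Qed.

Lemma det2_comb A B C (a b c : R) x : a + b + c = 1 ->
  x = a *: A + b *: B + c *: C -> det2 (B - x) (C - x) = a * det2 (B - A) (C - A).
Proof.
move=> abc ->; have -> : a = 1 - b - c by rewrite -abc; ring.
case: A B C => [A1 A2] [B1 B2] [Ck1 C2].
by rewrite /det2 /= /GRing.scale/=; ring.
Qed.

Lemma tri3_rot A B C : tri3 A B C = tri3 B C A.
Proof.
rewrite eqEsubset; split => x [a [b [c [a0 b0 c0 abc ->]]]].
  exists b, c, a; split => //; first by rewrite -abc; ring.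
  by rewrite -addrA addrC.
exists c, a, b; split => //; first by rewrite -abc; ring.
by rewrite addrC -addrA addrA.
Qed.

Lemma tri3_swap A B C : tri3 A B C = tri3 B A C.
Proof.
by rewrite eqEsubset; split => x [a [b [c [a0 b0 c0 abc ->]]]];
  exists b, a, c; split => //; rewrite 1?[b + a]addrC 1?[b *: _ + _]addrC.
Qed.

(** The factor [det2 (B - A) (C - A)] makes the sign conditions independent of the
orientation of the triangle. *)
Lemma tri3P A B C x : det2 (B - A) (C - A) != 0 ->
  tri3 A B C x <->
  [/\ 0 <= det2 (B - A) (C - A) * det2 (B - x) (C - x),
      0 <= det2 (B - A) (C - A) * det2 (C - x) (A - x) &
      0 <= det2 (B - A) (C - A) * det2 (A - x) (B - x)].
Proof.
set d := det2 (B - A) _ => d0; split.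
  move=> [a [b [c [a0 b0 c0 abc xE]]]].
  have E1 := det2_comb abc xE.
  have E2 : det2 (C - x) (A - x) = b * d.
    rewrite (@det2_comb B C A b c a) -?abc//; [|ring|by rewrite xE -addrA addrC].
    by rewrite /d /det2/=; ring.
  have E3 : det2 (A - x) (B - x) = c * d.
    rewrite (@det2_comb C A B c a b) -?abc//; [|ring|by rewrite xE addrC -addrA addrA].
    by rewrite /d /det2/=; ring.
  rewrite E1 E2 E3 -/d.
  by split; rewrite mulrCA mulr_ge0// -expr2 sqr_ge0.
move=> [h1 h2 h3].
have dd (y : R) : 0 <= d * y -> 0 <= y / d.
  move=> dy; have -> : y / d = (d * y) * (d ^- 2) by field.
  by rewrite mulr_ge0// invr_ge0 sqr_ge0.
exists (det2 (B - x) (C - x) / d), (det2 (C - x) (A - x) / d), (det2 (A - x) (B - x) / d).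
split; [exact: dd|exact: dd|exact: dd| |].
  by rewrite -!mulrDl -det2_bary divff.
transitivity (d^-1 *: (d *: x)); first by rewrite scalerA mulVf// scale1r.
rewrite {2}/d (bary_sum A B C x).
by rewrite !scalerDr !scalerA ![d^-1 * _]mulrC.
Qed.
End Triangle.

Section TriangleMeasure.
Context {R : realType}.
Implicit Types (A B C x : R * R) (w : R * R -> R).
Local Notation mu := (@lebesgue_measure R).

Lemma continuous_fst1 : continuous (fun x : R * R => x.1).
Proof. by move=> x; exact: cvg_fst. Qed.

Lemma continuous_snd2 : continuous (fun x : R * R => x.2).
Proof. by move=> x; exact: cvg_snd. Qed.

Lemma continuous_det2 A B : continuous (fun x => det2 (A - x) (B - x)).
Proof.
move=> x; rewrite /det2/=.
by apply: cvgB; apply: cvgM; apply: cvgB; do ?[exact: cvg_cst];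
   first [exact: cvg_fst|exact: cvg_snd].
Qed.

Lemma measurable_ge0 (g : R * R -> R) : continuous g -> measurable [set x | 0 <= g x].
Proof.
move=> cg; rewrite -[X in measurable X]setTI.
have -> : [set x | 0 <= g x] = g @^-1` `[0, +oo[.
  by apply/seteqP; split => x /=; rewrite in_itv/= andbT.
by apply: continuous_measurable2.
Qed.

Lemma measurable_tri3 A B C : det2 (B - A) (C - A) != 0 -> measurable (tri3 A B C).
Proof.
move=> d0; set d := det2 (B - A) (C - A).
have cd P Q : continuous (fun x => d * det2 (P - x) (Q - x)).
  by move=> x; apply: cvgM; [exact: cvg_cst|exact: continuous_det2].
rewrite (_ : tri3 A B C = [set x | 0 <= d * det2 (B - x) (C - x)] `&`
  ([set x | 0 <= d * det2 (C - x) (A - x)] `&` [set x | 0 <= d * det2 (A - x) (B - x)])).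
  by apply: measurableI; [|apply: measurableI]; exact: measurable_ge0.
by apply/seteqP; split => x; [move/(tri3P x d0) => [? ? ?]|
  move=> [? [? ?]]; apply/(tri3P x d0)].
Qed.

Lemma tri3_bounded A B C : exists a b c d : R, tri3 A B C `<=` crect a b c d.
Proof.
pose M := `|A.1| + `|B.1| + `|C.1|; pose N := `|A.2| + `|B.2| + `|C.2|.
exists (- M), M, (- N), N => x [a [b [c [a0 b0 c0 abc ->]]]].
have H (p q r : R) : `|a * p + b * q + c * r| <= `|p| + `|q| + `|r|.
  apply: (le_trans (ler_normD _ _)); apply: lerD.
    apply: (le_trans (ler_normD _ _)); apply: lerD.
      by rewrite normrM ger0_norm// ler_piMl//; lra.
    by rewrite normrM ger0_norm// ler_piMl//; lra.
  by rewrite normrM ger0_norm// ler_piMl//; lra.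
by split; rewrite /= in_itv/= -ler_norml; exact: H.
Qed.

Lemma integrable_tri3 A B C w : det2 (B - A) (C - A) != 0 -> continuous w ->
  mu2.-integrable (tri3 A B C) (EFin \o w).
Proof.
move=> d0 cw; have [a [b [c [d T]]]] := tri3_bounded A B C.
by apply: (continuous_integrable2 _ T) => //; exact: measurable_tri3.
Qed.

(** The sign of [d] says which of [p] and [q] is the left end, so that this form
of the fundamental theorem of calculus serves triangles of both orientations. *)
Lemma integral_between (d p q : R) (k W : R -> R) : d != 0 -> 0 <= d * (q - p) ->
  (forall t, derivable W t 1) -> derive1 W = k -> continuous k ->
  (\int[mu]_(t in [set t | 0 <= d * (q - t) /\ 0 <= d * (t - p)]%R) (k t)%:E =
  (Num.sg d * (W q - W p))%:E)%E.
Proof.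
move=> d0 dpq dW Wk ck.
have E a b : a <= b -> (\int[mu]_(t in `[a, b]) (k t)%:E = (W b - W a)%:E)%E.
  move=> ab; rewrite -(integral_derive ab dW Wk ck) /Rintegral fineK//.
  by apply: integrable_fin_num; [|exact: integrable_itv].
have [dp|dn|/eqP] := ltrgt0P d; last by rewrite (negbTE d0).
  have pq : p <= q by rewrite -subr_ge0 -(pmulr_rge0 _ dp).
  rewrite gtr0_sg// mul1r -(E _ _ pq).
  congr (integral _ _ _); apply/seteqP; split => t /=; rewrite !pmulr_rge0// !subr_ge0 in_itv/=.
    by move=> [-> ->].
  by move=> /andP[-> ->].
have qp : q <= p by rewrite -subr_le0 -(nmulr_rge0 _ dn).
rewrite ltr0_sg// mulN1r opprB -(E _ _ qp).
congr (integral _ _ _); apply/seteqP; split => t /=; rewrite !nmulr_rge0// !subr_le0 in_itv/=.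
  by move=> [-> ->].
by move=> /andP[-> ->].
Qed.

(** The abscissa, at height [y], of the line through [A] and [B], which must not be
horizontal. *)
Definition xline A B (y : R) := A.1 + (y - A.2) * ((B.1 - A.1) / (B.2 - A.2)).

Definition lint A B w := \int[mu]_(t in `[0, 1]) w (A + t *: (B - A)).

Lemma continuous_xline A B : continuous (xline A B).
Proof.
move=> y; apply: cvgD; first exact: cvg_cst.
by apply: cvgM; [apply: cvgB; [exact: cvg_id|exact: cvg_cst]|exact: cvg_cst].
Qed.

Lemma continuous_lift w (g : R -> R) : continuous w -> continuous g ->
  continuous (fun y => w (g y, y)).
Proof.
move=> cw cg y; apply: (@continuous_comp _ _ _ (fun y => (g y, y)) w); last exact: cw.
exact: (cvg_pair (cg y) (@cvg_id _ (nbhs y))).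
Qed.

Lemma lint_height A B w : continuous w -> A.2 <= B.2 ->
  \int[mu]_(y in `[A.2, B.2]) w (xline A B y, y) = (B.2 - A.2) * lint A B w.
Proof.
move=> cw; rewrite le_eqVlt => /predU1P[->|AB].
  by rewrite set_itv1 Rintegral_set1 subrr mul0r.
have cx := continuous_lift cw (@continuous_xline A B).
rewrite (integral_affine (ltW AB) cx).
congr (_ * _); apply: eq_Rintegral => t _.
congr (w _); rewrite /xline; congr pair => /=; rewrite /GRing.scale/=.
by field; rewrite subr_eq0 gt_eqF.
Qed.

End TriangleMeasure.

Lemma integrable_patch d (T : measurableType d) (R : realType)
    (m : {measure set T -> \bar R}) (D : set T) (k : T -> R) : measurable D ->
  m.-integrable D (EFin \o k) -> m.-integrable setT (EFin \o (k \_ D)).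
Proof. by move=> mD ik; rewrite -restrict_EFin; exact/(integrable_mkcond _ mD). Qed.

Lemma integrable_in_itv (R : realType) (a b : R) (i : interval R) (k : R -> R) :
  continuous k -> [set` i] `<=` `[a, b]%classic ->
  (@lebesgue_measure R).-integrable [set` i] (EFin \o k).
Proof. by move=> ck iab; have := integrable_itv a b ck; apply: integrableS. Qed.

Lemma integrable_itvoo (R : realType) (a b : R) (k : R -> R) : continuous k ->
  (@lebesgue_measure R).-integrable `]a, b[ (EFin \o k).
Proof. by move=> ck; apply: (@integrable_in_itv _ a b) => //; exact: subset_itv_oo_cc. Qed.

Section Gauss.
Context {R : realType}.
Implicit Types (A B C x : R * R) (w : R * R -> R).
Local Notation mu := (@lebesgue_measure R).

Lemma det2_xline A B x : A.2 != B.2 ->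
  det2 (A - x) (B - x) = (B.2 - A.2) * (xline A B x.2 - x.1).
Proof. by move=> AB; rewrite /xline /det2/=; field; rewrite subr_eq0 eq_sym. Qed.

Lemma ae_neq (a : R) : {ae mu, forall y, y != a}.
Proof.
exists [set a]; split => //; first exact: lebesgue_measure_set1.
by move=> y /= /negP; rewrite negbK => /eqP.
Qed.

Section Ordered.
Variables (A B C : R * R) (w : R * R -> R).
Hypotheses (d0 : det2 (B - A) (C - A) != 0) (AB : A.2 <= B.2) (BC : B.2 <= C.2).
Hypotheses (cw : continuous w) (dw : forall x, derivable (fun t : R => w (t, x.2)) x.1 1).
Hypothesis cdw : continuous (d1 w).
Let d := det2 (B - A) (C - A).

Lemma integral_slice (p q y : R) : 0 <= d * (q - p) ->
  (\int[mu]_(t in [set t | 0 <= d * (q - t) /\ 0 <= d * (t - p)]%R) (d1 w (t, y))%:E =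
  (Num.sg d * (w (q, y) - w (p, y)))%:E)%E.
Proof.
move=> pq; apply: (@integral_between _ d p q _ (fun t => w (t, y))) => //.
- by move=> t; exact: (@dw (t, y)).
- move=> t; apply: (@continuous_comp _ _ _ (fun t => (t, y)) (d1 w)); last exact: cdw.
  exact: (cvg_pair (@cvg_id _ (nbhs t)) (cvg_cst y)).
Qed.

Let S1 y := Num.sg d * (w (xline A B y, y) - w (xline A C y, y)).
Let S2 y := Num.sg d * (w (xline B C y, y) - w (xline A C y, y)).

(** Below the middle vertex a horizontal slice ends on [AB] and on [AC]; the
condition that belongs to [BC] holds automatically there. *)
Lemma slice_low y : A.2 < y < B.2 ->
  (\int[mu]_(t in [set t | tri3 A B C (t, y)]) (d1 w (t, y))%:E = (S1 y)%:E)%E.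
Proof.
move=> /andP[Ay yB]; have AB' : A.2 < B.2 by exact: lt_trans yB.
have AC' : A.2 < C.2 by exact: lt_le_trans BC.
have yC : y < C.2 by exact: lt_le_trans BC.
have EB t := @det2_xline A B (t, y) (negbT (lt_eqF AB')).
have EC t : det2 (C - (t, y)) (A - (t, y)) = (C.2 - A.2) * (t - xline A C y).
  by rewrite (@det2_xline C A) ?gt_eqF//= /xline; field; rewrite !subr_eq0 gt_eqF ?lt_eqF.
rewrite -integral_slice; last first.
  rewrite -(pmulr_rge0 _ (_ : 0 < (B.2 - A.2) * (C.2 - A.2))) ?mulr_gt0 ?subr_gt0//.
  rewrite [X in 0 <= X](_ : _ = d ^+ 2 * (y - A.2)); last first.
    by rewrite /d /xline /det2/=; field; rewrite !subr_eq0 !gt_eqF.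
  by rewrite mulr_ge0 ?sqr_ge0// subr_ge0 ltW.
congr (integral _ _ _); apply/seteqP; split => t /=.
  move/(tri3P _ d0) => [_]; rewrite EB EC -/d => h2 h3.
  rewrite -(pmulr_rge0 _ (_ : 0 < B.2 - A.2)) ?subr_gt0// mulrCA h3.
  by rewrite -(pmulr_rge0 _ (_ : 0 < C.2 - A.2)) ?subr_gt0// mulrCA h2.
move=> [h3 h2]; apply/(tri3P _ d0); rewrite EB EC -/d.
have k2 : 0 <= d * ((C.2 - A.2) * (t - xline A C y)).
  by rewrite mulrCA mulr_ge0// subr_ge0 ltW.
have k3 : 0 <= d * ((B.2 - A.2) * (xline A B y - t)).
  by rewrite mulrCA mulr_ge0// subr_ge0 ltW.
split => //; rewrite -EC in k2; rewrite -EB in k3.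
(* y is the weighted mean of the three heights: a (y - A.2) = b (B.2 - y) + c (C.2 - y) *)
rewrite -(pmulr_rge0 _ (_ : 0 < y - A.2)) ?subr_gt0//.
rewrite [X in 0 <= X](_ : _ = (B.2 - y) * (d * det2 (C - (t, y)) (A - (t, y))) +
   (C.2 - y) * (d * det2 (A - (t, y)) (B - (t, y)))).
  by rewrite addr_ge0// mulr_ge0// subr_ge0 ltW.
by rewrite /det2/=; ring.
Qed.

Lemma slice_high y : B.2 < y < C.2 ->
  (\int[mu]_(t in [set t | tri3 A B C (t, y)]) (d1 w (t, y))%:E = (S2 y)%:E)%E.
Proof.
move=> /andP[By yC]; have BC' : B.2 < C.2 by exact: lt_trans yC.
have AC' : A.2 < C.2 by exact: le_lt_trans BC'.
have Ay : A.2 < y by exact: le_lt_trans By.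
have EB t := @det2_xline B C (t, y) (negbT (lt_eqF BC')).
have EC t : det2 (C - (t, y)) (A - (t, y)) = (C.2 - A.2) * (t - xline A C y).
  by rewrite (@det2_xline C A) ?gt_eqF//= /xline; field; rewrite !subr_eq0 gt_eqF ?lt_eqF.
rewrite -integral_slice; last first.
  rewrite -(pmulr_rge0 _ (_ : 0 < (C.2 - B.2) * (C.2 - A.2))) ?mulr_gt0 ?subr_gt0//.
  rewrite [X in 0 <= X](_ : _ = d ^+ 2 * (C.2 - y)); last first.
    by rewrite /d /xline /det2/=; field; rewrite !subr_eq0 !gt_eqF.
  by rewrite mulr_ge0 ?sqr_ge0// subr_ge0 ltW.
congr (integral _ _ _); apply/seteqP; split => t /=.
  move/(tri3P _ d0) => []; rewrite EB EC -/d => h1 h2 _.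
  rewrite -(pmulr_rge0 _ (_ : 0 < C.2 - B.2)) ?subr_gt0// mulrCA h1.
  by rewrite -(pmulr_rge0 _ (_ : 0 < C.2 - A.2)) ?subr_gt0// mulrCA h2.
move=> [h3 h2]; apply/(tri3P _ d0); rewrite EB EC -/d.
have k2 : 0 <= d * ((C.2 - A.2) * (t - xline A C y)).
  by rewrite mulrCA mulr_ge0// subr_ge0 ltW.
have k3 : 0 <= d * ((C.2 - B.2) * (xline B C y - t)).
  by rewrite mulrCA mulr_ge0// subr_ge0 ltW.
split => //; rewrite -EC in k2; rewrite -EB in k3.
rewrite -(pmulr_rge0 _ (_ : 0 < C.2 - y)) ?subr_gt0//.
rewrite [X in 0 <= X](_ : _ = (y - B.2) * (d * det2 (C - (t, y)) (A - (t, y))) +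
   (y - A.2) * (d * det2 (B - (t, y)) (C - (t, y)))).
  by rewrite addr_ge0// mulr_ge0// subr_ge0 ltW.
by rewrite /det2/=; ring.
Qed.

Lemma slice_out y : (y < A.2) || (C.2 < y) -> [set t | tri3 A B C (t, y)] = set0.
Proof.
move=> h; apply/seteqP; split => // t /= [a [b [c [a0 b0 c0 abc [_ yE]]]]].
move: h; rewrite yE /GRing.scale/=.
have -> : a = 1 - b - c by rewrite -abc; ring.
have a0' : 0 <= 1 - b - c by lra.
have AC : A.2 <= C.2 by exact: le_trans BC.
have h1 : 0 <= b * (B.2 - A.2) by rewrite mulr_ge0// subr_ge0.
have h2 : 0 <= c * (C.2 - A.2) by rewrite mulr_ge0// subr_ge0.
have h3 : 0 <= (1 - b - c) * (C.2 - A.2) by rewrite mulr_ge0// subr_ge0.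
have h4 : 0 <= b * (C.2 - B.2) by rewrite mulr_ge0// subr_ge0.
by case/orP => h; lra.
Qed.

(** Fubini in horizontal slices.  The fundamental theorem of calculus leaves the
values of [w] at the two ends of each slice, and as the height varies these ends
run along the sides.  With the vertices sorted by height, one end is always on
the long side [AC], the other on [AB] and then on [BC]. *)
Lemma gauss_ordered :
  \int[mu2]_(x in tri3 A B C) d1 w x = Num.sg d *
  ((B.2 - A.2) * lint A B w + (C.2 - B.2) * lint B C w - (C.2 - A.2) * lint A C w).
Proof.
have mT := measurable_tri3 d0.
have iT := integrable_tri3 d0 cdw.
rewrite Rintegral_mkcond Rfubini_y; last first.
  exact: integrable_patch.
have cAB : continuous (fun y => w (xline A B y, y)) by apply: continuous_lift => //; exact: continuous_xline.
have cBC : continuous (fun y => w (xline B C y, y)) by apply: continuous_lift => //; exact: continuous_xline.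
have cAC : continuous (fun y => w (xline A C y, y)) by apply: continuous_lift => //; exact: continuous_xline.
have cS1 : continuous S1.
  by move=> y; apply: cvgM; [exact: cvg_cst|apply: cvgB; [exact: cAB|exact: cAC]].
have cS2 : continuous S2.
  by move=> y; apply: cvgM; [exact: cvg_cst|apply: cvgB; [exact: cBC|exact: cAC]].
pose S y := (S1 \_ `]A.2, B.2[) y + (S2 \_ `]B.2, C.2[) y.
have iS1 : mu.-integrable `]A.2, B.2[ (EFin \o S1).
  exact: integrable_itvoo.
have iS2 : mu.-integrable `]B.2, C.2[ (EFin \o S2).
  exact: integrable_itvoo.
have iS1' : mu.-integrable setT (EFin \o (S1 \_ `]A.2, B.2[)).
  exact: integrable_patch.
have iS2' : mu.-integrable setT (EFin \o (S2 \_ `]B.2, C.2[)).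
  exact: integrable_patch.
have iff : mu2.-integrable setT (EFin \o (d1 w \_ (tri3 A B C))).
  exact: integrable_patch.
transitivity (fine (\int[mu]_y (S y)%:E)%E).
  congr fine; apply: ae_eq_integral => //.
  - exact: (measurable_fubini_G iff).
  - apply/measurable_EFinP; rewrite /S; apply: measurable_funD.
      by apply/measurable_EFinP; exact: (measurable_int mu iS1').
    by apply/measurable_EFinP; exact: (measurable_int mu iS2').
  - near=> y => _.
    have yA : y != A.2 by near: y; exact: ae_neq.
    have yB : y != B.2 by near: y; exact: ae_neq.
    have yC : y != C.2 by near: y; exact: ae_neq.
    rewrite (_ : (\int[mu]_x _)%E = (\int[mu]_(t in [set t | tri3 A B C (t, y)]) (d1 w (t, y))%:E)%E); last first.
      rewrite [RHS]integral_mkcond; apply: eq_integral => x _.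
      rewrite /patch /= (_ : (x \in _) = ((x, y) \in tri3 A B C)); last first.
        by apply/idP/idP; rewrite !in_setE.
      by case: ifPn.
    rewrite /S !patchE !mem_setE !in_itv/=.
    have [yA'|yA'|yAe] := ltgtP y A.2; last by rewrite yAe eqxx in yA.
      rewrite slice_out ?yA'// integral_set0 (lt_gtF (lt_le_trans yA' AB)) /=.
      by rewrite addr0.
    have [yB'|yB'|yBe] := ltgtP y B.2; last by rewrite yBe eqxx in yB.
      by rewrite slice_low ?yA'// addr0.
    have [yC'|yC'|yCe] := ltgtP y C.2; last by rewrite yCe eqxx in yC.
      by rewrite slice_high ?yB'// add0r.
    by rewrite slice_out ?yC' ?orbT// integral_set0 addr0.
rewrite -[LHS]/(Rintegral _ _ _) /S RintegralD// -!Rintegral_mkcond.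
have cc a b (k : R -> R) : continuous k ->
    \int[mu]_(y in `]a, b[) k y = \int[mu]_(y in `[a, b]) k y.
  move=> ck; rewrite Rintegral_itv_obnd_cbnd ?Rintegral_itv_bndo_bndc//.
  - apply: (@integrable_in_itv _ a b) => // t /=.
    by rewrite !in_itv/= => /andP[-> /ltW].
  - exact: integrable_itvoo.
rewrite !cc// /S1 /S2 !RintegralZl//; do ?[exact: integrable_itv|
  by apply: integrable_itv => y; apply: cvgB; [exact: cAB|exact: cAC]|
  by apply: integrable_itv => y; apply: cvgB; [exact: cBC|exact: cAC]].
rewrite !RintegralB//; do ?exact: integrable_itv.
rewrite !lint_height// -mulrDr; congr (_ * _).
have := lint_height cw (le_trans AB BC : (A.2 <= C.2)).
have -> : \int[mu]_(y in `[A.2, C.2]) w (xline A C y, y) =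
  \int[mu]_(y in `[A.2, B.2]) w (xline A C y, y) +
  \int[mu]_(y in `[B.2, C.2]) w (xline A C y, y).
  have iAC := integrable_itv A.2 C.2 cAC.
  have := Rintegral_itvB iAC (_ : (BLeft A.2 <= BRight B.2)%O) (_ : (BRight B.2 <= BRight C.2)%O).
  rewrite !bnd_simp => /(_ AB BC) /eqP; rewrite subr_eq addrC => /eqP ->.
  congr (_ + _); rewrite Rintegral_itv_obnd_cbnd//; apply: (@integrable_in_itv _ A.2 C.2) => // t /=.
  by rewrite !in_itv/= => /andP[/ltW h ->]; rewrite (le_trans AB).
by move=> <-; ring.
Unshelve. all: by end_near.
Qed.

End Ordered.
End Gauss.

(** The instance at [mu2], with measurability in the canonical sigma-algebra of the
product: unification does not identify the two displays unaided.  The same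
holds for [integrableS2], [integrableB2] and [integrable_bounded_mul2]. *)
Lemma integrable_patch2 (R : realType) (D : set (R * R)) (k : R * R -> R) : measurable D ->
  mu2.-integrable D (EFin \o k) -> mu2.-integrable setT (EFin \o (k \_ D)).
Proof. by move=> mD ik; apply: (@integrable_patch _ _ _ mu2 D k). Qed.

Section GaussTriangle.
Context {R : realType}.
Implicit Types (A B C x : R * R) (w : R * R -> R).
Local Notation mu := (@lebesgue_measure R).

Lemma continuous_segment w A B : continuous w -> continuous (fun t : R => w (A + t *: (B - A))).
Proof.
move=> cw t; apply: (@continuous_comp _ _ _ (fun t : R => A + t *: (B - A)) w); last exact: cw.
by apply: cvgD; [exact: cvg_cst|apply: cvgZl; exact: cvg_id].
Qed.

Lemma lint_sym w A B : continuous w -> lint A B w = lint B A w.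
Proof.
move=> cw; rewrite /lint integral_reverse; last exact: continuous_segment.
apply: eq_Rintegral => t _; congr w.
by congr pair; rewrite /= /GRing.scale/=; ring.
Qed.

Lemma det2_rot A B C : det2 (C - B) (A - B) = det2 (B - A) (C - A).
Proof. by rewrite /det2/=; ring. Qed.

Lemma det2_swap A B C : det2 (A - B) (C - B) = - det2 (B - A) (C - A).
Proof. by rewrite /det2/=; ring. Qed.

Definition flux_x A B C w :=
  (B.2 - A.2) * lint A B w + (C.2 - B.2) * lint B C w + (A.2 - C.2) * lint C A w.

Definition flux_y A B C w :=
  (B.1 - A.1) * lint A B w + (C.1 - B.1) * lint B C w + (A.1 - C.1) * lint C A w.

(** Both members are invariant under rotation of the vertices and under exchange
of two of them, so that the vertices may be sorted by height. *)
Lemma gauss_x A B C w : det2 (B - A) (C - A) != 0 -> continuous w ->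
  (forall x, derivable (fun t : R => w (t, x.2)) x.1 1) -> continuous (d1 w) ->
  \int[mu2]_(x in tri3 A B C) d1 w x =
  Num.sg (det2 (B - A) (C - A)) * flux_x A B C w.
Proof.
move=> d0 cw dw cdw.
pose P A B C := det2 (B - A) (C - A) != 0 -> \int[mu2]_(x in tri3 A B C) d1 w x =
  Num.sg (det2 (B - A) (C - A)) * flux_x A B C w.
have ord A' B' C' : A'.2 <= B'.2 -> B'.2 <= C'.2 -> P A' B' C'.
  move=> AB BC d0'; rewrite gauss_ordered// (lint_sym _ _ cw).
  by rewrite [lint A' C' w]lint_sym// /flux_x [lint A' B' w]lint_sym//; ring.
have rot A' B' C' : P A' B' C' -> P B' C' A'.
  move=> h; rewrite /P det2_rot -tri3_rot => /h ->.
  by rewrite /flux_x; ring.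
have swp A' B' C' : P A' B' C' -> P B' A' C'.
  move=> h; rewrite /P det2_swap -tri3_swap oppr_eq0 => /h ->.
  rewrite sgrN /flux_x [lint B' A' w]lint_sym// [lint A' C' w]lint_sym//.
  by rewrite [lint C' B' w]lint_sym//; ring.
suff : P A B C by apply.
move: P ord rot swp => P ord rot swp {d0}.
have [AB|/ltW BA] := leP A.2 B.2; have [BC|/ltW CB] := leP B.2 C.2; have [AC|/ltW CA] := leP A.2 C.2.
- exact: ord AB BC.
- exact: ord AB BC.
- exact: swp _ _ _ (rot _ _ _ (rot _ _ _ (ord _ _ _ AC CB))).
- exact: rot _ _ _ (ord _ _ _ CA AB).
- exact: swp _ _ _ (ord _ _ _ BA AC).
- exact: rot _ _ _ (rot _ _ _ (ord _ _ _ BC CA)).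
- exact: rot _ _ _ (rot _ _ _ (swp _ _ _ (ord _ _ _ CB BA))).
- exact: rot _ _ _ (rot _ _ _ (swp _ _ _ (ord _ _ _ CB BA))).
Qed.

Let sw x := (x.2, x.1).

Lemma continuous_swap : continuous sw.
Proof. by move=> x; exact: (cvg_pair (@cvg_snd _ _ _ _ _) (@cvg_fst _ _ _ _ _)). Qed.

(** The reflection in the diagonal exchanges the partial derivatives and reverses
the orientation of the triangle, which is where the sign comes from. *)
Lemma gauss_y A B C w : det2 (B - A) (C - A) != 0 -> continuous w ->
  (forall x, derivable (fun t : R => w (x.1, t)) x.2 1) -> continuous (d2 w) ->
  \int[mu2]_(x in tri3 A B C) d2 w x =
  - Num.sg (det2 (B - A) (C - A)) * flux_y A B C w.
Proof.
move=> d0 cw dw cdw.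
have csw (g : R * R -> R) : continuous g -> continuous (g \o sw).
  by move=> cg x; apply: continuous_comp; [exact: continuous_swap|exact: cg].
have d1E : d1 (w \o sw) = d2 w \o sw by [].
have dE : det2 (sw B - sw A) (sw C - sw A) = - det2 (B - A) (C - A).
  by rewrite /det2 /=; ring.
have lE P Q : lint (sw P) (sw Q) (w \o sw) = lint P Q w.
  by apply: eq_Rintegral => t _ /=; congr w.
have d0' : det2 (sw B - sw A) (sw C - sw A) != 0 by rewrite dE oppr_eq0.
have dsw x : derivable (fun t : R => (w \o sw) (t, x.2)) x.1 1 by exact: (dw (sw x)).
have cdsw : continuous (d1 (w \o sw)) by rewrite d1E; exact: csw.
have fluxE : flux_x (sw A) (sw B) (sw C) (w \o sw) = flux_y A B C w by rewrite /flux_x !lE.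
have := gauss_x d0' (csw _ cw) dsw cdsw; rewrite fluxE d1E dE sgrN => <-.
rewrite d1E in cdsw.
have swT x : tri3 (sw A) (sw B) (sw C) x = tri3 A B C (sw x).
  apply/propext; rewrite (tri3P _ d0') (tri3P _ d0) dE.
  have dd P Q : - det2 (B - A) (C - A) * det2 (sw P - x) (sw Q - x) =
      det2 (B - A) (C - A) * det2 (P - sw x) (Q - sw x).
    by rewrite /det2/=; ring.
  by rewrite !dd.
have patch_sw : (d2 w \o sw) \_ (tri3 (sw A) (sw B) (sw C)) = (d2 w \_ (tri3 A B C)) \o sw.
  apply/funext => x; rewrite /= !patchE (_ : (x \in _) = (sw x \in tri3 A B C))//.
  by apply/idP/idP; rewrite !in_setE swT.
rewrite Rintegral_mkcond Rfubini_swap; last first.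
  exact: (integrable_patch2 (measurable_tri3 d0) (integrable_tri3 d0 cdw)).
rewrite [RHS]Rintegral_mkcond Rfubini_y; last first.
  exact: (integrable_patch2 (measurable_tri3 d0') (integrable_tri3 d0' cdsw)).
by rewrite patch_sw.
Qed.

End GaussTriangle.

(** * Smooth bump functions *)

Section Smooth1.
Context {R : realType}.
Implicit Types (f g : R -> R) (a b t : R).

(** One-dimensional counterpart of [Ck]; products of two such functions of one
variable each are smooth on the plane ([Ck_tensor]). *)
Fixpoint Ck1 (n : nat) f : Prop :=
  match n with
  | 0 => continuous f
  | m.+1 => exists f', (forall t, is_derive t 1 f (f' t)) /\ Ck1 m f'
  end.

Lemma is_derive_continuous f f' : (forall t, is_derive t 1 f (f' t)) -> continuous f.
Proof. by move=> df t; apply/differentiable_continuous/derivable1_diffP; exact: ex_derive. Qed.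

Lemma Ck1_continuous n f : Ck1 n f -> continuous f.
Proof. by case: n => //= n [f' [df _]]; exact: is_derive_continuous df. Qed.

Lemma Ck1W n f : Ck1 n.+1 f -> Ck1 n f.
Proof.
elim: n f => [|n IH] f.
  by move=> h; exact: Ck1_continuous h.
by move=> [f' [df h]]; exists f'; split => //; exact: IH.
Qed.

Lemma Ck1D n f g : Ck1 n f -> Ck1 n g -> Ck1 n (fun t => f t + g t).
Proof.
elim: n f g => [|n IH] f g /=.
  by move=> cf cg t; apply: cvgD; [exact: cf|exact: cg].
move=> [f' [df cf]] [g' [dg cg]]; exists (fun t => f' t + g' t); split; last exact: IH.
by move=> t; exact: is_deriveD.
Qed.

Lemma Ck1M n f g : Ck1 n f -> Ck1 n g -> Ck1 n (fun t => f t * g t).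
Proof.
elim: n f g => [|n IH] f g.
  by move=> cf cg t; apply: cvgM; [exact: cf|exact: cg].
move=> hf hg; have [f' [df cf]] := hf; have [g' [dg cg]] := hg.
exists (fun t => f t * g' t + g t * f' t); split.
  by move=> t; exact: is_deriveM.
by apply: Ck1D; apply: IH => //; exact: Ck1W.
Qed.

Lemma Ck1_cst n a : Ck1 n (fun=> a).
Proof.
elim: n a => [|n IH] a /=; first exact: cst_continuous.
by exists (fun=> 0); split => // t; exact: is_derive_cst.
Qed.

Lemma Ck1_affine n f a b : Ck1 n f -> Ck1 n (fun t => f (a + t * b)).
Proof.
elim: n f => [|n IH] f /=.
  move=> cf t; apply: (@continuous_comp _ _ _ (fun t => a + t * b) f); last exact: cf.
  by apply: cvgD; [exact: cvg_cst|apply: cvgMl; exact: cvg_id].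
move=> [f' [df cf]]; exists (fun t => b * f' (a + t * b)); split.
  move=> t; have := @is_derive1_comp _ f (fun t => a + t * b) t _ _ (df _) (is_derive_affine a b t).
  by rewrite mulrC.
by apply: Ck1M; [exact: Ck1_cst|exact: IH].
Qed.

(** [t^-n exp (- 1 / t)] for positive [t], extended by [0].  The case [n = 0] is
the classical flat function; the powers are there because derivatives of members
of the family are linear combinations of members ([is_derive_flat]). *)
Definition flat (n : nat) t : R := if 0 < t then t^-1 ^+ n * expR (- t^-1) else 0.

Lemma exprn_le_expR n (y : R) : 0 <= y -> y ^+ n <= n`!%:R * expR y.
Proof.
move=> y0; case: n => [|n].
  by rewrite expr0 mul1r -(@expR0 R) ler_expR.
rewrite -ler_pdivrMl ?ltr0n ?fact_gt0// mulrC.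
by apply: le_trans (expR_ge1Dxn n y0); rewrite lerDr.
Qed.

Lemma flat_ge0 n t : 0 <= flat n t.
Proof.
by rewrite /flat; case: ifP => // t0; rewrite mulr_ge0 ?expR_ge0// exprn_ge0// invr_ge0 ltW.
Qed.

Lemma flat_le n t : flat n t <= n`!%:R.
Proof.
rewrite /flat; case: ifP => [t0|_]; last by rewrite ler0n.
by rewrite expRN ler_pdivrMr ?expR_gt0// exprn_le_expR// invr_ge0 ltW.
Qed.

Lemma flatSS n t : flat n t = t ^+ 2 * flat n.+2 t.
Proof.
rewrite /flat; case: ifP => t0; last by rewrite mulr0.
by rewrite mulrA; congr (_ * _); rewrite !exprS; field; rewrite gt_eqF.
Qed.

(** At the origin the difference quotient is [h * flat n.+2 h], which is bounded
by a multiple of [h]. *)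
Lemma is_derive_flat n t : is_derive t 1 (flat n) (flat n.+2 t - n%:R * flat n.+1 t).
Proof.
have [t0|t0|t0] := ltgtP 0 t.
- pose g (t : R) := t^-1 ^+ n * expR (- t^-1).
  apply: (@near_eq_is_derive _ _ _ g).
    near=> u; rewrite /flat ifT//; near: u; exact: lt_nbhsr.
  have dV : is_derive t 1 (fun t : R => t^-1) (- t ^- 2).
    have := @is_deriveV _ id t 1 1 (negbT (gt_eqF t0)) (is_derive_id _ _).
    by rewrite /GRing.scale/= mulr1.
  have dE : is_derive t 1 (fun t : R => expR (- t^-1)) (t ^- 2 * expR (- t^-1)).
    have := @is_derive1_comp _ expR (fun t : R => - t^-1) t _ _ (is_derive_expR _) (is_deriveN dV).
    by rewrite opprK mulrC.
  have dX := @is_deriveX _ _ _ n _ _ _ dV; rewrite exprfctE in dX.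
  apply: (is_derive_eq (is_deriveM dX dE)); rewrite /flat t0 /GRing.scale/=.
  by rewrite -!exprVn; case: (n) => [|m]; rewrite /= !exprS ?expr0; ring.
- apply: (@near_eq_is_derive _ _ _ (cst 0)).
    near=> u; rewrite /flat ifF//; apply/negbTE; rewrite -leNgt ltW//; near: u; exact: lt_nbhsl.
  rewrite /flat !ifF ?(lt_gtF t0)// mulr0 subrr.
  exact: is_derive_cst.
- have f0 m : flat m 0 = 0 by rewrite /flat ltxx.
  rewrite -t0 !f0 mulr0 subrr.
  have lim0 : (fun h : R => h^-1 *: (flat n (h *: (1 : R) + 0) - flat n 0)) @ 0^' --> (0 : R).
    apply/cvgrPdist_le => e e0; pose K : R := n.+2`!%:R.
    have K0 : 0 < K by rewrite ltr0n fact_gt0.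
    near=> h; have h0 : h != 0 by near: h; exact: nbhs_dnbhs_neq.
    rewrite f0 subr0 addr0 /GRing.scale/= mulr1 sub0r normrN flatSS.
    rewrite [X in `|X|](_ : _ = h * flat n.+2 h); last by field.
    rewrite normrM (ger0_norm (flat_ge0 _ _)).
    apply: (@le_trans _ _ (`|h| * K)); first by rewrite ler_wpM2l// flat_le.
    rewrite -ler_pdivlMr//; near: h; apply: dnbhs0_le; exact: divr_gt0.
  by apply: DeriveDef; [apply/cvg_ex; exists 0|exact: cvg_lim].
Unshelve. all: by end_near.
Qed.

End Smooth1.

Section Bump.
Context {R : realType}.
Implicit Types (f g : R -> R) (a b c d k t : R) (x : R * R).

Lemma Ck1_flat n m : Ck1 n (@flat R m).
Proof.
elim: n m => [|n IH] m; first exact: is_derive_continuous (@is_derive_flat R m).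
exists (fun t => flat m.+2 t - m%:R * flat m.+1 t); split; first exact: is_derive_flat.
apply: Ck1D; first exact: IH.
rewrite (_ : (fun t => _) = (fun t => - m%:R * flat m.+1 t)).
  by apply: Ck1M; [exact: Ck1_cst|exact: IH].
by apply/funext => t; rewrite mulNr.
Qed.

Lemma Ck_tensor n f g : (forall m, Ck1 m f) -> (forall m, Ck1 m g) ->
  Ck n (fun x => f x.1 * g x.2).
Proof.
elim: n f g => [|n IH] f g hf hg.
  move=> x; apply: cvgM.
    by apply: continuous_comp; [exact: cvg_fst|exact: (hf 0%N)].
  by apply: continuous_comp; [exact: cvg_snd|exact: (hg 0%N)].
have [f' [df _]] := hf 1%N; have [g' [dg _]] := hg 1%N.
have uni h h1 h2 : (forall t : R, is_derive t (1 : R) h (h1 t)) -> (forall t, is_derive t (1 : R) h (h2 t)) -> h1 = h2 :> (R -> R).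
  by move=> H1 H2; apply/funext => t; rewrite -(@derive_val _ _ _ _ _ _ _ (H1 t)) -(@derive_val _ _ _ _ _ _ _ (H2 t)).
have hf' m : Ck1 m f' by have [f2 [df2 ?]] := hf m.+1; rewrite (uni _ _ _ df df2).
have hg' m : Ck1 m g' by have [g2 [dg2 ?]] := hg m.+1; rewrite (uni _ _ _ dg dg2).
have D1 x : is_derive x.1 (1 : R) (fun t => f t * g x.2) (f' x.1 * g x.2).
  have := is_deriveM (df x.1) (is_derive_cst (g x.2) x.1 1).
  by move/is_derive_eq; apply; rewrite /= /GRing.scale/= mulr0 add0r mulrC.
have D2 x : is_derive x.2 (1 : R) (fun t => f x.1 * g t) (f x.1 * g' x.2).
  have := is_deriveM (is_derive_cst (f x.1) x.2 1) (dg x.2).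
  by move/is_derive_eq; apply; rewrite /= /GRing.scale/= mulr0 addr0.
split.
- by move=> x; have [] := D1 x.
- by move=> x; have [] := D2 x.
- rewrite (_ : d1 _ = fun x => f' x.1 * g x.2); first exact: IH.
  by apply/funext => x; rewrite /d1 derive1E (@derive_val _ _ _ _ _ _ _ (D1 x)).
- rewrite (_ : d2 _ = fun x => f x.1 * g' x.2); first exact: IH.
  by apply/funext => x; rewrite /d2 derive1E (@derive_val _ _ _ _ _ _ _ (D2 x)).
Qed.

(** As the sharpness [k] grows, the bump tends to the indicator of [`]a, b[] while
its support stays inside [`[a, b]]. *)
Definition bump k a b t := flat 0 (- (k * a) + t * k) * flat 0 (k * b + t * - k).

Lemma Ck1_bump n k a b : Ck1 n (bump k a b).
Proof. by apply: Ck1M; apply: Ck1_affine; exact: Ck1_flat. Qed.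

Lemma bump_ge0 k a b t : 0 <= bump k a b t.
Proof. by rewrite mulr_ge0// flat_ge0. Qed.

Lemma bump_le1 k a b t : bump k a b t <= 1.
Proof. by rewrite /bump mulr_ile1// ?flat_ge0//; exact: (flat_le 0). Qed.

Lemma flat_gt0 n t : (0 < flat n t) = (0 < t).
Proof.
rewrite /flat; case: ifP => [t0|_]; last by rewrite ltxx.
by rewrite mulr_gt0 ?expR_gt0// exprn_gt0// invr_gt0.
Qed.

Lemma bump_gt0 k a b t : 0 < k -> (0 < bump k a b t) = (a < t < b).
Proof.
move=> k0; have -> : (0 < bump k a b t) = (0 < flat 0 (- (k * a) + t * k)) && (0 < flat 0 (k * b + t * - k)).
  rewrite /bump !lt0r mulf_eq0 negb_or !flat_ge0 mulr_ge0 ?flat_ge0//.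
  by rewrite !andbT.
rewrite !flat_gt0; congr (_ && _).
  by rewrite [t * k]mulrC addrC -mulrBr pmulr_rgt0// subr_gt0.
by rewrite mulrN [t * k]mulrC -mulrBr pmulr_rgt0// subr_gt0.
Qed.

Lemma flat0_cvg t : 0 < t -> flat 0 (n.+1%:R * t) @[n --> \oo] --> (1 : R).
Proof.
move=> t0.
have -> : (fun n => flat 0 (n.+1%:R * t)) = (fun n => expR (- (n.+1%:R^-1 * t^-1))).
  by apply/funext => n; rewrite /flat pmulr_rgt0 ?ltr0n// t0 mul1r invfM.
have h : (n.+1%:R^-1 * t^-1) @[n --> \oo] --> (0 : R).
  by rewrite -[X in _ --> X](mul0r t^-1); apply: cvgMl; exact: cvg_harmonic.
rewrite -[X in _ --> X]expR0 -oppr0.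
apply: (cvg_comp _ _ (cvgN h)); exact: continuous_expR.
Qed.

Lemma bump_cvg a b t : a < t < b -> bump n.+1%:R a b t @[n --> \oo] --> (1 : R).
Proof.
move=> /andP[at_ tb]; rewrite -[X in _ --> X](mulr1 1); apply: cvgM.
  have -> : (fun n => flat 0 (- (n.+1%:R * a) + t * n.+1%:R)) = (fun n => flat 0 (n.+1%:R * (t - a))).
    by apply/funext => n; congr flat; ring.
  by apply: flat0_cvg; rewrite subr_gt0.
have -> : (fun n => flat 0 (n.+1%:R * b + t * - n.+1%:R)) = (fun n => flat 0 (n.+1%:R * (b - t))).
  by apply/funext => n; congr flat; ring.
by apply: flat0_cvg; rewrite subr_gt0.
Qed.

Definition bump2 k a b c d x := bump k a b x.1 * bump k c d x.2.

Lemma Ck_bump2 n k a b c d : Ck n (bump2 k a b c d).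
Proof. by apply: Ck_tensor => m; exact: Ck1_bump. Qed.

Lemma bump2_ge0 k a b c d x : 0 <= bump2 k a b c d x.
Proof. by rewrite mulr_ge0// bump_ge0. Qed.

Lemma bump2_le1 k a b c d x : bump2 k a b c d x <= 1.
Proof. by rewrite mulr_ile1// ?bump_ge0// bump_le1. Qed.

Lemma bump2_gt0 k a b c d x : 0 < k -> (0 < bump2 k a b c d x) = (x \in orect a b c d).
Proof.
move=> k0; rewrite /bump2 lt0r mulf_eq0 negb_or mulr_ge0 ?bump_ge0// andbT.
have E p q t : (bump k p q t != 0) = (p < t < q) by rewrite -(bump_gt0 _ _ _ k0) lt0r bump_ge0 andbT.
rewrite !E; apply/andP/idP => [[h1 h2]|]; rewrite in_setE.
  by split; rewrite /= in_itv.
by move=> [/=]; rewrite !in_itv.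
Qed.

Lemma bump2_cvg a b c d x :
  bump2 n.+1%:R a b c d x @[n --> \oo] --> (\1_(orect a b c d) x : R).
Proof.
rewrite indicE; case: (boolP (x \in _)) => [|xn].
  rewrite in_setE => -[/=]; rewrite !in_itv/= => x1 x2.
  by rewrite -[X in _ --> X](mulr1 1); apply: cvgM; exact: bump_cvg.
apply: cvg_near_cst; apply: nearW => n; apply/eqP; move: xn.
by rewrite -(bump2_gt0 _ _ _ _ _ (_ : 0 < n.+1%:R))// lt0r bump2_ge0 andbT negbK.
Qed.

Lemma test_bump2 (U : set (R * R)) k a b c d : 0 < k -> crect a b c d `<=` U ->
  test_function U (bump2 k a b c d).
Proof.
move=> k0 rU.
have sub : [set x | bump2 k a b c d x != 0] `<=` crect a b c d.
  move=> x /= xn; have : 0 < bump2 k a b c d x by rewrite lt0r xn bump2_ge0.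
  rewrite bump2_gt0// in_setE => -[/=]; rewrite !in_itv/= => /andP[h1 h2] /andP[h3 h4].
  by split; rewrite /= in_itv/= !ltW.
have cl : closed (crect a b c d).
  apply: compact_closed; last exact: compact_crect.
  exact: norm_hausdorff.
have := closure_subset sub; rewrite -((closure_id (crect a b c d)).1 cl) => clsub.
split; [by move=> n; exact: Ck_bump2| |exact: subset_trans clsub rU].
apply: subclosed_compact clsub; first exact: closed_closure.
exact: compact_crect.
Qed.

End Bump.

(** * The fundamental lemma of the calculus of variations *)

Lemma integrable_mfun d (T : measurableType d) (R : realType)
    (m : {measure set T -> \bar R}) (D : set T) (k : T -> R) :
  m.-integrable D (EFin \o k) -> measurable_fun D k.
Proof. by move=> /measurable_int/measurable_EFinP. Qed.

Lemma ae_mono (R : realType) (P Q : R * R -> Prop) : (forall x, P x -> Q x) ->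
  {ae mu2, forall x, P x} -> {ae mu2, forall x, Q x}.
Proof. by move=> PQ [N [mN N0 sub]]; exists N; split => // x /= nQ; apply: sub => /= /PQ. Qed.

Section FundamentalLemma.
Context {R : realType}.
Implicit Types (a b c d : R) (x : R * R) (U : set (R * R)).
Local Notation mu := (@lebesgue_measure R).

Let rects : set (set (R * R)) :=
  [set X | exists a b c d : R, X = orect a b c d].

Lemma orectI a b c d a' b' c' d' : orect a b c d `&` orect a' b' c' d' =
  orect (Num.max a a') (Num.min b b') (Num.max c c') (Num.min d d').
Proof.
apply/seteqP; split => x; rewrite /orect /= !in_itv/= !lt_min !gt_max.
  by move=> [[/andP[-> ->] /andP[-> ->]] [/andP[-> ->] /andP[-> ->]]].
by move=> [/andP[/andP[-> ->] /andP[-> ->]] /andP[/andP[-> ->] /andP[-> ->]]].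
Qed.

(** Unlike products of arbitrary measurable sets, open rectangles carry test
functions, and they are still a pi-system that generates the product
sigma-algebra. *)
Lemma measurable_rects : @measurable _ (R * R)%type = <<s rects >>.
Proof.
apply/seteqP; split; last first.
  apply: smallest_sub; first exact: sigma_algebra_measurable.
  by move=> _ [a [b [c [d ->]]]]; exact: measurable_orect.
have bnd (t : R) : exists n : nat, - n%:R < t < n%:R.
  exists (Num.bound `|t|); rewrite -ltr_norml; exact: archi_boundP.
have mfst (A : set R) : measurable A -> <<s rects >> (A `*` setT).
  have -> : A `*` [set: R] = fst @^-1` A by apply/seteqP; split => x //= [].
  move=> mA; have : measurable_fun setT (fst : g_sigma_algebraType rects -> R).
    apply: (measurability _ (RGenOpens.measurableE R)).
    move=> _ [_ [a [b ->]] <-]; rewrite setTI.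
    rewrite (_ : _ @^-1` _ = \bigcup_n orect a b (- n%:R) n%:R).
      by apply: bigcupT_measurable => n; apply: sub_sigma_algebra; exists a, b, (- n%:R), n%:R.
    apply/seteqP; split => [x /= x1|x [n _ []]//].
    by have [n nx] := bnd x.2; exists n => //; split; rewrite //= in_itv.
  by move=> /(_ measurableT A mA); rewrite setTI.
have msnd (A : set R) : measurable A -> <<s rects >> (setT `*` A).
  have -> : [set: R] `*` A = snd @^-1` A by apply/seteqP; split => x //= [].
  move=> mA; have : measurable_fun setT (snd : g_sigma_algebraType rects -> R).
    apply: (measurability _ (RGenOpens.measurableE R)).
    move=> _ [_ [a [b ->]] <-]; rewrite setTI.
    rewrite (_ : _ @^-1` _ = \bigcup_n orect (- n%:R) n%:R a b).
      by apply: bigcupT_measurable => n; apply: sub_sigma_algebra; exists (- n%:R), n%:R, a, b.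
    apply/seteqP; split => [x /= x1|x [n _ []]//].
    by have [n nx] := bnd x.1; exists n => //; split; rewrite //= in_itv.
  by move=> /(_ measurableT A mA); rewrite setTI.
rewrite measurable_prod_measurableType.
apply: smallest_sub; first exact: smallest_sigma_algebra.
move=> _ [A mA [B mB <-]].
rewrite (_ : A `*` B = (A `*` setT) `&` (setT `*` B)).
  have mAT : measurable (A `*` setT : set (g_sigma_algebraType rects)) := mfst _ mA.
  have mTB : measurable (setT `*` B : set (g_sigma_algebraType rects)) := msnd _ mB.
  exact: (measurableI _ _ mAT mTB).
by rewrite -setXI setIT setTI.
Qed.

(** Dynkin's theorem: the sets on which [h] integrates to zero form a
lambda-system, so it suffices to know the integrals over rectangles. *)
Lemma integral0_rects (h : R * R -> R) a b c d :
  mu2.-integrable (orect a b c d) (EFin \o h) ->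
  (forall a' b' c' d', crect a' b' c' d' `<=` crect a b c d ->
     (\int[mu2]_(x in orect a' b' c' d') (h x)%:E = 0)%E) ->
  {ae mu2, forall x, orect a b c d x -> h x = 0}.
Proof.
set Q := orect a b c d => ih h0.
have mQ : measurable Q by exact: measurable_orect.
have iS S : measurable S -> mu2.-integrable (S `&` Q) (EFin \o h).
  by move=> mS; apply: integrableS ih => //; do ?[exact: measurableI|exact: subIsetr].
have P S : measurable S -> (\int[mu2]_(x in S `&` Q) (h x)%:E = 0)%E.
  rewrite measurable_rects; move: S; apply: dynkin_induction.
  - exact: measurable_rects.
  - move=> _ _ [a1 [b1 [c1 [d1 ->]]]] [a2 [b2 [c2 [d2 ->]]]]; rewrite orectI.
    by do 4 eexists.
  - by rewrite setTI; exact: h0.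
  - move=> _ [a1 [b1 [c1 [d1 ->]]]]; rewrite /Q orectI; apply: h0 => x.
    rewrite /crect /= !in_itv/= !le_min !ge_max.
    by move=> [/andP[/andP[_ ->] /andP[_ ->]] /andP[/andP[_ ->] /andP[_ ->]]].
  - move=> S mS S0; have Q0 : (\int[mu2]_(x in Q) (h x)%:E = 0)%E by exact: h0.
    have QE : Q = (S `&` Q) `|` (~` S `&` Q) by rewrite -setIUl setUv setTI.
    move: Q0; rewrite {1}QE integral_setU_EFin//=.
    + by rewrite S0 add0e.
    + exact: measurableI.
    + by apply: measurableI => //; exact: measurableC.
    + by rewrite -QE; exact: integrable_mfun ih.
    + by apply/disj_setPS => x [[Sx _] [nSx _]].
  - move=> F mF tF F0; rewrite setI_bigcupl integral_bigcup.
    + by apply: eseries0 => i _ _; exact: F0.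
    + exact: trivIset_setIr.
    + by move=> k; apply: (measurableI _ _ (mF k) mQ).
    + rewrite -setI_bigcupl; apply: iS; exact: bigcupT_measurable.
have := @integral_ae_eq _ _ _ mu2 Q mQ (cst 0) (EFin \o h) ih (measurable_cst _).
case=> [E EQ mE|N [mN N0 sub]].
  by rewrite integral0 -(P E mE); congr integral; apply/esym/setIidl.
by exists N; split => // x /= nx; apply: sub => /= ex; apply: nx => Qx; have [] := ex Qx.
Qed.

(** Along bumps of increasing sharpness, dominated convergence shows that [h]
integrates to zero over every rectangle whose closure is in [U]; countably many
such rectangles cover [U]. *)
Lemma fundamental_lemma U (h : R * R -> R) : open U ->
  mu2.-integrable U (EFin \o h) ->
  (forall v, test_function U v -> \int[mu2]_(x in U) (h x * v x) = 0) ->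
  {ae mu2, forall x, U x -> h x = 0}.
Proof.
move=> oU ih hv.
have mU := open_measurable2 oU.
have mh := integrable_mfun ih.
have rect0 a b c d : crect a b c d `<=` U ->
    (\int[mu2]_(x in orect a b c d) (h x)%:E = 0)%E.
  move=> rU; pose f_ n x := (h x * bump2 n.+1%:R a b c d x)%:E.
  have mb n : measurable_fun setT (bump2 n.+1%:R a b c d).
    by apply: continuous_measurable2; exact: (@Ck_bump2 _ 0).
  have [] := @dominated_convergence _ _ _ mu2 U mU f_
     (fun x => (h x * \1_(orect a b c d) x)%:E) (abse \o (EFin \o h)).
  - move=> n; apply/measurable_EFinP/measurable_funM; first by [].
    exact: (measurable_funTS (mb n)).
  - apply/measurable_EFinP/measurable_funM; first by [].
    by apply: measurable_indic; exact: measurable_orect.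
  - apply: aeW => x Ux; apply: cvg_EFin; first by apply: nearW.
    by apply: cvgM; [exact: cvg_cst|exact: bump2_cvg].
  - exact: integrable_abse.
  - apply: aeW => x n Ux /=; rewrite lee_fin normrM ler_piMr//.
    by rewrite ger0_norm ?bump2_ge0// bump2_le1.
  move=> _ _ cv.
  have E n : (\int[mu2]_(x in U) f_ n x = 0)%E.
    have := hv _ (test_bump2 (ltr0Sn R n) rU).
    rewrite /Rintegral => /eqP; rewrite fine_eq0 => [/eqP//|].
    apply: integrable_fin_num => //; apply: le_integrable ih => //.
      by apply/measurable_EFinP/measurable_funM => //; exact: (measurable_funTS (mb n)).
    move=> x Ux /=; rewrite lee_fin normrM ler_piMr//.
    by rewrite ger0_norm ?bump2_ge0// bump2_le1.
  have : (\int[mu2]_(x in U) (h x * \1_(orect a b c d) x)%:E = 0)%E.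
    by apply: (cvg_unique _ cv); [|rewrite (_ : [sequence _]_n = cst 0%E); [exact: cvg_cst|apply/funext]].
  have QU : orect a b c d `<=` U.
    by apply: subset_trans rU => x [/= h1 h2]; split; exact: subset_itv_oo_cc.
  rewrite (_ : (fun x => (h x * _)%:E) = (fun x => (h x)%:E) \_ (orect a b c d)); last first.
    apply/funext => x; rewrite indicE patchE; case: ifP => _; first by rewrite mulr1.
    by rewrite mulr0.
  by rewrite -integral_mkcondr (setIidr QU).
pose rr (q : rat * rat * (rat * rat)) : set (R * R) :=
  crect (ratr q.1.1) (ratr q.1.2) (ratr q.2.1) (ratr q.2.2).
pose oo (q : rat * rat * (rat * rat)) : set (R * R) :=
  orect (ratr q.1.1) (ratr q.1.2) (ratr q.2.1) (ratr q.2.2).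
have H q : rr q `<=` U -> {ae mu2, forall x, oo q x -> h x = 0}.
  move=> qU; apply: integral0_rects.
    apply: integrableS ih => //; first exact: measurable_orect.
    apply: subset_trans qU => x [/= h1 h2]; rewrite /rr /crect.
    by split; exact: subset_itv_oo_cc.
  by move=> a' b' c' d' /subset_trans/(_ qU); exact: rect0.
have : {ae mu2, forall x n, if unpickle n is Some q then rr q `<=` U -> oo q x -> h x = 0 else True}.
  apply: ae_foralln => n; case: (unpickle n) => [q|]; last exact: aeW.
  have [qU|nqU] := pselect (rr q `<=` U); last by apply: aeW => x /nqU.
  by apply: ae_mono (H q qU) => x.
apply: ae_mono => x hx Ux; have [q [xq qU]] := open_rat_rect oU Ux.
by have := hx (pickle q); rewrite pickleK; apply.
Qed.
End FundamentalLemma.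

(** * Barycentric geometry of a triangulation *)

Section Cyclic3.

Lemma ordSS3 (i : 'I_3) : ordS (ordS i) = ord_pred i.
Proof. by apply/val_inj; case: i => [[|[|[|]]] ?]. Qed.

Lemma ord_predP3 (i : 'I_3) : ord_pred (ord_pred i) = ordS i.
Proof. by apply/val_inj; case: i => [[|[|[|]]] ?]. Qed.

Lemma ordS_neq3 (i : 'I_3) : (ordS i == i) = false.
Proof. by case: i => [[|[|[|]]] ?]. Qed.

Lemma ord_pred_neq3 (i : 'I_3) : (ord_pred i == i) = false.
Proof. by case: i => [[|[|[|]]] ?]. Qed.

Lemma ordS_pred_neq3 (i : 'I_3) : (ordS i == ord_pred i) = false.
Proof. by case: i => [[|[|[|]]] ?]. Qed.

Lemma ord3P (i k : 'I_3) : [\/ k = i, k = ordS i | k = ord_pred i].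
Proof.
case: i k => [[|[|[|//]]] ?] [[|[|[|//]]] ?];
  solve [ by apply: Or31; apply/val_inj | by apply: Or32; apply/val_inj | by apply: Or33; apply/val_inj ].
Qed.

Lemma big_ord3 (V : zmodType) (F : 'I_3 -> V) i :
  \sum_k F k = F i + F (ordS i) + F (ord_pred i).
Proof.
rewrite (bigD1 i)//= (bigD1 (ordS i)) ?ordS_neq3//= (bigD1 (ord_pred i))/=; last first.
  by rewrite ord_pred_neq3 eq_sym ordS_pred_neq3.
rewrite big1 ?addr0 ?addrA// => k /andP[/andP[k1 k2] k3].
by have [ki|ki|ki] := ord3P i k; rewrite ki eqxx in k1 k2 k3.
Qed.

Lemma ordS3E : (ordS (0 : 'I_3) = 1) * (ordS (1 : 'I_3) = 2) * (ordS (2 : 'I_3) = 0).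
Proof. by do !split; apply/val_inj. Qed.

Lemma ord_pred3E : (ord_pred (0 : 'I_3) = 2) * (ord_pred (1 : 'I_3) = 0) * (ord_pred (2 : 'I_3) = 1).
Proof. by do !split; apply/val_inj. Qed.

End Cyclic3.

Section TriangleGeometry.
Context {R : realType}.
Variable M : mesh R.
Implicit Types (T : 'I_(ntri M)) (x y : R * R) (h : Defs.half M).
Hypothesis nondeg : forall T, det2 (vtx T 1 - vtx T 0) (vtx T 2 - vtx T 0) != 0.

Definition vo h : R * R := vtx h.1 h.2.
Definition detT T := det2 (vtx T 1 - vtx T 0) (vtx T 2 - vtx T 0).

Lemma det2_half h : det2 (ha h - vo h) (hb h - vo h) = detT h.1.
Proof.
case: h => T i; rewrite /ha /hb /vo /detT /=.
have [E|E|E] := ord3P 0 i; subst i.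
- by rewrite ordS3E ord_pred3E.
- by rewrite !ordS3E !ord_pred3E det2_rot.
- by rewrite !ord_pred3E !ordS3E det2_rot det2_rot.
Qed.

Lemma detT_neq0 T : detT T != 0. Proof. exact: nondeg. Qed.

Lemma det2_half_neq0 h : det2 (ha h - vo h) (hb h - vo h) != 0.
Proof. by rewrite det2_half detT_neq0. Qed.

Lemma tri_tri3 h : tri h.1 = tri3 (vo h) (ha h) (hb h).
Proof.
apply/seteqP; split => x.
  move=> [w [w0 w1 ->]]; exists (w h.2), (w (ordS h.2)), (w (ord_pred h.2)).
  by split => //; [rewrite -w1 (big_ord3 _ h.2)|rewrite (big_ord3 _ h.2)].
move=> [a [b [c [a0 b0 c0 abc ->]]]].
exists (fun k => if k == h.2 then a else if k == ordS h.2 then b else c).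
split.
- by move=> k; case: ifP => // _; case: ifP.
- by rewrite (big_ord3 _ h.2) eqxx ordS_neq3 eqxx ord_pred_neq3 eq_sym ordS_pred_neq3.
- by rewrite (big_ord3 _ h.2) eqxx ordS_neq3 eqxx ord_pred_neq3 eq_sym ordS_pred_neq3.
Qed.

(** The barycentric coordinate of [x] that belongs to the vertex opposite to
[h]. *)
Definition lam h x := det2 (ha h - x) (hb h - x) / detT h.1.

Lemma tri_lam T x : tri T x <-> forall i, 0 <= lam (T, i) x.
Proof.
rewrite -[T]/((T, 0 : 'I_3).1) (tri_tri3 (T, 0)) (tri3P _ (det2_half_neq0 _)) det2_half /=.
have E h : 0 <= lam h x <-> 0 <= detT h.1 * det2 (ha h - x) (hb h - x).
  rewrite (_ : _ * _ = lam h x * detT h.1 ^+ 2); last first.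
    by rewrite /lam; field; exact: detT_neq0.
  by rewrite (pmulr_lge0 _ (_ : 0 < detT h.1 ^+ 2)) ?exprn_even_gt0 ?detT_neq0; split.
have E0 := E (T, 0); have E1 := E (T, ordS 0); have E2 := E (T, ord_pred 0).
rewrite /ha /hb /= in E0 E1 E2 *; rewrite !(ordSS3, ordSK, ord_predK, ord_predP3) in E0 E1 E2 *.
split=> [[h0 h1 h2] i|h].
  by have [->|->|->] := ord3P 0 i; [exact/E0|exact/E1|exact/E2].
by split; [exact/E0|exact/E1|exact/E2].
Qed.

Lemma lam_sum h x : lam h x + lam (h.1, ordS h.2) x + lam (h.1, ord_pred h.2) x = 1.
Proof.
rewrite /lam /= -!mulrDl; apply: (canLR (mulfK _)); first exact: detT_neq0.
rewrite mul1r -(det2_half h) [RHS](det2_bary _ _ _ x) /ha /hb /vo /=.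
by rewrite !(ordSS3, ordSK, ord_predK, ord_predP3).
Qed.

Lemma lam_comb h x : x = lam h x *: vo h + lam (h.1, ordS h.2) x *: ha h
  + lam (h.1, ord_pred h.2) x *: hb h.
Proof.
have := bary_sum (vo h) (ha h) (hb h) x; rewrite det2_half => E.
transitivity ((detT h.1)^-1 *: (detT h.1 *: x)).
  by rewrite scalerA mulVf ?scale1r// detT_neq0.
rewrite E !scalerDr !scalerA ![(detT h.1)^-1 * _]mulrC /lam /ha /hb /vo /=.
by rewrite !(ordSS3, ordSK, ord_predK, ord_predP3).
Qed.

Lemma lam_affine h a b x y : a + b = 1 -> lam h (a *: x + b *: y) = a * lam h x + b * lam h y.
Proof.
move=> ab; have -> : a = 1 - b by rewrite -ab addrK.
by rewrite /lam /det2/= /GRing.scale/=; field; exact: detT_neq0.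
Qed.

Lemma lam_affine3 h a b c x y z : a + b + c = 1 ->
  lam h (a *: x + b *: y + c *: z) = a * lam h x + b * lam h y + c * lam h z.
Proof.
move=> abc; have -> : a = 1 - b - c by rewrite -abc; ring.
by rewrite /lam /det2/= /GRing.scale/=; field; exact: detT_neq0.
Qed.

Lemma lam_vo h : lam h (vo h) = 1.
Proof. by rewrite /lam det2_half divff// detT_neq0. Qed.

Lemma lam_ha h : lam h (ha h) = 0.
Proof. by rewrite /lam /det2/=; ring. Qed.

Lemma lam_hb h : lam h (hb h) = 0.
Proof. by rewrite /lam /det2/=; ring. Qed.

Lemma lam_vtx T i j : lam (T, i) (vtx T j) = (i == j)%:R.
Proof.
have [->|->|->] := ord3P i j.
- by rewrite eqxx lam_vo.
- by rewrite eq_sym ordS_neq3 lam_ha.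
- by rewrite eq_sym ord_pred_neq3 lam_hb.
Qed.

Lemma gamE h t : gam h t = (1 - t) *: ha h + t *: hb h.
Proof.
rewrite /gam; case: (ha h) (hb h) => [a1 a2] [b1 b2].
by congr pair; rewrite /= /GRing.scale/=; ring.
Qed.

Lemma lam_gam h h' t : lam h' (gam h t) = (1 - t) * lam h' (ha h) + t * lam h' (hb h).
Proof. by rewrite gamE lam_affine// subrK. Qed.

Lemma side_lam h x : side h x <-> tri h.1 x /\ lam h x = 0.
Proof.
split=> [[t /=]|[/tri_lam Tx hx]].
  rewrite in_itv/= => /andP[t0 t1] <-; split; last by rewrite lam_gam lam_ha lam_hb !mulr0 addr0.
  apply/tri_lam => i; rewrite lam_gam /ha /hb !lam_vtx.
  by rewrite addr_ge0// mulr_ge0// ?ler0n// subr_ge0.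
exists (lam (h.1, ord_pred h.2) x).
  rewrite /= in_itv/= Tx/=; have := lam_sum h x; rewrite hx add0r => <-.
  by rewrite lerDr.
rewrite gamE [RHS](lam_comb h) hx scale0r add0r; congr (_ *: _ + _).
by have := lam_sum h x; rewrite hx add0r => <-; rewrite addrK.
Qed.

Lemma ha_side h : side h (ha h).
Proof. by exists 0; rewrite /= ?in_itv/= ?lexx ?ler01// /gam scale0r addr0. Qed.

Lemma hb_side h : side h (hb h).
Proof. by exists 1; rewrite /= ?in_itv/= ?lexx ?ler01// /gam scale1r addrC subrK. Qed.

Lemma ha_neq_hb h : ha h != hb h.
Proof.
apply/eqP => E; have := det2_half_neq0 h; rewrite E.
by rewrite /det2 mulrC subrr eqxx.
Qed.

Lemma continuous_lam h : continuous (lam h).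
Proof.
by move=> x; apply: cvgM; [exact: continuous_det2|exact: cvg_cst].
Qed.

End TriangleGeometry.

Section SharedSides.
Context {R : realType}.
Variable M : mesh R.
Implicit Types (T : 'I_(ntri M)) (x y : R * R) (h : Defs.half M).
Hypothesis hM : triangulation M.

Let nondeg : forall T, det2 (vtx T 1 - vtx T 0) (vtx T 2 - vtx T 0) != 0.
Proof. by case: hM. Qed.

Lemma side_sub_tri h : side h `<=` tri h.1.
Proof. by move=> x /(side_lam nondeg) []. Qed.

(** Conformity alone allows the two triangles to meet in some other common side;
this is excluded because that side would have to contain the side [h]. *)
Lemma shared_tri h h' : h.1 != h'.1 -> side h = side h' -> tri h.1 `&` tri h'.1 = side h.
Proof.
move=> hh' ss; have [_ _ conf _] := hM.
have aT : tri h.1 (ha h) := side_sub_tri (ha_side h).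
have bT : tri h.1 (hb h) := side_sub_tri (hb_side h).
have aT' : tri h'.1 (ha h) by apply: side_sub_tri; rewrite -ss; exact: ha_side.
have bT' : tri h'.1 (hb h) by apply: side_sub_tri; rewrite -ss; exact: hb_side.
have [E|[i [j [_ E]]]|[i [j [_ E]]]] := conf _ _ hh'.
- have : set0 (ha h) by rewrite -E.
  by [].
- have ea : ha h = vtx h.1 i by have : [set vtx h.1 i] (ha h) by rewrite -E.
  have eb : hb h = vtx h.1 i by have : [set vtx h.1 i] (hb h) by rewrite -E.
  by have := ha_neq_hb nondeg h; rewrite ea eb eqxx.
- rewrite E; congr side; case: h hh' ss aT bT aT' bT' E => T k /= hh' ss aT bT aT' bT' E.
  have /(side_lam nondeg)[_ la] : side (T, i) (ha (T, k)) by rewrite -E.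
  have /(side_lam nondeg)[_ lb] : side (T, i) (hb (T, k)) by rewrite -E.
  congr pair; have [//|ki|ki] := ord3P k i.
    by move: la; rewrite /ha /= ki (lam_vtx nondeg) eqxx => /eqP; rewrite oner_eq0.
  by move: lb; rewrite /hb /= ki (lam_vtx nondeg) eqxx => /eqP; rewrite oner_eq0.
Qed.

(** A segment determines its end points up to order, since they are its extreme
points.  Two half-edges with the same point set may still run in opposite
directions. *)
Lemma segment_ends (a b c d : R * R) : a != b ->
  (fun t : R => a + t *: (b - a)) @` `[0, 1] = (fun t : R => c + t *: (d - c)) @` `[0, 1] ->
  (a = c /\ b = d) \/ (a = d /\ b = c).
Proof.
move=> ab E.
have [s] : ((fun t : R => c + t *: (d - c)) @` `[0, 1]) a.
  by rewrite -E; exists 0; rewrite /= ?in_itv/= ?lexx ?ler01// scale0r addr0.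
rewrite /= in_itv/= => /andP[s0 s1] sa.
have [u] : ((fun t : R => c + t *: (d - c)) @` `[0, 1]) b.
  by rewrite -E; exists 1; rewrite /= ?in_itv/= ?lexx ?ler01// scale1r addrC subrK.
rewrite /= in_itv/= => /andP[u0 u1] ub.
have [s'] : ((fun t : R => a + t *: (b - a)) @` `[0, 1]) c.
  by rewrite E; exists 0; rewrite /= ?in_itv/= ?lexx ?ler01// scale0r addr0.
rewrite /= in_itv/= => /andP[s'0 s'1] sc.
have [u'] : ((fun t : R => a + t *: (b - a)) @` `[0, 1]) d.
  by rewrite E; exists 1; rewrite /= ?in_itv/= ?lexx ?ler01// scale1r addrC subrK.
rewrite /= in_itv/= => /andP[u'0 u'1] ud.
have dc : d - c != 0.
  by apply/eqP => dc; move: ab; rewrite -sa -ub dc !scaler0 eqxx.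
have comb t : a + t *: (b - a) = c + (s + t * (u - s)) *: (d - c).
  rewrite -sa -ub; move: (c) (d - c) => [p1 p2] [q1 q2].
  by congr pair; rewrite /= /GRing.scale/=; ring.
have inj p q : c + p *: (d - c) = c + q *: (d - c) -> p = q.
  move=> /addrI /eqP; rewrite -subr_eq0 -scalerBl scaler_eq0 (negbTE dc) orbF subr_eq0.
  by move/eqP.
have es : s + s' * (u - s) = 0.
  by apply: inj; rewrite -comb sc scale0r addr0.
have eu : s + u' * (u - s) = 1.
  by apply: inj; rewrite -comb ud scale1r addrC subrK.
have [s00|sn0] := eqVneq s 0.
  left; move: es eu; rewrite s00 subr0 !add0r => es eu.
  have u1' : u = 1.
    apply/eqP; rewrite eq_le u1/= -eu; apply: ler_piMl => //.
  by rewrite -sa -ub s00 u1' scale0r addr0 scale1r addrC subrK.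
right.
have sp : 0 < s by rewrite lt0r sn0.
have s'E : s' = 1.
  have h : (1 - s') * s + s' * u = 0 by rewrite -es; ring.
  have : (1 - s') * s = 0.
    apply/eqP; rewrite eq_le; apply/andP; split; last by rewrite mulr_ge0// subr_ge0.
    by rewrite -h lerDl mulr_ge0.
  by move/eqP; rewrite mulf_eq0 (negbTE sn0) orbF subr_eq0 => /eqP.
have u00 : u = 0 by rewrite -es s'E mul1r addrC subrK.
have s1' : s = 1.
  move: eu; rewrite u00 sub0r => eu.
  have : (1 - u') * s = 1 by rewrite -[RHS]eu; ring.
  move=> h; apply/eqP; rewrite eq_le s1/= -h; apply: ler_piMl => //.
  by rewrite lerBlDr lerDl.
by rewrite -sa -ub u00 s1' scale0r addr0 scale1r addrC subrK.
Qed.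

Lemma shared_ends h h' : side h = side h' ->
  (ha h = ha h' /\ hb h = hb h') \/ (ha h = hb h' /\ hb h = ha h').
Proof. by move=> ss; apply: segment_ends => //; exact: ha_neq_hb. Qed.

(** Both coordinates are affine and vanish on the common side, so they are
proportional. *)
Lemma lam_shared h h' x : side h = side h' -> lam h' x = lam h' (vo h) * lam h x.
Proof.
move=> ss; rewrite [in LHS](lam_comb nondeg h x).
rewrite lam_affine3 ?lam_sum//.
have z y : side h y -> lam h' y = 0 by rewrite ss => /(side_lam nondeg)[].
by rewrite (z _ (ha_side h)) (z _ (hb_side h)) !mulr0 !addr0 mulrC.
Qed.

Lemma lam_mid h h' i : side h = side h' -> i != h'.2 ->
  lam (h'.1, i) (gam h 2^-1) = 2^-1.
Proof.
move=> ss ih; have E : gam h 2^-1 = gam h' 2^-1.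
  have hf : 1 - 2^-1 = 2^-1 :> R by field.
  by rewrite !gamE hf; have [[-> ->]|[-> ->]] := shared_ends ss; rewrite // addrC.
rewrite E (lam_gam nondeg) /ha /hb !(lam_vtx nondeg).
have [ii|->|->] := ord3P h'.2 i; first by rewrite ii eqxx in ih.
  by rewrite eqxx ordS_pred_neq3 mulr0 addr0 mulr1; field.
by rewrite eqxx eq_sym ordS_pred_neq3 mulr0 add0r mulr1.
Qed.

(** Otherwise the points obtained by moving slightly from the midpoint of the side
towards the vertex of the first triangle would lie in both triangles, which only
meet in the side. *)
Lemma opposite h h' : h.1 != h'.1 -> side h = side h' -> lam h' (vo h) < 0.
Proof.
move=> hh' ss; rewrite ltNge; apply/negP => k0.
have TT := shared_tri hh' ss.
pose m := gam h 2^-1.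
have [e /andP[e0 e1] he] : exists2 e : R, 0 < e <= 1 &
   forall i, 0 <= lam (h'.1, i) ((1 - e) *: m + e *: vo h).
  have ev i : exists2 e : R, 0 < e <= 1 & forall d, 0 <= d <= e ->
      0 <= lam (h'.1, i) ((1 - d) *: m + d *: vo h).
    have [->|ih] := eqVneq i h'.2.
      exists 1; first by rewrite ltr01 lexx.
      move=> d /andP[d0 d1]; rewrite lam_affine ?subrK//.
      have /(side_lam nondeg)[_ ms] : side h' m.
        rewrite -ss; exists 2^-1 => //=; rewrite in_itv/= invr_ge0 ler0n/=.
        by rewrite invf_le1 ?ltr0n// ler1n.
      by rewrite -(surjective_pairing h') ms mulr0 add0r mulr_ge0.
    (* at the midpoint this coordinate is 1 / 2, and it changes at a rate of at most |c| + 1 / 2 *)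
    pose c := lam (h'.1, i) (vo h).
    exists (1 + `|c| *+ 2)^-1.
      have h1 : 1 <= 1 + `|c| *+ 2 by rewrite lerDl mulrn_wge0.
      by rewrite invr_gt0 invf_le1 ?h1 (lt_le_trans ltr01).
    move=> d /andP[d0 d1]; rewrite lam_affine ?subrK// lam_mid// -/c.
    have h1 : 0 < 1 + `|c| *+ 2 by rewrite (lt_le_trans ltr01)// lerDl mulrn_wge0.
    have h2 : d * (1 + `|c| *+ 2) <= 1 by rewrite -ler_pdivlMr// div1r.
    have h3 : - `|c| <= c by rewrite lerNl ler_normr lexx orbT.
    have h4 : d * (- `|c|) <= d * c by rewrite ler_wpM2l.
    by rewrite mulrDr mulr1 mulr2n in h2; lra.
  have [e0 /andP[a0 b0] H0] := ev 0; have [e1 /andP[a1 b1] H1] := ev (ordS 0).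
  have [e2 /andP[a2 b2] H2] := ev (ord_pred 0).
  exists (Num.min e0 (Num.min e1 e2)); first by rewrite !lt_min a0 a1 a2 ge_min b0.
  have p : 0 < Num.min e0 (Num.min e1 e2) by rewrite !lt_min a0 a1 a2.
  move=> i; have [->|->|->] := ord3P 0 i; [apply: H0|apply: H1|apply: H2];
    by rewrite (ltW p) !ge_min lexx ?orbT.
have : (tri h.1 `&` tri h'.1) ((1 - e) *: m + e *: vo h).
  split; apply/(tri_lam nondeg) => // i.
  rewrite lam_affine ?subrK// /m (lam_gam nondeg) /ha /hb /vo !(lam_vtx nondeg).
  have half0 : 0 <= 2^-1 :> R by rewrite invr_ge0.
  have half1 : 0 <= 1 - 2^-1 :> R by rewrite subr_ge0 invf_le1 ?ltr0n// ler1n.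
  by rewrite addr_ge0// mulr_ge0// ?subr_ge0// ?(ltW e0)// addr_ge0// mulr_ge0.
rewrite TT => /(side_lam nondeg)[_].
rewrite lam_affine ?subrK// /m (lam_gam nondeg) lam_ha lam_hb (lam_vo nondeg) !mulr0 addr0 mulr0 add0r mulr1.
by move=> ee; rewrite ee ltxx in e0.
Qed.

Lemma shared_side_inj T i j : side (T, i) = side (T, j) -> i = j.
Proof.
move=> ss; have /(side_lam nondeg)[_ la] : side (T, j) (ha (T, i)) by rewrite -ss; exact: ha_side.
have /(side_lam nondeg)[_ lb] : side (T, j) (hb (T, i)) by rewrite -ss; exact: hb_side.
have [//|ki|ki] := ord3P i j.
  by move: la; rewrite /ha /= ki (lam_vtx nondeg) eqxx => /eqP; rewrite oner_eq0.
by move: lb; rewrite /hb /= ki (lam_vtx nondeg) eqxx => /eqP; rewrite oner_eq0.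
Qed.

(** Three triangles on one side would lie pairwise on opposite sides of it; the
proportionality factors of their coordinates would be three negative numbers of
which one is the product of the two others. *)
Lemma shared_unique h h1 h2 : h1.1 != h.1 -> h2.1 != h.1 ->
  side h1 = side h -> side h2 = side h -> h1 = h2.
Proof.
move=> n1 n2 s1 s2; have [e|ne] := eqVneq h1.1 h2.1.
  case: h1 h2 e s1 s2 {n1 n2} => [T1 i1] [T2 i2] /= -> s1 s2.
  by congr pair; apply: (@shared_side_inj T2); rewrite s1 s2.
rewrite eq_sym in n1; rewrite eq_sym in n2.
have o1 := opposite n1 (esym s1); have o2 := opposite n2 (esym s2).
have s12 : side h1 = side h2 by rewrite s1.
have o12 := opposite ne s12.
have := lam_shared (vo h) s12.
have : 0 < lam h2 (vo h1) * lam h1 (vo h) by rewrite nmulr_rgt0.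
by move=> + e; rewrite -e => /lt_trans/(_ o2); rewrite ltxx.
Qed.

Lemma nout_opposite h h' : h.1 != h'.1 -> side h = side h' -> nout h' = - nout h.
Proof.
move=> hh' ss; have k0 := opposite hh' ss; have lE := lam_shared _ ss.
have D g : dot ((hb g - ha g).2, - (hb g - ha g).1) (vtx g.1 g.2 - ha g) = - detT g.1.
  by rewrite -det2_half /dot /det2 /vo /=; ring.
rewrite /nout !D !sgrN !opprK.
have e' := lE (vo h'); rewrite (lam_vo nondeg) in e'.
have : Num.sg (detT h'.1) *: (hb h' - ha h') = - (Num.sg (detT h.1) *: (hb h - ha h)).
  have kk : Num.sg (lam h' (vo h)) = -1 by rewrite ltr0_sg.
  move: kk; rewrite /lam sgrM sgrV; have [[<- <-]|[<- <-]] := shared_ends ss => kk.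
    have dd : Num.sg (det2 (ha h - vo h) (hb h - vo h)) = Num.sg (detT h.1) by rewrite det2_half.
    rewrite dd in kk.
    have : Num.sg (detT h'.1) = - Num.sg (detT h.1).
      have := congr1 (fun z => z * Num.sg (detT h'.1)) kk.
      rewrite -mulrA -expr2 sqr_sg detT_neq0//= mulr1 mulN1r => ->.
      by rewrite opprK.
    by move=> ->; rewrite scaleNr.
  have dd : det2 (hb h - vo h) (ha h - vo h) = - detT h.1.
    by rewrite -det2_half /det2/=; ring.
  rewrite dd sgrN in kk.
  have : Num.sg (detT h'.1) = Num.sg (detT h.1).
    have := congr1 (fun z => z * Num.sg (detT h'.1)) kk.
    rewrite -mulrA -expr2 sqr_sg detT_neq0//= mulr1 mulN1r => /oppr_inj ->.
    by [].
  by move=> ->; rewrite -scalerN opprB.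
move=> E.
have nE : norm2 (hb h' - ha h') = norm2 (hb h - ha h).
  have [[<- <-]//|[<- <-]] := shared_ends ss.
  by rewrite /norm2 /dot /=; congr Num.sqrt; ring.
rewrite nE; move/(congr1 (fun z => (norm2 (hb h - ha h))^-1 *: z)): E.
rewrite scalerN !scalerA => E.
have [E1 E2] := (congr1 fst E, congr1 snd E).
move: E1 E2; rewrite /= /GRing.scale/= => E1 E2.
congr pair; rewrite /= /GRing.scale/=.
  by rewrite [_ / _]mulrC E2 [_ / _ in RHS]mulrC.
by rewrite !mulrN [_ / _]mulrC E1 [_ / _ in RHS]mulrC.
Qed.

End SharedSides.

Lemma bigsetU_fin (I : finType) (T : Type) (F : I -> set T) :
  \big[setU/set0]_i F i = \bigcup_(i in setT) F i.
Proof.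
rewrite -bigcup_seq; apply/seteqP; split => x [i _ Fi]; exists i => //=.
by rewrite mem_index_enum.
Qed.

Section NullSets.
Context {R : realType}.
Local Notation mu := (@lebesgue_measure R).

Lemma measurable_eq0 (g : R * R -> R) : continuous g -> measurable [set x | g x = 0].
Proof.
move=> cg; rewrite -[X in measurable X]setTI.
rewrite (_ : [set x | g x = 0] = g @^-1` [set 0]); last by [].
by apply: continuous_measurable2.
Qed.

Lemma open_gt0 (g : R * R -> R) : continuous g -> open [set x | 0 < g x].
Proof.
move=> /continuousP cg; rewrite (_ : [set x | _] = g @^-1` [set y | 0 < y]); last by [].
apply: cg; exact: open_gt.
Qed.

(** By Fubini: the slices of a line that is not vertical are singletons. *)
Lemma line_null (A e : R * R) : e != 0 -> mu2 [set x | det2 e (x - A) = 0] = 0%E.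
Proof.
move=> e0; have [e1|e1] := eqVneq e.1 0.
  have e2 : e.2 != 0 by apply: contraNneq e0 => e2; rewrite [e]surjective_pairing e1 e2; apply/eqP.
  rewrite (_ : [set x | _] = [set A.1] `*` setT).
    by rewrite /mu2 product_measure1E//= lebesgue_measure_set1 mul0e.
  apply/seteqP; split => x /=; rewrite /det2 /= e1 mul0r sub0r.
    by move/eqP; rewrite oppr_eq0 mulf_eq0 (negbTE e2)/= subr_eq0 => /eqP.
  by move=> [-> _]; rewrite subrr mulr0 oppr0.
rewrite /mu2 /product_measure1; apply: integral0_eq => x _ /=.
rewrite (_ : xsection _ _ = [set A.2 + e.2 * (x - A.1) / e.1]); last first.
  apply/seteqP; split => y; rewrite xsectionE /=; rewrite /det2 /=.
    move=> E; have : e.1 * (y - A.2) = e.2 * (x - A.1) by apply/eqP; rewrite -subr_eq0; apply/eqP.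
    by move=> <-; field.
  by move=> ->; field.
exact: lebesgue_measure_set1.
Qed.
End NullSets.

Section MeshMeasure.
Context {R : realType}.
Variable M : mesh R.
Implicit Types (T : 'I_(ntri M)) (x y : R * R) (h : Defs.half M).
Hypothesis hM : triangulation M.

Let nondeg : forall T, det2 (vtx T 1 - vtx T 0) (vtx T 2 - vtx T 0) != 0.
Proof. by case: hM. Qed.

Definition otri T : set (R * R) := [set x | forall i, 0 < lam (T, i) x].

Lemma open_otri T : open (otri T).
Proof.
rewrite (_ : otri T = [set x | 0 < lam (T, 0) x] `&` [set x | 0 < lam (T, ordS 0) x] `&`
   [set x | 0 < lam (T, ord_pred 0) x]).
  by apply: openI; [apply: openI|]; apply: open_gt0; exact: continuous_lam.
apply/seteqP; split => [x h|x [[h0 h1] h2] i]; first by do !split; exact: h.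
by have [->|->|->] := ord3P 0 i.
Qed.

Lemma otri_tri T : otri T `<=` tri T.
Proof. by move=> x h; apply/(tri_lam nondeg) => i; exact: ltW. Qed.

Lemma otri_Omega T : otri T `<=` Omega M.
Proof.
rewrite /Omega -open_subsetE; last exact: open_otri.
by move=> x /otri_tri Tx; exists T.
Qed.

Lemma measurable_tri T : measurable (tri T).
Proof. by rewrite (tri_tri3 (T, 0)); apply: measurable_tri3; exact: (det2_half_neq0 nondeg). Qed.

Lemma integrable_tri T (w : R * R -> R) : continuous w -> mu2.-integrable (tri T) (EFin \o w).
Proof.
by move=> cw; rewrite (tri_tri3 (T, 0)); apply: integrable_tri3 => //; exact: (det2_half_neq0 nondeg).
Qed.

(** A common point of two triangles is on the boundary of the first one.  The
alternative in the conclusion keeps track of the side [(T, i)]: either the point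
is also on another side, or [(T, i)] itself is shared. *)
Lemma conforming_boundary T T' x i : T != T' -> tri T x -> tri T' x ->
  exists2 k, lam (T, k) x = 0 & (k != i \/ exists j, side (T, i) = side (T', j)).
Proof.
move=> TT' Tx T'x; have [_ _ conf _] := hM.
have [E|[k [j [_ E]]]|[k [j [ss E]]]] := conf _ _ TT'.
- by have : set0 x by rewrite -E.
- have -> : x = vtx T k by have : [set vtx T k] x by rewrite -E.
  have [ki|ki] := eqVneq (ordS k) i.
    exists (ord_pred k); first by rewrite (lam_vtx nondeg) ord_pred_neq3.
    by left; rewrite -ki eq_sym ordS_pred_neq3.
  by exists (ordS k); [rewrite (lam_vtx nondeg) ordS_neq3|left].
- have /(side_lam nondeg)[_ lx] : side (T, k) x by rewrite -E.
  exists k => //; have [ki|ki] := eqVneq k i; last by left.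
  by right; exists j; rewrite -ki.
Qed.

Lemma otri_disj T T' x : T != T' -> otri T x -> tri T' x -> False.
Proof.
move=> TT' oT T'x; have [k lk _] := conforming_boundary 0 TT' (otri_tri oT) T'x.
by have := oT k; rewrite lk ltxx.
Qed.

Lemma lam0_null h : mu2 [set x | lam h x = 0] = 0%E.
Proof.
rewrite (_ : [set x | _] = [set x | det2 (hb h - ha h) (x - ha h) = 0]).
  by apply: line_null; rewrite subr_eq0 eq_sym; exact: ha_neq_hb.
have E x : det2 (ha h - x) (hb h - x) = det2 (hb h - ha h) (x - ha h).
  by rewrite /det2/=; ring.
apply/seteqP; split => x /=; rewrite /lam E; last by move=> ->; rewrite mul0r.
by move/eqP; rewrite mulf_eq0 invr_eq0 (negbTE (detT_neq0 nondeg _)) orbF => /eqP.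
Qed.

Lemma measurable_otri T : measurable (otri T).
Proof. by apply: open_measurable2; exact: open_otri. Qed.

Lemma measurable_Omega : measurable (Omega M).
Proof. by apply: open_measurable2; exact: open_interior. Qed.

(** The lines that carry the sides form a null set that contains every set of
boundary points met below. *)
Lemma boundary_null (A : set (R * R)) : measurable A ->
  (forall x, A x -> exists h, lam h x = 0) -> mu2 A = 0%E.
Proof.
move=> mA Ah; apply/negligibleP => //.
apply: (@negligibleS _ _ _ mu2 (\big[setU/set0]_(h : Defs.half M) [set x | lam h x = 0])).
  by move=> x /Ah [h hx]; rewrite bigsetU_fin; exists h.
elim/big_ind: _ => [|B C|h _]; first exact: negligible_set0.
  exact: negligibleU.
apply/negligibleP; last exact: lam0_null.
by apply: measurable_eq0; exact: continuous_lam.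
Qed.

Lemma tri_boundary_null T : mu2 (tri T `\` otri T) = 0%E.
Proof.
apply: boundary_null => [|x [Tx nx]].
  by apply: measurableD; [exact: measurable_tri|exact: measurable_otri].
move/existsNP: nx => [i /negP]; rewrite -leNgt => li.
by exists (T, i); apply/eqP; rewrite eq_le li (tri_lam nondeg _ _).1.
Qed.

Definition inner : set (R * R) := \big[setU/set0]_(T : 'I_(ntri M)) otri T.

Lemma innerE : inner = \bigcup_(T in setT) otri T.
Proof. by exact: bigsetU_fin. Qed.

Lemma measurable_inner : measurable inner.
Proof. by rewrite /inner; apply: bigsetU_measurable => T _; exact: measurable_otri. Qed.

Lemma Omega_boundary_null : mu2 (Omega M `\` inner) = 0%E.
Proof.
apply: boundary_null => [|x [/interior_subset[T _ Tx] nx]].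
  by apply: measurableD; [exact: measurable_Omega|exact: measurable_inner].
have nT : ~ otri T x by move=> oT; apply: nx; rewrite innerE; exists T.
move/existsNP: nT => [i /negP]; rewrite -leNgt => li.
by exists (T, i); apply/eqP; rewrite eq_le li (tri_lam nondeg _ _).1.
Qed.

Lemma integral_otri T (k : R * R -> R) : mu2.-integrable (tri T) (EFin \o k) ->
  \int[mu2]_(x in tri T) k x = \int[mu2]_(x in otri T) k x.
Proof.
move=> ik; rewrite /Rintegral (@negligible_integral _ _ _ mu2 _ (tri T `\` otri T))//.
- by rewrite setDD (setIidr (@otri_tri T)).
- by apply: measurableD; [exact: measurable_tri|exact: measurable_otri].
- exact: measurable_tri.
- exact: tri_boundary_null.
Qed.

(** Up to a null set [Omega] is the disjoint union of the open triangles. *)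
Lemma integral_Omega_otri (k : R * R -> R) : mu2.-integrable (Omega M) (EFin \o k) ->
  \int[mu2]_(x in Omega M) k x = \sum_(T : 'I_(ntri M)) \int[mu2]_(x in otri T) k x.
Proof.
move=> ik.
have innerO : inner `<=` Omega M by rewrite innerE => x [T _]; exact: otri_Omega.
rewrite /Rintegral (@negligible_integral _ _ _ mu2 _ (Omega M `\` inner))//.
- rewrite setDD (setIidr innerO) /inner.
  rewrite [X in fine X](@integral_bigsetU_EFin _ _ _ mu2 _ otri k)//.
  + rewrite -sum_fine// => T _; apply: integrable_fin_num; first exact: measurable_otri.
    by apply: integrableS ik => //; [exact: measurable_Omega|exact: measurable_otri|exact: otri_Omega].
  + by move=> T; exact: measurable_otri.
  + exact: index_enum_uniq.
  + move=> T T' _ _ [x [Tx T'x]]; apply/eqP; apply: contraPT (erefl 0%N) => TT' _.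
    exact: otri_disj TT' Tx (otri_tri T'x).
  + apply/measurable_EFinP; apply: (@measurable_funS _ _ _ _ (Omega M)) => //.
      exact: measurable_Omega.
    exact: integrable_mfun ik.
- by apply: measurableD; [exact: measurable_Omega|exact: measurable_inner].
- exact: measurable_Omega.
- exact: Omega_boundary_null.
Qed.

(** The points at which all coordinates but those of the common side are positive.
For a shared side this is an open set that contains the relative interior of the side, lies in the
two triangles and meets no other side of the mesh: test functions supported in
it see the jump across this side only. *)
Definition edge_nbhd h h' : set (R * R) :=
  [set x | (forall i, i != h.2 -> 0 < lam (h.1, i) x) /\
           (forall i, i != h'.2 -> 0 < lam (h'.1, i) x)].

Lemma open_edge_nbhd h h' : open (edge_nbhd h h').
Proof.
pose H h := [set x : R * R | 0 < lam (h.1, ordS h.2) x] `&` [set x | 0 < lam (h.1, ord_pred h.2) x].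
rewrite (_ : edge_nbhd h h' = H h `&` H h').
  by do !apply: openI; apply: open_gt0; exact: continuous_lam.
have E (g : Defs.half M) x : H g x <-> forall i, i != g.2 -> 0 < lam (g.1, i) x.
  split=> [[h1 h2] i|h1]; last by split; apply: h1; rewrite ?ordS_neq3 ?ord_pred_neq3.
  by have [->|->|->] := ord3P g.2 i; rewrite ?eqxx.
by apply/seteqP; split => x [h1 h2]; split; apply/E.
Qed.

Section Shared.
Variables h h' : Defs.half M.
Hypotheses (hh' : h.1 != h'.1) (ss : side h = side h').

(** The coordinates of the two triangles that belong to the common side have
opposite signs, so one of them is nonnegative. *)
Lemma edge_nbhd_tri : edge_nbhd h h' `<=` tri h.1 `|` tri h'.1.
Proof.
move=> x [H H']; have [l0|l0] := leP 0 (lam h x).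
  left; apply/(tri_lam nondeg) => i; have [->|ih] := eqVneq i h.2.
    by rewrite -(surjective_pairing h).
  exact/ltW/H.
right; apply/(tri_lam nondeg) => i; have [->|ih] := eqVneq i h'.2; last exact/ltW/H'.
rewrite -(surjective_pairing h') (lam_shared hM x ss).
by rewrite nmulr_rge0 ?(opposite hM hh' ss)// ltW.
Qed.

Lemma edge_nbhd_Omega : edge_nbhd h h' `<=` Omega M.
Proof.
rewrite /Omega -open_subsetE; last exact: open_edge_nbhd.
by move=> x /edge_nbhd_tri[Tx|Tx]; [exists h.1|exists h'.1].
Qed.

Lemma lam_gam_gt0 (g : Defs.half M) (t : R) i : 0 < t < 1 -> i != g.2 -> 0 < lam (g.1, i) (gam g t).
Proof.
move=> /andP[t0 t1] ig; rewrite (lam_gam nondeg) /ha /hb !(lam_vtx nondeg).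
have [ii|->|->] := ord3P g.2 i; first by rewrite ii eqxx in ig.
  by rewrite eqxx ordS_pred_neq3 mulr0 addr0 mulr1 subr_gt0.
by rewrite eqxx eq_sym ordS_pred_neq3 mulr0 add0r mulr1.
Qed.

Lemma gam_edge_nbhd (t : R) : 0 < t < 1 -> edge_nbhd h h' (gam h t).
Proof.
move=> t01; split => [i|i] ih; first exact: lam_gam_gt0.
have [[ea eb]|[ea eb]] := shared_ends hM ss.
  by rewrite gamE ea eb -gamE; exact: lam_gam_gt0.
rewrite gamE ea eb addrC -{1}(subKr 1 t) -gamE; apply: lam_gam_gt0 => //.
by move: t01 => /andP[t0 t1]; rewrite subr_gt0 t1 ltrBlDr ltrDl.
Qed.

Lemma edge_nbhd_side (g : Defs.half M) x : edge_nbhd h h' x -> side g x -> g = h \/ g = h'.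
Proof.
move=> [H H'] /(side_lam nondeg)[gx lx].
have [e|ne] := eqVneq g.1 h.1.
  left; apply/eqP; rewrite (surjective_pairing g) (surjective_pairing h) xpair_eqE e eqxx/=.
  apply/negPn/negP => /H; move: lx; rewrite {1}(surjective_pairing g) e => ->.
  by rewrite ltxx.
have [e'|ne'] := eqVneq g.1 h'.1.
  right; apply/eqP; rewrite (surjective_pairing g) (surjective_pairing h') xpair_eqE e' eqxx/=.
  apply/negPn/negP => /H'; move: lx; rewrite {1}(surjective_pairing g) e' => ->.
  by rewrite ltxx.
exfalso; have [hx|h'x] := edge_nbhd_tri (conj H H' : edge_nbhd h h' x).
  rewrite eq_sym in ne; have [k lk [kh|[j sj]]] := conforming_boundary h.2 ne hx gx.
    by have := H _ kh; rewrite lk ltxx.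
  rewrite -(surjective_pairing h) in sj.
  have := @shared_unique _ _ hM h h' (g.1, j).
  have nh : h'.1 != h.1 by rewrite eq_sym.
  rewrite eq_sym in ne; move=> /(_ nh ne (esym ss) (esym sj)) e.
  by rewrite e eqxx in ne'.
rewrite eq_sym in ne'; have [k lk [kh|[j sj]]] := conforming_boundary h'.2 ne' h'x gx.
  by have := H' _ kh; rewrite lk ltxx.
rewrite -(surjective_pairing h') in sj.
have := @shared_unique _ _ hM h' h (g.1, j).
rewrite eq_sym in ne'; move=> /(_ hh' ne' ss (esym sj)) e.
by rewrite e eqxx in ne.
Qed.

End Shared.
End MeshMeasure.

(** * Differentiable functions and polynomials *)

Section Differentiable.
Context {R : realType}.
Implicit Types (x : R * R) (u v w : R * R -> R) (a : R).

(** The partial derivatives are arguments, so that they can be computed along with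
the function by the rules below. *)
Definition has_partials w wx wy := [/\ continuous w, continuous wx, continuous wy,
  forall x, is_derive x.1 (1 : R) (fun t : R => w (t, x.2)) (wx x) &
  forall x, is_derive x.2 (1 : R) (fun t : R => w (x.1, t)) (wy x)].

Lemma has_partials_d1 w wx wy : has_partials w wx wy -> d1 w = wx.
Proof.
by move=> [_ _ _ h _]; apply/funext => x; rewrite /d1 derive1E (@derive_val _ _ _ _ _ _ _ (h x)).
Qed.

Lemma has_partials_d2 w wx wy : has_partials w wx wy -> d2 w = wy.
Proof.
by move=> [_ _ _ _ h]; apply/funext => x; rewrite /d2 derive1E (@derive_val _ _ _ _ _ _ _ (h x)).
Qed.

Lemma Ck_has_partials w : Ck 0 w -> Ck 1 w -> has_partials w (d1 w) (d2 w).
Proof.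
move=> c0 [h1 h2 c1 c2]; split; [exact: c0|exact: c1|exact: c2| |] => x.
  by apply: DeriveDef; [exact: h1|rewrite /d1 derive1E].
by apply: DeriveDef; [exact: h2|rewrite /d2 derive1E].
Qed.

Lemma has_partials_cst a : has_partials (fun=> a) (fun=> 0) (fun=> 0).
Proof. by split; do ?[exact: cst_continuous]; move=> x; exact: is_derive_cst. Qed.

Lemma has_partials_fst : has_partials (fun x => x.1) (fun=> 1) (fun=> 0).
Proof.
split; do ?[exact: cst_continuous].
- exact: continuous_fst1.
- by move=> x; exact: is_derive_id.
- by move=> x; exact: is_derive_cst.
Qed.

Lemma has_partials_snd : has_partials (fun x => x.2) (fun=> 0) (fun=> 1).
Proof.
split; do ?[exact: cst_continuous].
- exact: continuous_snd2.
- by move=> x; exact: is_derive_cst.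
- by move=> x; exact: is_derive_id.
Qed.

Lemma continuousDf (f g : R * R -> R) : continuous f -> continuous g -> continuous (fun x => f x + g x).
Proof. by move=> cf cg x; apply: cvgD; [exact: cf|exact: cg]. Qed.

Lemma continuousMf (f g : R * R -> R) : continuous f -> continuous g -> continuous (fun x => f x * g x).
Proof. by move=> cf cg x; apply: cvgM; [exact: cf|exact: cg]. Qed.

Lemma has_partialsD u ux uy v vx vy : has_partials u ux uy -> has_partials v vx vy ->
  has_partials (fun x => u x + v x) (fun x => ux x + vx x) (fun x => uy x + vy x).
Proof.
move=> [a1 a2 a3 a4 a5] [b1 b2 b3 b4 b5]; split; do ?exact: continuousDf.
  by move=> x; exact: is_deriveD (a4 x) (b4 x).
by move=> x; exact: is_deriveD (a5 x) (b5 x).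
Qed.

Lemma has_partialsM u ux uy v vx vy : has_partials u ux uy -> has_partials v vx vy ->
  has_partials (fun x => u x * v x) (fun x => ux x * v x + u x * vx x)
    (fun x => uy x * v x + u x * vy x).
Proof.
move=> [a1 a2 a3 a4 a5] [b1 b2 b3 b4 b5]; split;
  do ?[exact: continuousMf|by apply: continuousDf; exact: continuousMf].
  move=> x; apply: is_derive_eq (is_deriveM (a4 x) (b4 x)) _.
  by rewrite /GRing.scale/= -!surjective_pairing; ring.
move=> x; apply: is_derive_eq (is_deriveM (a5 x) (b5 x)) _.
by rewrite /GRing.scale/= -!surjective_pairing; ring.
Qed.

Lemma has_partials_ext u u' ux ux' uy uy' : u =1 u' -> ux =1 ux' -> uy =1 uy' ->
  has_partials u ux uy -> has_partials u' ux' uy'.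
Proof. by move=> /funext -> /funext -> /funext ->. Qed.

Lemma has_partialsX u ux uy n : has_partials u ux uy ->
  has_partials (fun x => u x ^+ n) (fun x => n%:R * u x ^+ n.-1 * ux x) (fun x => n%:R * u x ^+ n.-1 * uy x).
Proof.
move=> h; elim: n => [|n IH].
  by apply: has_partials_ext (has_partials_cst 1) => x; rewrite ?mul0r.
by apply: has_partials_ext (has_partialsM h IH) => x; rewrite /= ?exprS//; case: n {IH} => [|n];
  rewrite /= ?expr0 ?exprS -?[n.+2%:R]natr1 -?[n.+1%:R]natr1; ring.
Qed.

End Differentiable.

Section Polynomials.
Context {R : realType}.
Implicit Types (x : R * R) (u v w : R * R -> R) (m : nat).

Lemma Plt2_0 m : Plt2 m (fun=> 0 : R).
Proof. by exists (fun _ _ => 0) => x; rewrite big1// => i _; rewrite big1// => j _; rewrite !mul0r. Qed.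

Lemma Plt2D m u v : Plt2 m u -> Plt2 m v -> Plt2 m (fun x => u x + v x).
Proof.
move=> [c hc] [d hd]; exists (fun i j => c i j + d i j) => x; rewrite hc hd -big_split.
by apply: eq_bigr => i _; rewrite -big_split; apply: eq_bigr => j _; rewrite /= !mulrDl.
Qed.

Lemma Plt2Z m (a : R) u : Plt2 m u -> Plt2 m (fun x => a * u x).
Proof.
move=> [c hc]; exists (fun i j => a * c i j) => x; rewrite hc mulr_sumr.
by apply: eq_bigr => i _; rewrite mulr_sumr; apply: eq_bigr => j _; rewrite !mulrA.
Qed.

Lemma Plt2_ext m u v : u =1 v -> Plt2 m u -> Plt2 m v.
Proof. by move=> /funext ->. Qed.

Lemma Plt2_monomial m i j : (i + j < m)%N -> Plt2 m (fun x : R * R => x.1 ^+ i * x.2 ^+ j).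
Proof.
move=> ijm; have im : (i < m)%N by apply: leq_ltn_trans ijm; rewrite leq_addr.
have jm : (j < m - i)%N by rewrite ltn_subRL.
exists (fun i' j' => ((i' == i) && (j' == j))%:R) => x.
rewrite (bigD1 (Ordinal im))//= (bigD1 (Ordinal jm))//= !eqxx mul1r.
rewrite big1 => [|j' /eqP j'j]; last first.
  by rewrite (_ : (_ == j) = false) ?mul0r//; apply/negP => /eqP e; apply: j'j; apply/val_inj.
rewrite addr0 big1 ?addr0// => i' /eqP i'i; rewrite big1// => j' _.
by rewrite (_ : (_ == i) = false) ?mul0r//; apply/negP => /eqP e; apply: i'i; apply/val_inj.
Qed.

Lemma Plt2_ind (P : (R * R -> R) -> Prop) m :
  P (fun=> 0) -> (forall u v, P u -> P v -> P (fun x => u x + v x)) ->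
  (forall a u, P u -> P (fun x => a * u x)) ->
  (forall i j, (i + j < m)%N -> P (fun x => x.1 ^+ i * x.2 ^+ j)) ->
  forall v, Plt2 m v -> P v.
Proof.
move=> P0 PD PZ PM v [c hc].
have sumP (I : Type) (s : seq I) (f : I -> R * R -> R) :
    (forall i, P (f i)) -> P (fun x => \sum_(i <- s) f i x).
  move=> h; elim: s => [|i s IH].
    by rewrite (_ : (fun x => _) = fun=> 0)//; apply/funext => x; rewrite big_nil.
  rewrite (_ : (fun x => _) = fun x => f i x + \sum_(j <- s) f j x); first exact: PD.
  by apply/funext => x; rewrite big_cons.
rewrite (funext hc); apply: (sumP 'I_m) => i; apply: (sumP 'I_(m - i)) => j.
rewrite (_ : (fun x => _) = fun x => c i j * (x.1 ^+ i * x.2 ^+ j)); last first.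
  by apply/funext => x; rewrite mulrA.
by apply: PZ; apply: PM; rewrite -ltn_subRL.
Qed.

(** The bounds on [x * dv/dx] and [y * dv/dy], which do not lose a degree, are
what the divergence of [q(x) x] requires. *)
Lemma Plt2_partials m v : Plt2 m v -> exists vx vy, [/\ has_partials v vx vy,
  Plt2 m vx, Plt2 m vy, Plt2 m (fun x => x.1 * vx x) & Plt2 m (fun x => x.2 * vy x)].
Proof.
move: v; apply: Plt2_ind.
- exists (fun=> 0), (fun=> 0); split; do ?exact: Plt2_0; first exact: has_partials_cst.
    by apply: Plt2_ext (Plt2_0 m) => x; rewrite mulr0.
  by apply: Plt2_ext (Plt2_0 m) => x; rewrite mulr0.
- move=> u v [ux [uy [u1 u2 u3 u4 u5]]] [vx [vy [v1 v2 v3 v4 v5]]].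
  exists (fun x => ux x + vx x), (fun x => uy x + vy x); split; do ?exact: Plt2D.
  + exact: has_partialsD.
  + by apply: Plt2_ext (Plt2D u4 v4) => x; rewrite mulrDr.
  + by apply: Plt2_ext (Plt2D u5 v5) => x; rewrite mulrDr.
- move=> a u [ux [uy [u1 u2 u3 u4 u5]]].
  exists (fun x => a * ux x), (fun x => a * uy x); split; do ?exact: Plt2Z.
  + by apply: has_partials_ext (has_partialsM (has_partials_cst a) u1) => x //; rewrite mul0r add0r.
  + by apply: Plt2_ext (Plt2Z a u4) => x; rewrite mulrCA.
  + by apply: Plt2_ext (Plt2Z a u5) => x; rewrite mulrCA.
- move=> i j ijm.
  exists (fun x => i%:R * (x.1 ^+ i.-1 * x.2 ^+ j)), (fun x => j%:R * (x.1 ^+ i * x.2 ^+ j.-1)); split.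
  + by apply: has_partials_ext (has_partialsM (has_partialsX i has_partials_fst) (has_partialsX j has_partials_snd)) => x //; ring.
  + by apply: Plt2Z; apply: Plt2_monomial; lia.
  + by apply: Plt2Z; apply: Plt2_monomial; lia.
  + apply: Plt2_ext (Plt2Z i%:R (Plt2_monomial ijm)) => x.
    by case: i {ijm} => [|i]; rewrite ?mul0r ?mulr0// exprS; ring.
  + apply: Plt2_ext (Plt2Z j%:R (Plt2_monomial ijm)) => x.
    by case: j {ijm} => [|j]; rewrite ?mul0r ?mulr0// exprS; ring.
Qed.

Lemma Plt2_continuous m v : Plt2 m v -> continuous v.
Proof. by move=> /Plt2_partials [vx [vy [[]]]]. Qed.

Lemma Plt1_continuous m (w : R -> R) : Plt1 m w -> continuous w.
Proof.
move=> [c hc]; rewrite (funext hc).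
elim: m {hc} => [|m IH].
  by under eq_fun do rewrite big_ord0; exact: cst_continuous.
under eq_fun do rewrite big_ord_recr/=.
move=> t; apply: cvgD; first exact: IH.
by apply: cvgM; [exact: cvg_cst|exact: exprn_continuous].
Qed.

End Polynomials.

(** * Integration by parts on one triangle *)

Section GaussMesh.
Context {R : realType}.
Variable M : mesh R.
Implicit Types (T : 'I_(ntri M)) (x : R * R) (h : Defs.half M).
Hypothesis hM : triangulation M.

Let nondeg : forall T, det2 (vtx T 1 - vtx T 0) (vtx T 2 - vtx T 0) != 0.
Proof. by case: hM. Qed.

Definition elen h := norm2 (hb h - ha h).

Lemma elen_gt0 h : 0 < elen h.
Proof.
rewrite /elen /norm2 sqrtr_gt0 /dot -!expr2 lt0r addr_ge0 ?sqr_ge0// andbT.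
rewrite paddr_eq0 ?sqr_ge0// !sqrf_eq0 negb_and.
have := ha_neq_hb nondeg h; apply: contraNT; rewrite negb_or !negbK.
move=> /andP[/eqP e1 /eqP e2]; rewrite eq_sym -subr_eq0.
by rewrite [hb h - ha h]surjective_pairing e1 e2; apply/eqP.
Qed.

(** Multiplying the outer normal by the length of the side removes the square root
and leaves the components that occur in [flux_x] and [flux_y]. *)
Lemma nout_elen h : elen h *: nout h =
  (Num.sg (detT h.1) * (hb h - ha h).2, - Num.sg (detT h.1) * (hb h - ha h).1).
Proof.
rewrite /nout (_ : dot _ _ = - detT h.1); last first.
  by rewrite -det2_half /dot /det2 /vo /=; ring.
rewrite sgrN opprK -/(elen h) scalerA mulrC -mulrA mulVf ?gt_eqF ?elen_gt0// mulr1.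
by congr pair; rewrite /= /GRing.scale/= mulrN mulNr.
Qed.

Lemma gauss_tri T (a ax ay b bx by_ u ux uy : R * R -> R) :
  has_partials a ax ay -> has_partials b bx by_ -> has_partials u ux uy ->
  intT T (fun x => a x * ux x + b x * uy x) + intT T (fun x => (ax x + by_ x) * u x) =
  \sum_i elen (T, i) * \int[lebesgue_measure]_(t in `[0, 1])
     (dot (a (gam (T, i) t), b (gam (T, i) t)) (nout (T, i)) * u (gam (T, i) t)).
Proof.
move=> ha_ hb_ hu; have hau := has_partialsM ha_ hu; have hbu := has_partialsM hb_ hu.
have [ca cax _ _ _] := ha_; have [cb _ cby _ _] := hb_; have [cu cux cuy _ _] := hu.
have [cau caux _ dau _] := hau; have [cbu _ cbuy _ dbu] := hbu.
rewrite /intT -RintegralD; last 3 first.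
- exact: measurable_tri.
- by apply: integrable_tri => //; apply: continuousDf; exact: continuousMf.
- by apply: integrable_tri => //; apply: continuousMf => //; exact: continuousDf.
transitivity (\int[mu2]_(x in tri T) (d1 (fun x => a x * u x) x + d2 (fun x => b x * u x) x)).
  by apply: eq_Rintegral => x _; rewrite (has_partials_d1 hau) (has_partials_d2 hbu); ring.
rewrite RintegralD; last 3 first.
- exact: measurable_tri.
- by rewrite (has_partials_d1 hau); exact: integrable_tri.
- by rewrite (has_partials_d2 hbu); exact: integrable_tri.
have TE : tri T = tri3 (vtx T 0) (vtx T 1) (vtx T 2).
  by rewrite (tri_tri3 (T, 0)) /vo /ha /hb /= ordS3E ord_pred3E.
rewrite TE (gauss_x (nondeg T) cau); last 2 first.
- by move=> x; have [] := dau x.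
- by rewrite (has_partials_d1 hau).
rewrite (gauss_y (nondeg T) cbu); last 2 first.
- by move=> x; have [] := dbu x.
- by rewrite (has_partials_d2 hbu).
have E i : elen (T, i) * \int[lebesgue_measure]_(t in `[0, 1])
     (dot (a (gam (T, i) t), b (gam (T, i) t)) (nout (T, i)) * u (gam (T, i) t)) =
   Num.sg (detT T) * ((hb (T, i) - ha (T, i)).2 * lint (ha (T, i)) (hb (T, i)) (fun x => a x * u x)) -
   Num.sg (detT T) * ((hb (T, i) - ha (T, i)).1 * lint (ha (T, i)) (hb (T, i)) (fun x => b x * u x)).
  have cg (w : R * R -> R) : continuous w -> continuous (fun t : R => w (gam (T, i) t)).
    exact: continuous_segment.
  rewrite /lint !mulrA -RintegralZl//; last first.
    apply: integrable_itv => t; apply: cvgM; last exact: cg.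
    by apply: cvgD; apply: cvgM; do ?[exact: cvg_cst]; exact: cg.
  rewrite -[_ * Rintegral _ _ _ in RHS]RintegralZl//; last exact: integrable_itv (cg _ cau).
  rewrite -[X in _ - X]RintegralZl//; last exact: integrable_itv (cg _ cbu).
  rewrite -RintegralB//; last 2 first.
  - apply: integrable_itv => t; apply: cvgM; [exact: cvg_cst|exact: (cg _ cau)].
  - apply: integrable_itv => t; apply: cvgM; [exact: cvg_cst|exact: (cg _ cbu)].
  apply: eq_Rintegral => t _; rewrite -/(gam (T, i) t) /dot.
  have := nout_elen (T, i); case: (nout (T, i)) => [n1 n2] [] /= n1E n2E.
  transitivity ((a (gam (T, i) t) * (elen (T, i) * n1) +
     b (gam (T, i) t) * (elen (T, i) * n2)) * u (gam (T, i) t)).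
    by ring.
  by move: n1E n2E; rewrite /GRing.scale/= => -> ->; ring.
under [RHS]eq_bigr do rewrite E.
rewrite (big_ord3 _ 0) /ha /hb /= !(ordS3E, ord_pred3E) /flux_x /flux_y -/(detT T) /=; ring.
Qed.

(** [div (q x) = 2 q + x . grad q] has the degree of [q], so the divergence does not
leave [P_r]. *)
Lemma RT_div r (p : field M) : RT r p -> forall T, exists a ax ay b bx by_ : R * R -> R,
  [/\ has_partials a ax ay, has_partials b bx by_, forall x, p T x = (a x, b x) &
      Plt2 r.+1 (fun x => ax x + by_ x)].
Proof.
move=> [_ hp] T; have [[[q1 q2] q3] [/= h1 h2 h3 hE]] := hp T.
have [q1x [q1y [c1 p1x p1y _ _]]] := Plt2_partials h1.
have [q2x [q2y [c2 p2x p2y _ _]]] := Plt2_partials h2.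
have [q3x [q3y [c3 p3x p3y p3x' p3y']]] := Plt2_partials h3.
have A := has_partialsD c1 (has_partialsM c3 has_partials_fst); have B := has_partialsD c2 (has_partialsM c3 has_partials_snd).
do 6 eexists; split; [exact: A|exact: B| |].
  by move=> x; rewrite hE.
apply: Plt2_ext (Plt2D (Plt2D p1x p2y) (Plt2D (Plt2D p3x' p3y') (Plt2Z 2 h3))) => x.
by rewrite /=; ring.
Qed.

End GaussMesh.

(** * The weak divergence of a Raviart-Thomas field *)

Section Integrable.
Context d (T : measurableType d) (R : realType) (m : {measure set T -> \bar R}).
Implicit Types (D : set T) (g v : T -> R).

(** [|g| <= 1 + g^2]. *)
Lemma integrable_sqr D g : measurable D -> m.-integrable D (EFin \o (fun=> 1 : R)) ->
  measurable_fun D g -> m.-integrable D (EFin \o (fun x => g x ^+ 2)) ->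
  m.-integrable D (EFin \o g).
Proof.
move=> mD i1 mg ig; have := integrableD mD i1 ig; apply: le_integrable => //.
  exact/measurable_EFinP.
move=> x Ox /=; rewrite lee_fin [leRHS]ger0_norm ?addr_ge0 ?sqr_ge0//.
rewrite -[g x ^+ 2]real_normK ?num_real//.
have : 0 <= (`|g x| - 1) ^+ 2 by exact: sqr_ge0.
by rewrite sqrrB expr1n; have := normr_ge0 (g x); lra.
Qed.

Lemma integrable_bounded_mul D g v (B : R) : measurable D ->
  m.-integrable D (EFin \o g) -> measurable_fun D v -> (forall x, `|v x| <= B) ->
  m.-integrable D (EFin \o (fun x => g x * v x)).
Proof.
move=> mD ig mv vB; have := integrableZl mD `|B| ig; apply: le_integrable => //.
  by apply/measurable_EFinP/measurable_funM => //; exact: integrable_mfun ig.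
move=> x Dx /=; rewrite lee_fin !normrM normr_id mulrC ler_wpM2r//.
exact: le_trans (vB x) (ler_norm B).
Qed.

End Integrable.

Lemma integrableS2 (R : realType) (E D : set (R * R)) (k : R * R -> R) :
  measurable E -> measurable D -> D `<=` E ->
  mu2.-integrable E (EFin \o k) -> mu2.-integrable D (EFin \o k).
Proof. by move=> mE mD DE ik; apply: (@integrableS _ _ _ mu2 E D). Qed.

Section PlaneIntegrable.
Context {R : realType}.
Implicit Types (D : set (R * R)) (f k v : R * R -> R).

Lemma integrableB2 D f k : measurable D -> mu2.-integrable D (EFin \o f) ->
  mu2.-integrable D (EFin \o k) -> mu2.-integrable D (EFin \o (fun x => f x - k x)).
Proof. by move=> mD i1 i2; exact: (@integrableB _ _ _ mu2 D mD _ _ i1 i2). Qed.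

Lemma integrable_bounded_mul2 D f v (B : R) : measurable D ->
  mu2.-integrable D (EFin \o f) -> measurable_fun D v -> (forall x, `|v x| <= B) ->
  mu2.-integrable D (EFin \o (fun x => f x * v x)).
Proof. by move=> mD i1 mv vB; exact: (@integrable_bounded_mul _ _ _ mu2 D _ _ B mD i1 mv vB). Qed.

End PlaneIntegrable.

Section UnitInterval.
Context {R : realType}.
Local Notation mu := (@lebesgue_measure R).

Lemma integral_pos_continuous (k : R -> R) (t0 : R) : continuous k -> 0 < t0 < 1 ->
  (forall t, 0 <= t <= 1 -> 0 <= k t) -> 0 < k t0 ->
  0 < \int[mu]_(t in `[0, 1]) k t.
Proof.
move=> ck /andP[t00 t01] k0 kt0.
have : \forall t \near t0, k t0 / 2 < k t /\ 0 < t < 1.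
  near=> t; split; last (apply/andP; split).
  - near: t; apply: (cvgr_gt (k t0)); first exact: ck.
    by rewrite ltr_pdivrMr// ltr_pMr// ltr1n.
  - near: t; exact: lt_nbhsr.
  - near: t; exact: lt_nbhsl.
move=> /nbhs_ballP[e /= e0 he].
have e20 : 0 < e / 2 by rewrite divr_gt0.
have inb t : t \in `[t0 - e / 2, t0 + e / 2] -> k t0 / 2 < k t /\ 0 < t < 1.
  rewrite in_itv/= => /andP[h1 h2]; apply: he; rewrite /ball/= ltr_distlC.
  by apply/andP; split; lra.
apply: (@lt_le_trans _ _ (\int[mu]_(t in `[t0 - e / 2, t0 + e / 2]) k t)); last first.
  rewrite /Rintegral fine_le//.
  - by apply: integrable_fin_num => //; exact: integrable_itv.
  - by apply: integrable_fin_num => //; exact: integrable_itv.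
  - apply: ge0_subset_integral => //.
    + by apply/measurable_EFinP; exact: (integrable_mfun (integrable_itv 0 1 ck)).
    + by move=> t /= /inb[_]; rewrite in_itv/= => /andP[/ltW -> /ltW ->].
apply: (@lt_le_trans _ _ (\int[mu]_(t in `[t0 - e / 2, t0 + e / 2]) (k t0 / 2))).
  rewrite Rintegral_cst//= lebesgue_measure_itv/= lte_fin ifT; last by lra.
  by rewrite /= mulr_gt0 ?divr_gt0//; lra.
apply: le_Rintegral => //.
- by apply: integrable_itv => t; exact: cvg_cst.
- exact: integrable_itv.
- by move=> t /= /inb[/ltW].
Unshelve. all: by end_near.
Qed.

Lemma integral_eq_oo (k1 k2 : R -> R) : (forall t, 0 < t < 1 -> k1 t = k2 t) ->
  continuous k1 -> continuous k2 ->
  \int[mu]_(t in `[0, 1]) k1 t = \int[mu]_(t in `[0, 1]) k2 t.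
Proof.
move=> e c1 c2; have cc (k : R -> R) : continuous k ->
    \int[mu]_(t in `[0, 1]) k t = \int[mu]_(t in `]0, 1[) k t.
  move=> ck; rewrite Rintegral_itv_bndo_bndc; last exact: integrable_itvoo.
  rewrite Rintegral_itv_obnd_cbnd//; apply: (@integrable_in_itv _ 0 1) => // t /=.
  by rewrite !in_itv/= => /andP[/ltW -> ->].
by rewrite !cc//; apply: eq_Rintegral => t; rewrite inE /= in_itv/= => /e.
Qed.

End UnitInterval.

Section WeakDivergence.
Context {R : realType}.
Variable M : mesh R.
Implicit Types (T : 'I_(ntri M)) (x : R * R) (h : Defs.half M).
Hypothesis hM : triangulation M.
Local Notation mu := (@lebesgue_measure R).

Let nondeg : forall T, det2 (vtx T 1 - vtx T 0) (vtx T 2 - vtx T 0) != 0.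
Proof. by case: hM. Qed.

Lemma Omega_bounded : exists a b c d, Omega M `<=` crect a b c d.
Proof.
pose B : R := \sum_(h : Defs.half M) (`|(vo h).1| + `|(vo h).2|).
have hB h : `|(vo h).1| + `|(vo h).2| <= B.
  by rewrite /B (bigD1 h)//= lerDl sumr_ge0// => k _; rewrite addr_ge0.
exists (- B), B, (- B), B => x /interior_subset[T _ [w [w0 w1 ->]]].
have H (q : R * R -> R) : (forall k, `|q (vtx T k)| <= B) ->
    `|\sum_k w k * q (vtx T k)| <= B.
  move=> hq; apply: (le_trans (ler_norm_sum _ _ _)).
  rewrite -[B]mul1r -w1 mulr_suml; apply: ler_sum => k _.
  by rewrite normrM (ger0_norm (w0 k)) ler_wpM2l.
have E1 : (\sum_k w k *: vtx T k).1 = \sum_k w k * (vtx T k).1.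
  by rewrite (big_morph (@fst R R) (id1 := 0) (op1 := +%R)).
have E2 : (\sum_k w k *: vtx T k).2 = \sum_k w k * (vtx T k).2.
  by rewrite (big_morph (@snd R R) (id1 := 0) (op1 := +%R)).
split; rewrite /= in_itv/= -ler_norml ?E1 ?E2.
  by apply: (H fst) => k; apply: le_trans (hB (T, k)); rewrite lerDl.
by apply: (H snd) => k; apply: le_trans (hB (T, k)); rewrite lerDr.
Qed.

Lemma L2_integrable (g : R * R -> R) : L2 (Omega M) g ->
  mu2.-integrable (Omega M) (EFin \o g).
Proof.
move=> [mg ig]; have [a [b [c [d Ob]]]] := Omega_bounded.
apply: integrable_sqr => //; first exact: measurable_Omega.
- by apply: (continuous_integrable2 (measurable_Omega M) Ob); exact: cst_continuous.
- exact: (measurable_funTS mg).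
Qed.

Section Components.
Variables (r : nat) (p : field M) (g : R * R -> R).
Variables (a ax ay b bx by_ : 'I_(ntri M) -> R * R -> R).
Hypotheses (ha_ : forall T, has_partials (a T) (ax T) (ay T)) (hb_ : forall T, has_partials (b T) (bx T) (by_ T)).
Hypothesis pE : forall T x, p T x = (a T x, b T x).
Hypotheses (hp : RT0 r p) (hg : div_is p g).

Implicit Types (U V : set (R * R)) (v : R * R -> R).

Definition pdiv T x := ax T x + by_ T x.
Definition ntr h t := dot (p h.1 (gam h t)) (nout h).

Lemma continuous_gam (w : R * R -> R) h : continuous w -> continuous (fun t : R => w (gam h t)).
Proof. exact: continuous_segment. Qed.

Lemma continuous_dot_p h T (n : R * R) : continuous (fun t : R => dot (p T (gam h t)) n).
Proof.
have [ca _ _ _ _] := ha_ T; have [cb _ _ _ _] := hb_ T.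
move=> t; rewrite /dot; under eq_fun do rewrite pE /=.
by apply: cvgD; apply: cvgM; do ?[exact: cvg_cst]; exact: continuous_gam.
Qed.

Lemma continuous_pdiv T : continuous (pdiv T).
Proof. by have [_ c _ _ _] := ha_ T; have [_ _ c' _ _] := hb_ T; exact: continuousDf. Qed.

(** The contribution of the half-edge [h] to the boundary terms of Gauss'
theorem. *)
Definition flux (u : 'I_(ntri M) -> R * R -> R) h :=
  elen h * \int[mu]_(t in `[0, 1]) (ntr h t * u h.1 (gam h t)).

Lemma gauss_broken (u ux uy : 'I_(ntri M) -> R * R -> R) : (forall T, has_partials (u T) (ux T) (uy T)) ->
  \sum_T intT T (fun x => dot (p T x) (grad (u T) x)) + \sum_T intT T (fun x => pdiv T x * u T x) =
  \sum_h flux u h.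
Proof.
move=> hu; rewrite -big_split /=.
transitivity (\sum_T \sum_i flux u (T, i)).
  apply: eq_bigr => T _.
  rewrite (_ : \sum_i _ = \sum_i elen (T, i) * \int[mu]_(t in `[0, 1])
     (dot (a T (gam (T, i) t), b T (gam (T, i) t)) (nout (T, i)) * u T (gam (T, i) t))); last first.
    apply: eq_bigr => i _; congr (_ * _); apply: eq_Rintegral => t _.
    by rewrite /ntr pE.
  rewrite -(gauss_tri hM T (ha_ T) (hb_ T) (hu T)).
  congr (_ + _); apply: eq_Rintegral => x _.
  by rewrite pE /dot /grad /= (has_partials_d1 (hu T)) (has_partials_d2 (hu T)).
rewrite (pair_bigA _ (fun T i => flux u (T, i))) /=.
by apply: eq_bigr => h _; rewrite -surjective_pairing.
Qed.

Lemma test_partials U v : test_function U v -> has_partials v (d1 v) (d2 v).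
Proof. by move=> [h _ _]; apply: Ck_has_partials; exact: h. Qed.

(** The difference between the elementwise and the distributional divergence is
carried by the sides. *)
Lemma weak_flux v : test_function (Omega M) v ->
  \sum_T intT T (fun x => pdiv T x * v x) - \int[mu2]_(x in Omega M) (g x * v x) =
  \sum_h flux (fun=> v) h.
Proof.
move=> tv; have := @gauss_broken (fun=> v) (fun=> d1 v) (fun=> d2 v) (fun=> test_partials tv).
by move=> <-; have [_ ->//] := hg; rewrite addrC.
Qed.

Lemma test_zero (U : set (R * R)) v x : test_function U v -> ~ U x -> v x = 0.
Proof.
move=> [_ _ sub] nU; apply/eqP; apply: contrapT => /negP vx; apply: nU; apply: sub.
exact: subset_closure.
Qed.

Lemma test_bounded (U : set (R * R)) v : test_function U v -> exists B, forall x, `|v x| <= B.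
Proof.
move=> tv; have [/(_ 0%N) /= cv cpt _] := tv.
have : compact (v @` closure [set x | v x != 0]).
  by apply: continuous_compact => //; exact: continuous_subspaceT.
move=> /compact_bounded[N [_ hN]]; exists (`|N| + 1) => x.
have [vx|] := eqVneq (v x) 0; first by rewrite vx normr0 addr_ge0.
move=> vx; apply: (hN (`|N| + 1)); first by rewrite (le_lt_trans (ler_norm N))// ltrDl.
by exists x => //; exact: subset_closure.
Qed.

Lemma test_sub (U V : set (R * R)) v : U `<=` V -> test_function U v -> test_function V v.
Proof. by move=> UV [h c s]; split => //; exact: subset_trans UV. Qed.

Lemma g_integrable : mu2.-integrable (Omega M) (EFin \o g).
Proof. by apply: L2_integrable; have [] := hg. Qed.

Lemma measurable_g : measurable_fun setT g.
Proof. by have [[]] := hg. Qed.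

(** A test function supported in the open triangle vanishes on all sides and on
all other triangles, so that [weak_flux] reduces to the hypothesis of the
fundamental lemma. *)
Lemma ae_pdiv T : {ae mu2, forall x, tri T x -> g x = pdiv T x}.
Proof.
have ig : mu2.-integrable (otri T) (EFin \o g).
  apply: (integrableS2 _ _ _ g_integrable);
    [exact: measurable_Omega|exact: measurable_otri|exact: otri_Omega].
have id_ : mu2.-integrable (otri T) (EFin \o pdiv T).
  apply: (integrableS2 _ _ _ (integrable_tri hM T (@continuous_pdiv T)));
    [exact: measurable_tri|exact: measurable_otri|exact: otri_tri].
have := @fundamental_lemma R (otri T) (fun x => g x - pdiv T x) (@open_otri _ _ T).
case=> [| v tv |N [mN N0 sub]].
- exact: integrableB2 (measurable_otri T) ig id_.
- have tO := test_sub (@otri_Omega _ _ hM T) tv.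
  have cv : continuous v by have [/(_ 0%N)] := tv.
  have mv D : measurable_fun D v by apply: measurable_funTS; exact: continuous_measurable2.
  have [B vB] := test_bounded tv.
  have mo := measurable_otri T.
  under eq_Rintegral do rewrite mulrBl.
  rewrite RintegralB//; last 2 first.
    exact: (integrable_bounded_mul2 mo ig (mv _) vB).
    exact: (integrable_bounded_mul2 mo id_ (mv _) vB).
  have := weak_flux tO.
  rewrite [X in _ = X]big1 => [|h _]; last first.
    rewrite /flux (eq_Rintegral _ (g := fun=> 0)); first by rewrite Rintegral_cst//= mul0r mulr0.
    move=> t; rewrite inE/= in_itv/= => t01; rewrite (test_zero tv) ?mulr0// => oT.
    have sh : side h (gam h t) by exists t; rewrite //= in_itv.
    have [Tx lx] := (side_lam (nondeg) _ _).1 sh.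
    have [e|ne] := eqVneq T h.1.
      by have := oT h.2; rewrite e -surjective_pairing lx ltxx.
    exact: (otri_disj hM ne oT Tx).
  move=> /eqP; rewrite subr_eq0 => /eqP E.
  apply/eqP; rewrite subr_eq0; apply/eqP.
  transitivity (\int[mu2]_(x in Omega M) (g x * v x)).
    rewrite -{1}(setIidr (@otri_Omega _ _ hM T)) Rintegral_mkcondr.
    apply: eq_Rintegral => x _; rewrite patchE; case: ifPn => //.
    by rewrite notin_setE => /(test_zero tv) ->; rewrite mulr0.
  rewrite -E (bigD1 T)//= [X in _ + X]big1 ?addr0 => [|T' T'T].
    rewrite /intT integral_otri//.
    by apply: integrable_tri => //; apply: continuousMf => //; exact: continuous_pdiv.
  rewrite /intT (eq_Rintegral _ (g := fun=> 0)); first by rewrite Rintegral_cst ?mul0r//; exact: measurable_tri.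
  move=> x; rewrite inE => T'x; rewrite (test_zero tv) ?mulr0// => oT.
  by rewrite eq_sym in T'T; exact: (otri_disj hM T'T oT T'x).
- exists (N `|` (tri T `\` otri T)); split.
  + by apply: measurableU => //; apply: measurableD; [exact: measurable_tri|exact: measurable_otri].
  + by apply: null_set_setU => //; [apply: measurableD; [exact: measurable_tri|exact: measurable_otri]|exact: tri_boundary_null].
  + move=> x /= /not_implyP[Tx ngx]; have [oT|noT] := pselect (otri T x); last by right.
    by left; apply: sub => /= /(_ oT) /eqP; rewrite subr_eq0 => /eqP.
Qed.

Lemma shared_lint h h' (k : R * R -> R) : side h = side h' -> continuous k ->
  \int[mu]_(t in `[0, 1]) k (gam h' t) = \int[mu]_(t in `[0, 1]) k (gam h t).
Proof.
move=> ss ck; rewrite -[LHS]/(lint (ha h') (hb h') k) -[RHS]/(lint (ha h) (hb h) k).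
have [[<- <-]//|[<- <-]] := shared_ends hM ss.
exact: lint_sym.
Qed.

Lemma shared_elen h h' : side h = side h' -> elen h' = elen h.
Proof.
move=> ss; rewrite /elen; have [[<- <-]//|[<- <-]] := shared_ends hM ss.
by rewrite /norm2 /dot /=; congr Num.sqrt; ring.
Qed.

Lemma continuous_p T : continuous (fun x => (p T x).1) /\ continuous (fun x => (p T x).2).
Proof.
have [ca _ _ _ _] := ha_ T; have [cb _ _ _ _] := hb_ T.
have -> : (fun x => (p T x).1) = a T by apply/funext => x; rewrite pE.
have -> : (fun x => (p T x).2) = b T by apply/funext => x; rewrite pE.
by split; [exact: ca|exact: cb].
Qed.

Lemma continuous_pn T (n : R * R) : continuous (fun x => dot (p T x) n).
Proof.
have [c1 c2] := continuous_p T; rewrite /dot.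
by apply: continuousDf; apply: continuousMf => //; exact: cst_continuous.
Qed.

Lemma flux_shared h h' (w : R * R -> R) : side h = side h' -> continuous w ->
  flux (fun=> w) h + flux (fun=> w) h' = elen h * \int[mu]_(t in `[0, 1])
    ((dot (p h.1 (gam h t)) (nout h) + dot (p h'.1 (gam h t)) (nout h')) * w (gam h t)).
Proof.
move=> ss cw; rewrite /flux (shared_elen ss) -mulrDr; congr (_ * _).
rewrite (shared_lint (k := fun x => dot (p h'.1 x) (nout h') * w x) ss); last first.
  by apply: continuousMf => //; exact: continuous_pn.
rewrite -RintegralD//; last 2 first.
- apply: integrable_itv; apply: (@continuous_gam (fun x => dot (p h.1 x) (nout h) * w x)).
  by apply: continuousMf => //; exact: continuous_pn.
- apply: integrable_itv; apply: (@continuous_gam (fun x => dot (p h'.1 x) (nout h') * w x)).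
  by apply: continuousMf => //; exact: continuous_pn.
by apply: eq_Rintegral => t _; rewrite /ntr [RHS]mulrDl.
Qed.

(** Once [g] is known to be the elementwise divergence, only the sides are left in
[weak_flux]. *)
Lemma flux_test_eq0 v : test_function (Omega M) v -> \sum_h flux (fun=> v) h = 0.
Proof.
move=> tv; rewrite -weak_flux//; apply/eqP; rewrite subr_eq0; apply/eqP.
have cv : continuous v by have [/(_ 0%N)] := tv.
have mv D : measurable_fun D v by apply: measurable_funTS; exact: continuous_measurable2.
have [B vB] := test_bounded tv.
rewrite integral_Omega_otri//; last first.
  exact: (integrable_bounded_mul2 (measurable_Omega M) g_integrable (mv _) vB).
apply: eq_bigr => T _; rewrite /intT integral_otri//; last first.
  by apply: integrable_tri => //; apply: continuousMf => //; exact: continuous_pdiv.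
congr fine; apply: ae_eq_integral.
- exact: measurable_otri.
- apply/measurable_EFinP/measurable_funM; last exact: mv.
  by apply: measurable_funTS; exact: continuous_measurable2 (@continuous_pdiv T).
- by apply/measurable_EFinP/measurable_funM; [exact: measurable_funTS measurable_g|exact: mv].
- by apply: ae_mono (ae_pdiv T) => x e oT; rewrite e//; exact: otri_tri.
Qed.

(** The left-hand side is a continuous function [J] of the parameter.  If it did not
vanish at [t0], then a bump supported near [gam h t0], where [J] keeps its sign,
would have a nonzero flux through this side and none through the others. *)
Lemma ntr_shared h h' t0 : h.1 != h'.1 -> side h = side h' -> 0 < t0 < 1 ->
  dot (p h.1 (gam h t0)) (nout h) + dot (p h'.1 (gam h t0)) (nout h') = 0.
Proof.
move=> hh' ss t01.
pose J t := dot (p h.1 (gam h t)) (nout h) + dot (p h'.1 (gam h t)) (nout h').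
rewrite -/(J t0); apply/eqP/negPn/negP => J0.
have cJ : continuous J.
  by move=> t; apply: cvgD; exact: continuous_dot_p.
(* this coordinate recovers the parameter of a point of the side *)
pose tau x := lam (h.1, ord_pred h.2) x.
have tauE t : tau (gam h t) = t.
  rewrite /tau (lam_gam nondeg) /ha /hb !(lam_vtx nondeg) eqxx.
  by rewrite eq_sym ordS_pred_neq3 mulr0 add0r mulr1.
pose U := edge_nbhd h h' `&` [set x | 0 < J (tau x) * J t0].
have oU : open U.
  apply: openI; first exact: open_edge_nbhd.
  apply: open_gt0 => x; apply: cvgM; last exact: cvg_cst.
  by apply: continuous_comp; [exact: continuous_lam|exact: cJ].
have Ux : U (gam h t0).
  split; first exact: gam_edge_nbhd.
  by rewrite /= tauE -expr2 lt0r sqrf_eq0 J0 sqr_ge0.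
have [q [xq qU]] := open_rat_rect oU Ux.
pose v := bump2 1 (ratr q.1.1) (ratr q.1.2) (ratr q.2.1) (ratr q.2.2) : R * R -> R.
have tv : test_function U v by exact: test_bump2.
have tO : test_function (Omega M) v.
  by apply: test_sub tv => x [/(edge_nbhd_Omega hM hh' ss)].
have cv : continuous v by have [/(_ 0%N)] := tv.
have hn : h' != h by apply: contraNneq hh' => ->.
have other k : k != h -> k != h' -> flux (fun=> v) k = 0.
  move=> kh kh'; rewrite /flux (eq_Rintegral _ (g := fun=> 0)).
    by rewrite Rintegral_cst//= mul0r mulr0.
  move=> t; rewrite inE/= in_itv/= => tt.
  have sk : side k (gam k t) by exists t; rewrite //= in_itv.
  rewrite (test_zero tv) ?mulr0// => -[nb _].
  have [e|e] := edge_nbhd_side hM hh' ss nb sk; first by rewrite e eqxx in kh.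
  by rewrite e eqxx in kh'.
have two : \sum_k flux (fun=> v) k = flux (fun=> v) h + flux (fun=> v) h'.
  rewrite (bigD1 h isT); congr (_ + _); rewrite (bigD1 h' hn) -[RHS]addr0; congr (_ + _).
  by apply: big1 => k /andP[]; exact: other.
have := flux_test_eq0 tO; rewrite two.
rewrite flux_shared// => /eqP; rewrite mulf_eq0 gt_eqF ?elen_gt0//= => /eqP I0.
have : 0 < \int[mu]_(t in `[0, 1]) (J t0 * (J t * v (gam h t))).
  apply: (@integral_pos_continuous _ _ t0) => //.
  - move=> t; apply: cvgM; first exact: cvg_cst.
    by apply: cvgM; [exact: cJ|exact: continuous_gam].
  - move=> t tt; have [Ut|nU] := pselect (U (gam h t)).
      rewrite mulrA mulr_ge0//; last exact: bump2_ge0.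
      by case: Ut => _ /=; rewrite tauE mulrC => /ltW.
    by rewrite (test_zero tv nU) !mulr0.
  - rewrite mulrA mulr_gt0//; first by rewrite -expr2 lt0r sqrf_eq0 J0 sqr_ge0.
    by rewrite bump2_gt0// in_setE.
rewrite RintegralZl//; first by rewrite I0 mulr0 ltxx.
by apply: integrable_itv => t; apply: cvgM; [exact: cJ|exact: continuous_gam].
Qed.

End Components.
End WeakDivergence.

(** * The adjoint of the discrete gradient *)

Section PairingDivergence.
Context {R : realType}.
Variable M : mesh R.
Implicit Types (T : 'I_(ntri M)) (x : R * R) (h : Defs.half M).
Hypothesis hM : triangulation M.
Variables (r : nat) (p : field M) (g : R * R -> R).
Variables (a ax ay b bx by_ : 'I_(ntri M) -> R * R -> R).
Hypotheses (ha_ : forall T, has_partials (a T) (ax T) (ay T)) (hb_ : forall T, has_partials (b T) (bx T) (by_ T)).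
Hypothesis pE : forall T x, p T x = (a T x, b T x).
Hypotheses (hp : RT0 r p) (hg : div_is p g).
Variable nE : edge M -> R * R.
Hypothesis hn : unit_normals nE.
Local Notation mu := (@lebesgue_measure R).

(** Relates the two half-edges of an interior side, in both orders. *)
Definition partner h h' := (h.1 != h'.1) && `[< side h = side h' >].

(** Every half-edge off the boundary has exactly one partner, so the sum runs over
ordered pairs of partners; in half of them the triangle with the larger index
comes first, and exchanging the two members leads to [interior_edge]. *)
Lemma sum_partner (f : Defs.half M -> R) :
  (forall h, boundary_side h -> f h = 0) ->
  \sum_h f h = \sum_(e : edge M | interior_edge e) (f e.1 + f e.2).
Proof.
move=> f0.
transitivity (\sum_(e : edge M | partner e.1 e.2) f e.1).
  rewrite -(pair_big_dep xpredT partner (fun h _ => f h)) /=; apply: eq_bigr => h _.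
  have [bh|nbh] := pselect (boundary_side h).
    by rewrite f0// big1.
  have [h' [n' s']] : exists h', h'.1 != h.1 /\ side h' = side h.
    apply: contrapT => no; apply: nbh => h' n' s'; apply: no; by exists h'.
  rewrite (big_pred1 h')// => k; rewrite /partner.
  apply/idP/eqP => [/andP[nk /asboolP sk]|->]; last first.
    by rewrite eq_sym n'/=; apply/asboolP.
  by apply: (shared_unique hM _ n' (esym sk) s'); rewrite eq_sym.
rewrite (bigID (fun e : edge M => (e.1.1 < e.2.1)%N)) /= big_split /=; congr (_ + _).
  apply: eq_bigl => -[h h']; rewrite /partner /interior_edge /= andbAC; congr (_ && _).
  by rewrite andb_idl// neq_ltn => ->.
pose sw (e : edge M) : edge M := (e.2, e.1).
have swK : involutive sw by case.
rewrite [RHS](reindex_inj (inv_inj swK)).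
apply: eq_bigl => -[h h']; rewrite /partner /interior_edge /= -leqNgt.
have -> : `[< side h' = side h >] = `[< side h = side h' >].
  by apply/asboolP/asboolP => ->.
by case: `[< _ >]; rewrite ?andbF// !andbT ltn_neqAle eq_sym.
Qed.

(** In the plane [N] and [n] are both orthogonal to [e], hence parallel, and the
mixed term of Lagrange's identity drops out. *)
Lemma projection_normal (N n e q : R * R) : norm2 N = 1 -> e != 0 -> dot N e = 0 ->
  dot n e = 0 -> dot q N * dot n N = dot q n.
Proof.
case: N n e q => [N1 N2] [n1 n2] [e1 e2] [q1 q2] N0 e0; rewrite /dot /= => Ne ne.
have NN : N1 * N1 + N2 * N2 = 1.
  rewrite -[RHS](expr1n _ 2) -N0 /norm2 sqr_sqrtr /dot//=.
  by rewrite addr_ge0// -expr2 sqr_ge0.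
have D : N1 * n2 - N2 * n1 = 0.
  apply/eqP; move: e0; apply: contraNT => D0.
  have E1 : (N1 * n2 - N2 * n1) * e1 = 0.
    transitivity (n2 * (N1 * e1 + N2 * e2) - N2 * (n1 * e1 + n2 * e2)); first by ring.
    by rewrite Ne ne !mulr0 subrr.
  have E2 : (N1 * n2 - N2 * n1) * e2 = 0.
    transitivity (N1 * (n1 * e1 + n2 * e2) - n1 * (N1 * e1 + N2 * e2)); first by ring.
    by rewrite Ne ne !mulr0 subrr.
  move/eqP: E1; move/eqP: E2; rewrite !mulf_eq0 (negbTE D0)/= => /eqP -> /eqP ->.
  by apply/eqP.
transitivity ((q1 * n1 + q2 * n2) * (N1 * N1 + N2 * N2) - (q1 * N2 - q2 * N1) * (N2 * n1 - N1 * n2)).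
  by ring.
by rewrite NN mulr1 (_ : N2 * n1 - N1 * n2 = 0) ?mulr0 ?subr0// -[RHS]oppr0 -D; ring.
Qed.

Lemma dot_nout h : dot (nout h) (hb h - ha h) = 0.
Proof. by rewrite /nout /dot /= /GRing.scale/=; ring. Qed.

(** The adjoint of [Lam] is [- div].  On an interior side the two boundary terms
combine into the normal component of [p] times the jump, because the outer
normals are opposite and the normal components agree. *)
Lemma pairing_Lam (u : broken M) : (forall T, exists ux uy, has_partials (u T) ux uy) ->
  pairing nE p (Lam nE u) = - \sum_T intT T (fun x => pdiv ax by_ T x * u T x).
Proof.
move=> hu; have [ux hux] := choice hu; have [uy huy] := choice hux.
have G := gauss_broken hM ha_ hb_ pE huy.
rewrite /pairing /Lam /=.
have cu T : continuous (u T) by have [] := huy T.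
suff -> : \sum_(e | interior_edge e) intE e (fun t => ntrace nE p e t * jump nE u e t) =
    \sum_h flux p u h.
  by rewrite -G opprD addrA subrr add0r.
rewrite sum_partner => [|h bh]; last first.
  rewrite /flux (eq_Rintegral _ (g := fun=> 0)); first by rewrite Rintegral_cst//= mul0r mulr0.
  by move=> t; rewrite inE/= in_itv/= => tt; have [_ hb0] := hp; rewrite /ntr hb0// mul0r.
apply: eq_bigr => -[h h'] ie; have /andP[/= hlt /asboolP ss] := ie.
have hh' : h.1 != h'.1 by rewrite neq_ltn hlt.
have cpn T n : continuous (fun x => dot (p T x) n) by exact: (continuous_pn ha_ hb_ pE).
have e0 : hb h - ha h != 0 by rewrite subr_eq0 eq_sym; apply: ha_neq_hb; case: hM.
have [N1 N0] := hn ie; rewrite /= in N1 N0.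
rewrite /intE /flux /= (shared_elen hM ss) -/(elen h) -mulrDr; congr (_ * _).
rewrite (shared_lint hM (k := fun x => dot (p h'.1 x) (nout h') * u h'.1 x) ss); last first.
  exact: continuousMf.
have c1 : continuous (fun t : R => dot (p h.1 (gam h t)) (nout h) * u h.1 (gam h t)).
  by apply: (@continuous_gam _ _ (fun x => dot (p h.1 x) (nout h) * u h.1 x)); exact: continuousMf.
have c2 : continuous (fun t : R => dot (p h'.1 (gam h t)) (nout h') * u h'.1 (gam h t)).
  by apply: (@continuous_gam _ _ (fun x => dot (p h'.1 x) (nout h') * u h'.1 x)); exact: continuousMf.
rewrite -RintegralD//; [|exact: integrable_itv|exact: integrable_itv].
apply: integral_eq_oo => [t t01||].
- rewrite /ntrace /jump /= -/(ntr p h t).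
  have J := ntr_shared hM ha_ hb_ pE hg hh' ss t01.
  have nn := nout_opposite hM hh' ss.
  have P := projection_normal (p h.1 (gam h t)) N1 e0 N0 (dot_nout h).
  have dN (q n : R * R) : dot q (- n) = - dot q n by rewrite /dot/=; ring.
  rewrite /ntr; move: J; rewrite nn dN => /eqP; rewrite subr_eq0 => /eqP J.
  rewrite -J -P /dot /= /GRing.scale/=; ring.
- have jE t : jump nE u (h, h') t =
      u h.1 (gam h t) * dot (nout h) (nE (h, h')) + u h'.1 (gam h t) * dot (nout h') (nE (h, h')).
    by rewrite /jump /dot /= /GRing.scale/=; ring.
  under eq_fun do rewrite jE.
  have cu' T (q : R) : continuous (fun t : R => u T (gam h t) * q).
    have c := @continuous_gam R M (u T) h (cu T).
    by move=> t; apply: cvgM; [exact: c|exact: cvg_cst].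
  have c := @continuous_gam R M _ h (cpn h.1 (nE (h, h'))).
  move=> t; apply: cvgM; first exact: c.
  by apply: cvgD; exact: cu'.
- by move=> t; apply: cvgD; [exact: c1|exact: c2].
Qed.

End PairingDivergence.

(** * Duality of the s-norms and convex conjugates *)

Section SNorm.
Context {R : realType}.
Implicit Types (s : \bar R) (x y : R * R).

Lemma snorm_ge0 s x : 0 <= snorm s x.
Proof. by case: s => [a| |] /=; rewrite ?powR_ge0// le_max normr_ge0. Qed.

Lemma snormZ s (k : R) x : (1 <= s)%E -> snorm s (k *: x) = `|k| * snorm s x.
Proof.
case: s => [a| |] //= a1; last first.
  by rewrite !normrM maxr_pMr.
have a0 : a != 0 by rewrite gt_eqF// (lt_le_trans ltr01).
rewrite !normrM !powRM// -mulrDr powRM ?powR_ge0 ?addr_ge0 ?powR_ge0//.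
by rewrite -powRrM mulfV// powRr1.
Qed.

Lemma snorm1 x : snorm 1 x = `|x.1| + `|x.2|.
Proof. by rewrite /= !powRr1// invr1 powRr1// addr_ge0. Qed.

(** Hoelder's inequality together with its sharpness.  The extremal [x] is required
to be nonzero even for [y = 0], so that [x] can be used to bound the dual norm
from above. *)
Definition dual_pair s t := forall y,
  (forall x, dot x y <= snorm s x * snorm t y) /\
  exists2 x, 0 < snorm s x & dot x y = snorm s x * snorm t y.

Let sgn (z : R) : R := if 0 <= z then 1 else -1.

Let sgn_norm z : `|sgn z| = 1.
Proof. by rewrite /sgn; case: ifP; rewrite ?normrN normr1. Qed.

Let sgn_mul z : sgn z * z = `|z|.
Proof.
rewrite /sgn; case: (lerP 0 z) => z0; first by rewrite mul1r ger0_norm.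
by rewrite mulN1r ltr0_norm.
Qed.

Lemma dual_pair_inf1 : dual_pair +oo 1.
Proof.
move=> y; rewrite snorm1; split.
  move=> x; rewrite /dot /= mulrDr; apply: lerD; apply: (le_trans (ler_norm _));
    by rewrite normrM ler_wpM2r// le_max lexx ?orbT.
exists (sgn y.1, sgn y.2); rewrite /dot /= !sgn_norm maxxx ?ltr01// mul1r.
by rewrite !sgn_mul.
Qed.

Lemma dual_pair_1inf : dual_pair 1 +oo.
Proof.
move=> y; split.
  move=> x; rewrite snorm1 /dot /= mulrDl; apply: lerD; apply: (le_trans (ler_norm _));
    by rewrite normrM ler_wpM2l// le_max lexx ?orbT.
have [yy|/ltW yy] := leP `|y.1| `|y.2|.
  exists (0, sgn y.2); rewrite snorm1 /= normr0 add0r sgn_norm ?ltr01// mul1r.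
  by rewrite /dot /= mul0r add0r sgn_mul max_r.
exists (sgn y.1, 0); rewrite snorm1 /= normr0 addr0 sgn_norm ?ltr01// mul1r.
by rewrite /dot /= mul0r addr0 sgn_mul max_l.
Qed.

(** The extremal vector has components of size [|y_i|^(b - 1)] with the signs of
those of [y]. *)
Lemma dual_pair_fin (a b : R) : 1 < a -> 1 < b -> a^-1 + b^-1 = 1 -> dual_pair a%:E b%:E.
Proof.
move=> a1 b1 ab y; have a0 : 0 < a by exact: lt_trans a1.
have b0 : 0 < b by exact: lt_trans b1.
have b0' : b != 0 by rewrite gt_eqF.
split.
  move=> x; apply: le_trans (hoelder2 _ _ _ _ a0 b0 ab); rewrite ?normr_ge0//.
  by rewrite /dot -!normrM; apply: lerD; exact: ler_norm.
have [y0|y0] := eqVneq y 0.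
  exists (1, 0) => /=; first by rewrite normr0 normr1 powR0 ?gt_eqF// powR1 addr0 powR1.
  rewrite y0 /dot /= normr0 !(powR0 b0') addr0 (powR0 (_ : b^-1 != 0)) ?invr_eq0//.
  by rewrite !mulr0 addr0.
pose S := `|y.1| `^ b + `|y.2| `^ b.
have S0 : 0 < S.
  rewrite lt0r addr_ge0 ?powR_ge0// andbT paddr_eq0 ?powR_ge0// !powR_eq0 b0' !andbT !normr_eq0.
  by apply: contra y0 => /andP[/eqP e1 /eqP e2]; rewrite [y]surjective_pairing e1 e2; apply/eqP.
pose f z := sgn z * `|z| `^ (b - 1).
have fn z : `|f z| `^ a = `|z| `^ b.
  rewrite /f normrM sgn_norm mul1r ger0_norm ?powR_ge0// -powRrM; congr (_ `^ _).
  have aE : a^-1 = 1 - b^-1 by rewrite -ab addrK.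
  have a0' : a != 0 by rewrite gt_eqF.
  by apply: (mulIf (_ : a^-1 != 0)); rewrite ?invr_eq0// mulfK// aE; field.
have fm z : f z * z = `|z| `^ b.
  by rewrite /f mulrAC sgn_mul mulr_powRB1.
exists (f y.1, f y.2); rewrite /= !fn -/S; first by rewrite powR_gt0.
rewrite /dot /= !fm -/S -powRD ?ab ?oner_eq0//.
by rewrite powRr1// ltW.
Qed.

Lemma dual_pair_conjugate s : (1 <= s)%E -> dual_pair s (hoelder_conjugate s).
Proof.
case: s => [a| |]//; last by move=> _; rewrite hoelder_conjugatey; exact: dual_pair_inf1.
rewrite lee_fin le_eqVlt => /predU1P[<-|a1].
  by rewrite hoelder_conjugate1; exact: dual_pair_1inf.
have -> : hoelder_conjugate a%:E = (a / (a - 1))%:E.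
  rewrite /hoelder_conjugate/= gt_eqF; last by rewrite lte_fin (lt_trans ltr01).
  by rewrite -EFinD inver subr_eq0 gt_eqF// -EFinM.
have a0 : a != 0 by rewrite gt_eqF// (lt_trans ltr01).
have a10 : 0 < a - 1 by rewrite subr_gt0.
apply: dual_pair_fin => //.
  by rewrite ltr_pdivlMr// mul1r ltrBlDr ltrDl.
by field; rewrite a0/= gt_eqF.
Qed.

Lemma snorm_dual s y (c : R) : (1 <= s)%E ->
  (forall x, dot x y <= c * snorm s x) <-> snorm (hoelder_conjugate s) y <= c.
Proof.
move=> s1; have [h1 [x0 x0p x0E]] := dual_pair_conjugate s1 y; split.
  by move=> /(_ x0); rewrite x0E mulrC ler_pM2r.
by move=> yc x; apply: le_trans (h1 x) _; rewrite mulrC ler_wpM2r// snorm_ge0.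
Qed.

End SNorm.

Section Conjugate.
Context {R : realType} (X : Type).
Implicit Types (V : set X) (k l : X -> R).

Lemma conjugate_eq V k l (A : R) : (forall w, V w -> l w - k w <= A) ->
  (exists2 w, V w & l w - k w = A) -> conjugate V k l = A%:E.
Proof.
move=> ub [w0 Vw0 E]; apply/eqP; rewrite eq_le; apply/andP; split.
  by apply: ge_ereal_sup => _ [w Vw <-]; rewrite lee_fin; exact: ub.
by rewrite -E; apply: ereal_sup_ubound; exists w0.
Qed.

Lemma conjugate_ge V k l w : V w -> ((l w - k w)%:E <= conjugate V k l)%E.
Proof. by move=> Vw; apply: ereal_sup_ubound; exists w. Qed.

(** It suffices that the functional grows along some ray. *)
Lemma conjugate_pinfty V k l (w : R -> X) (a b : R) : 0 < a ->
  (forall t, 0 <= t -> V (w t)) -> (forall t, 0 <= t -> l (w t) - k (w t) = t * a + b) ->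
  conjugate V k l = +oo%E.
Proof.
move=> a0 Vw E; apply/eqyP => A A0.
have t0 : 0 <= (A + `|b|) / a by rewrite divr_ge0 ?addr_ge0 ?(ltW a0)// ltW.
apply: le_trans (conjugate_ge k l (Vw _ t0)); rewrite E// divfK ?gt_eqF// lee_fin.
by have := ler_norm (- b); rewrite normrN; lra.
Qed.

End Conjugate.

(** * The conjugate of the discrete total variation *)

Section RintegralSum.
Context d (T : measurableType d) (R : realType) (m : {measure set T -> \bar R}).
Variables (D : set T) (mD : measurable D).

Lemma Rintegral_sum (I : Type) (s : seq I) (f : I -> T -> R) :
  (forall i, m.-integrable D (EFin \o f i)) ->
  m.-integrable D (EFin \o (fun x => \sum_(i <- s) f i x)) /\
  \int[m]_(x in D) (\sum_(i <- s) f i x) = \sum_(i <- s) \int[m]_(x in D) f i x.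
Proof.
move=> hf; elim: s => [|i s [IH1 IH2]].
  have E : (fun x => \sum_(i <- [::]) f i x) = cst 0 by apply/funext => x; rewrite big_nil.
  rewrite E big_nil Rintegral_cst// mul0r; split=> //.
  exact: (@integrable0 _ _ _ m D).
have E : (fun x => \sum_(j <- i :: s) f j x) = (fun x => f i x + \sum_(j <- s) f j x).
  by apply/funext => x; rewrite big_cons.
rewrite E big_cons -IH2 RintegralD//; split => //.
by have := integrableD mD (hf i) IH1.
Qed.

End RintegralSum.

Section ConjugateG.
Context {R : realType}.
Variable M : mesh R.
Implicit Types (T : 'I_(ntri M)) (x : R * R) (e : edge M).
Hypothesis hM : triangulation M.
Variables (r : nat) (s : \bar R) (nE : edge M -> R * R).
Variables (phi : 'I_(ntri M) -> lattice r -> R * R -> R) (psi : 'I_r.+1 -> R -> R).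
Hypothesis hs : (1 <= s)%E.
Hypothesis hphi : forall T, nodal_basis (Plt2 r) (@nodeT R M T r) (phi T).
Hypothesis hpsi : nodal_basis (Plt1 r.+1) (@nodeE R r) psi.
Local Notation mu := (@lebesgue_measure R).

Lemma continuous_phi T i : continuous (phi T i).
Proof. by apply: (@Plt2_continuous _ r); have [] := hphi T. Qed.

Lemma continuous_psi j : continuous (psi j).
Proof. by apply: (@Plt1_continuous _ r.+1); have [] := hpsi. Qed.

Lemma intT_sum (I : finType) T (f : I -> R * R -> R) : (forall i, continuous (f i)) ->
  intT T (fun x => \sum_i f i x) = \sum_i intT T (f i).
Proof.
move=> cf; have [] // := @Rintegral_sum _ _ _ mu2 (tri T) (measurable_tri hM T) I (index_enum I) f.
by move=> i; apply: integrable_tri.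
Qed.

Lemma intE_sum (I : finType) e (f : I -> R -> R) : (forall i, continuous (f i)) ->
  intE e (fun t => \sum_i f i t) = \sum_i intE e (f i).
Proof.
move=> cf; rewrite /intE -mulr_sumr; congr (_ * _).
have [] // := @Rintegral_sum _ _ _ mu `[0, 1]%classic (measurable_itv _) I (index_enum I) f.
by move=> i; apply: integrable_itv.
Qed.

Lemma intTZ T (k : R) (f : R * R -> R) : continuous f ->
  intT T (fun x => k * f x) = k * intT T f.
Proof.
move=> cf; rewrite /intT RintegralZl//; first exact: measurable_tri.
exact: integrable_tri.
Qed.

Lemma intEZ e (k : R) (f : R -> R) : continuous f -> intE e (fun t => k * f t) = k * intE e f.
Proof.
move=> cf; rewrite /intE RintegralZl; [exact: mulrCA|exact: measurable_itv|].
exact: integrable_itv.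
Qed.

Lemma intT_IT T (v : R * R -> R) :
  intT T (IT phi T v) = \sum_i v (nodeT T i) * cT phi T i.
Proof.
rewrite /IT intT_sum => [|i x]; last by apply: cvgM; [exact: cvg_cst|exact: continuous_phi].
by apply: eq_bigr => i _; rewrite intTZ//; exact: continuous_phi.
Qed.

Lemma intE_IE e (v : R -> R) :
  intE e (IE psi v) = \sum_j v (nodeE j) * cE psi e j.
Proof.
rewrite /IE intE_sum => [|i x]; last by apply: cvgM; [exact: cvg_cst|exact: continuous_psi].
by apply: eq_bigr => i _; rewrite intEZ//; exact: continuous_psi.
Qed.

Lemma primal_split (D : {set 'I_(ntri M)}) (beta : R) (f u : broken M) :
  primal s nE phi psi D beta f u = F D f u + beta * G s nE phi psi (Lam nE u).
Proof.
rewrite /primal /F /DTV /G /Lam /=; congr (_ + _ * (_ + _)).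
apply: eq_bigr => e _; rewrite !intE_IE mulr_sumr; apply: eq_bigr => j _.
by rewrite [X in X * _]mulrC mulrA.
Qed.

Section DualField.
Variable q : field M.
Hypothesis cq1 : forall T, continuous (fun x => (q T x).1).
Hypothesis cq2 : forall T, continuous (fun x => (q T x).2).

Lemma continuous_ntrace e : continuous (ntrace nE q e).
Proof.
have c : continuous (fun x => dot (q e.1.1 x) (nE e)).
  by rewrite /dot; apply: continuousDf; apply: continuousMf => //; exact: cst_continuous.
exact: (@continuous_segment _ _ _ _ c).
Qed.

Lemma pairing_nodes d : @Yset R M r d ->
  pairing nE q d = \sum_T \sum_i dot (d.1 T (nodeT T i)) (sigmaT phi q T i) -
    \sum_(e | interior_edge e) \sum_j d.2 e (nodeE j) * sigmaE nE psi q e j.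
Proof.
move=> [Y1 Y2]; rewrite /pairing; congr (_ - _).
  apply: eq_bigr => T _; have [_ _ E] := hphi T; have [Y11 Y12] := Y1 T.
  have -> : (fun x => dot (q T x) (d.1 T x)) = (fun x =>
     \sum_i ((d.1 T (nodeT T i)).1 * (phi T i x * (q T x).1) +
             (d.1 T (nodeT T i)).2 * (phi T i x * (q T x).2))).
    apply/funext => x; rewrite /dot (E _ Y11) (E _ Y12) !mulr_sumr -big_split.
    by apply: eq_bigr => i _ /=; ring.
  have c1 i : continuous (fun x => phi T i x * (q T x).1).
    by apply: continuousMf => //; exact: continuous_phi.
  have c2 i : continuous (fun x => phi T i x * (q T x).2).
    by apply: continuousMf => //; exact: continuous_phi.
  rewrite intT_sum => [|i]; last first.
    by apply: continuousDf; apply: continuousMf => //; exact: cst_continuous.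
  apply: eq_bigr => i _; rewrite /dot /sigmaT /= -!intTZ// /intT RintegralD//.
  - exact: measurable_tri.
  - by apply: integrable_tri => //; apply: continuousMf => //; exact: cst_continuous.
  - by apply: integrable_tri => //; apply: continuousMf => //; exact: cst_continuous.
apply: eq_bigr => e ie; have [_ _ E] := hpsi.
have -> : (fun t => ntrace nE q e t * d.2 e t) =
    (fun t => \sum_j d.2 e (nodeE j) * (psi j t * ntrace nE q e t)).
  apply/funext => t; rewrite (E _ (Y2 e ie)) mulr_sumr.
  by apply: eq_bigr => j _; ring.
have c j : continuous (fun t => psi j t * ntrace nE q e t).
  by move=> t; apply: cvgM; [exact: continuous_psi|exact: continuous_ntrace].
rewrite intE_sum => [|j t]; last by apply: cvgM; [exact: cvg_cst|exact: c].
by apply: eq_bigr => j _; rewrite intEZ.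
Qed.

Lemma G_nodes d : G s nE phi psi d =
  \sum_T \sum_i snorm s (d.1 T (nodeT T i)) * cT phi T i +
  \sum_(e | interior_edge e) \sum_j `|d.2 e (nodeE j)| * (snorm s (nE e) * cE psi e j).
Proof.
rewrite /G; congr (_ + _); first by apply: eq_bigr => T _; rewrite intT_IT.
apply: eq_bigr => e _; rewrite intE_IE mulr_sumr; apply: eq_bigr => j _; ring.
Qed.

(** A nodal basis reproduces the polynomials that occur in [Yset], so the objective
of the conjugate decouples into one term per node. *)
Lemma pairing_G d : @Yset R M r d -> pairing nE q d - G s nE phi psi d =
  \sum_T \sum_i (dot (d.1 T (nodeT T i)) (sigmaT phi q T i) -
                 snorm s (d.1 T (nodeT T i)) * cT phi T i) +
  \sum_(e | interior_edge e) \sum_j (- (d.2 e (nodeE j) * sigmaE nE psi q e j) -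
      `|d.2 e (nodeE j)| * (snorm s (nE e) * cE psi e j)).
Proof.
move=> Yd; rewrite pairing_nodes// G_nodes opprD addrACA -!sumrB; congr (_ + _).
  by apply: eq_bigr => T _; rewrite -sumrB.
rewrite -opprD -big_split -sumrN; apply: eq_bigr => e _.
by rewrite /= -big_split /= -sumrN; apply: eq_bigr => j _; rewrite opprD.
Qed.

Lemma Yset0 : @Yset R M r (fun _ _ => (0, 0), fun _ _ => 0).
Proof.
split => [T|e _] /=; first by split; exact: Plt2_0.
by exists (fun=> 0) => t; rewrite big1// => i _; rewrite mul0r.
Qed.

Lemma snorm0 : snorm s (0 : R * R) = 0.
Proof. by rewrite -(scale0r (0 : R * R)) snormZ// normr0 mul0r. Qed.

(** The constraint set for [beta = 1]. *)
Definition admissible :=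
  (forall T i, snorm (hoelder_conjugate s) (sigmaT phi q T i) <= cT phi T i) /\
  (forall e, interior_edge e -> forall j,
     `|sigmaE nE psi q e j| <= snorm s (nE e) * cE psi e j).

Lemma conjugate_G0 : admissible -> conjugate (@Yset R M r) (G s nE phi psi) (pairing nE q) = 0%E.
Proof.
move=> [h1 h2]; apply: conjugate_eq => [d Yd|].
  rewrite pairing_G//; rewrite -[leRHS]addr0; apply: lerD; apply: sumr_le0.
    move=> T _; apply: sumr_le0 => i _; rewrite subr_le0 mulrC.
    exact: (snorm_dual _ _ hs).2.
  move=> e ie; apply: sumr_le0 => j _; rewrite subr_le0.
  apply: (le_trans (ler_norm _)); rewrite normrN normrM ler_wpM2l//.
  exact: h2.
exists (fun _ _ => (0, 0), fun _ _ => 0); first exact: Yset0.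
rewrite pairing_G; last exact: Yset0.
rewrite big1 ?add0r => [|T _]; last first.
  by rewrite big1// => i _ /=; rewrite -[(0, 0)]/(0 : R * R) snorm0 /dot/= !(mul0r, oppr0, addr0).
by rewrite big1// => e _; rewrite big1// => j _ /=; rewrite normr0 !(mul0r, oppr0, addr0).
Qed.

(** A violated constraint yields a direction at a single node along which the
objective grows linearly; the nodal basis function extends it to an element of
[Yset]. *)
Lemma conjugate_G_pinfty : ~ admissible ->
  conjugate (@Yset R M r) (G s nE phi psi) (pairing nE q) = +oo%E.
Proof.
have ge0Z (k : R) (w : R * R) : 0 <= k -> snorm s (k *: w) = k * snorm s w.
  by move=> k0; rewrite snormZ// ger0_norm.
move=> na; have [h1|/existsNP[T0 /existsNP[i0 nh]]] :=
    pselect (forall T i, snorm (hoelder_conjugate s) (sigmaT phi q T i) <= cT phi T i); last first.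
  have [w wp] : exists w, cT phi T0 i0 * snorm s w < dot w (sigmaT phi q T0 i0).
    apply: contrapT => no; apply: nh; apply/(snorm_dual _ _ hs) => w.
    by rewrite leNgt; apply/negP => h; apply: no; exists w.
  pose d (t : R) : Yprod M := (fun T x => if T == T0 then (t * phi T0 i0 x) *: w else 0, fun _ _ => 0).
  have Yd t : @Yset R M r (d t).
    split => [T|e _] /=; last first.
      by exists (fun=> 0) => z; rewrite big1// => i _; rewrite mul0r.
    case: eqP => _ /=; last by split; exact: Plt2_0.
    have [hp _ _] := hphi T0.
    by split; [apply: Plt2_ext (Plt2Z (t * w.1) (hp i0))|apply: Plt2_ext (Plt2Z (t * w.2) (hp i0))] => x;
      rewrite /= /GRing.scale/=; ring.
  apply: (@conjugate_pinfty _ _ _ _ _ d (dot w (sigmaT phi q T0 i0) - cT phi T0 i0 * snorm s w) 0).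
  - by rewrite subr_gt0.
  - by move=> t _; exact: Yd.
  move=> t t0; rewrite pairing_G// addr0.
  rewrite [X in _ + X]big1 ?addr0 => [|e _]; last first.
    by rewrite big1// => j _ /=; rewrite normr0 !(mul0r, oppr0, addr0).
  have z T i : dot 0 (sigmaT phi q T i) - snorm s 0 * cT phi T i = 0.
    by rewrite snorm0 /dot/= !(mul0r, oppr0, addr0).
  rewrite (bigD1 T0)//= [X in _ + X]big1 ?addr0 => [|T TT0]; last first.
    by rewrite big1// => i _; rewrite (negbTE TT0) z.
  rewrite (bigD1 i0)//= [X in _ + X]big1 ?addr0 => [|i ii0].
    have [_ -> _] := hphi T0; rewrite !eqxx mulr1 ge0Z// /dot /= /GRing.scale/=; ring.
  have [_ -> _] := hphi T0; rewrite eqxx eq_sym (negbTE ii0) mulr0 scale0r; exact: z.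
have [e0 ie0 [j0 nh]] : exists2 e, interior_edge e & exists j,
    ~ `|sigmaE nE psi q e j| <= snorm s (nE e) * cE psi e j.
  apply: contrapT => no; apply: na; split => // e ie j; apply: contrapT => h; apply: no.
  by exists e => //; exists j.
move/negP: nh; rewrite -ltNge => nh.
pose sg0 : R := if 0 <= sigmaE nE psi q e0 j0 then -1 else 1.
have sgn : `|sg0| = 1 by rewrite /sg0; case: ifP; rewrite ?normrN normr1.
have sgm : - (sg0 * sigmaE nE psi q e0 j0) = `|sigmaE nE psi q e0 j0|.
  rewrite /sg0; case: (lerP 0 (sigmaE nE psi q e0 j0)) => h; first by rewrite mulN1r opprK ger0_norm.
  by rewrite mul1r ltr0_norm.
pose d (t : R) : Yprod M := (fun _ _ => 0, fun e z => if e == e0 then t * (sg0 * psi j0 z) else 0).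
have [hp pd _] := hpsi.
have Yd t : @Yset R M r (d t).
  split => [T|e _] /=; first by split; exact: Plt2_0.
  case: eqP => _; last by exists (fun=> 0) => z; rewrite big1// => i _; rewrite mul0r.
  have [c hc] := hp j0; exists (fun i => t * (sg0 * c i)) => z; rewrite hc !mulr_sumr.
  by apply: eq_bigr => i _; rewrite !mulrA.
apply: (@conjugate_pinfty _ _ _ _ _ d (`|sigmaE nE psi q e0 j0| - snorm s (nE e0) * cE psi e0 j0) 0).
- by rewrite subr_gt0.
- by move=> t _; exact: Yd.
move=> t t0; rewrite pairing_G// addr0.
rewrite [X in X + _]big1 ?add0r => [|T _]; last first.
  by rewrite big1// => i _ /=; rewrite snorm0 /dot/= !(mul0r, oppr0, addr0).
rewrite (bigD1 e0)//= [X in _ + X]big1 ?addr0 => [|e /andP[_ ee0]]; last first.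
  by rewrite big1// => j _; rewrite (negbTE ee0) normr0 !(mul0r, oppr0, addr0).
rewrite (bigD1 j0)//= [X in _ + X]big1 ?addr0 => [|j jj0]; last first.
  by rewrite eqxx pd eq_sym (negbTE jj0) !mulr0 normr0 !(mul0r, oppr0, addr0).
rewrite !eqxx pd eqxx mulr1 normrM sgn mulr1 (ger0_norm t0) -sgm; ring.
Qed.

End DualField.
End ConjugateG.

(** * The conjugate of the data term *)

Section ConjugateF.
Context {R : realType}.
Variable M : mesh R.
Implicit Types (T : 'I_(ntri M)) (x : R * R).
Hypothesis hM : triangulation M.
Variables (D : {set 'I_(ntri M)}) (r : nat) (f : broken M) (dv : broken M) (g : R * R -> R).
Hypotheses (hf : DG_on D r f) (hdv : forall T, Plt2 r.+1 (dv T)).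
Hypothesis mg : measurable_fun setT g.
Hypothesis gdv : forall T, {ae mu2, forall x, tri T x -> g x = dv T x}.

Lemma intT_ae T (v w : R * R -> R) : measurable_fun setT v -> measurable_fun setT w ->
  {ae mu2, forall x, tri T x -> v x = w x} -> intT T v = intT T w.
Proof.
move=> mv mw vw; rewrite /intT; congr fine; apply: ae_eq_integral.
- exact: measurable_tri.
- by apply/measurable_EFinP; exact: measurable_funTS mv.
- by apply/measurable_EFinP; exact: measurable_funTS mw.
- by apply: ae_mono vw => x e Tx; rewrite e.
Qed.

Let cdv T : continuous (dv T). Proof. exact: Plt2_continuous (hdv T). Qed.

(** Contrapositively, if [g] does not vanish almost everywhere on [T], then its
polynomial representative has a positive square integral. *)
Lemma intT_sq_eq0 T : intT T (fun x => dv T x * dv T x) = 0 ->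
  {ae mu2, forall x, tri T x -> g x = 0}.
Proof.
move=> h.
have cd2 : continuous (fun x => dv T x * dv T x) by exact: continuousMf.
have id2 := integrable_tri hM T cd2.
have mT := measurable_tri hM T.
have : (\int[mu2]_(x in tri T) `|(dv T x * dv T x)%:E| = 0)%E.
  have -> : (fun x => `|(dv T x * dv T x)%:E|)%E = (fun x => (dv T x * dv T x)%:E).
    by apply/funext => x; rewrite gee0_abs// lee_fin -expr2 sqr_ge0.
  move/eqP: h; rewrite /intT /Rintegral fine_eq0 => [/eqP//|].
  by apply: (@integrable_fin_num _ _ _ mu2 (tri T)).
have md2 : measurable_fun (tri T) (fun x => (dv T x * dv T x)%:E).
  by apply/measurable_EFinP; exact: integrable_mfun id2.
move=> /(@ae_eq_integral_abs _ _ _ mu2 (tri T) mT _ md2) [N1 [mN1 N10 s1]].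
have [N2 [mN2 N20 s2]] := gdv T.
exists (N1 `|` N2); split; [exact: measurableU|exact: null_set_setU|].
move=> x /= /not_implyP[Tx gx]; have [e|ne] := pselect (g x = dv T x); last first.
  by right; apply: s2 => /= /(_ Tx).
left; apply: s1 => /= /(_ Tx) [] /eqP; rewrite mulf_eq0 orbb => /eqP d0; apply: gx.
by rewrite e.
Qed.

Definition lift_dv (u : broken M) : R := \sum_T intT T (fun x => dv T x * u T x).

(** The data extended by zero, which makes it an element of the finite element
space. *)
Definition fD : broken M := fun T => if T \in D then f T else fun=> 0.

Let hfD T : Plt2 r.+1 (fD T).
Proof. by rewrite /fD; case: ifP => [/hf//|_]; exact: Plt2_0. Qed.

Let cfD T : continuous (fD T). Proof. exact: Plt2_continuous (hfD T). Qed.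

(** Completing the square on the triangles with data:
[d u - 1/2 (u - f)^2 = 1/2 (d + f)^2 - 1/2 f^2 - 1/2 (d + f - u)^2]. *)
Lemma F_value (u : broken M) : DG r u ->
  lift_dv u - F D f u = \sum_(T | T \notin D) intT T (fun x => dv T x * u T x) +
  \sum_(T in D) (intT T (fun x => 2^-1 * (dv T x + f T x) ^+ 2) - intT T (fun x => 2^-1 * f T x ^+ 2)
     - intT T (fun x => 2^-1 * (dv T x + f T x - u T x) ^+ 2)).
Proof.
move=> hu; have cu T : continuous (u T) by exact: Plt2_continuous (hu T).
rewrite /lift_dv (bigID (mem D))/= addrC -addrA; congr (_ + _).
rewrite /F /sqnorm mulr_sumr -sumrB; apply: eq_bigr => T TD.
have cf : continuous (f T) by exact: Plt2_continuous (hf TD).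
have csq (w : R * R -> R) : continuous w -> continuous (fun x => w x ^+ 2).
  by move=> cw x; under eq_fun do rewrite expr2; apply: cvgM; exact: cw.
have cB (v w : R * R -> R) : continuous v -> continuous w -> continuous (fun x => v x - w x).
  by move=> cv cw x; apply: cvgB; [exact: cv|exact: cw].
have ch (w : R * R -> R) : continuous w -> continuous (fun x => 2^-1 * w x).
  by move=> cw; apply: continuousMf => //; exact: cst_continuous.
have cDv := @cdv T; have cU := cu T.
have c1 : continuous (fun x => 2^-1 * (u T x - f T x) ^+ 2) by apply: ch; apply: csq; exact: cB.
have c2 : continuous (fun x => 2^-1 * (dv T x + f T x) ^+ 2).
  by apply: ch; apply: csq; exact: continuousDf.
have c3 : continuous (fun x => 2^-1 * f T x ^+ 2) by apply: ch; exact: csq.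
have c4 : continuous (fun x => 2^-1 * (dv T x + f T x - u T x) ^+ 2).
  by apply: ch; apply: csq; apply: cB => //; exact: continuousDf.
have c5 : continuous (fun x => dv T x * u T x) by exact: continuousMf.
have mT := measurable_tri hM T.
rewrite -intTZ//; last by apply: csq; exact: cB.
rewrite /intT -!RintegralB//; do ?[exact: integrable_tri|by apply: integrable_tri => //; exact: cB].
by apply: eq_Rintegral => x _; field.
Qed.

(** The last square of [F_value] vanishes for [u = f + div p]. *)
Lemma conjugate_F_zero_off l : (forall u, DG r u -> l u = lift_dv u) -> zero_off D g ->
  conjugate (DG r) (F D f) l =
    (2^-1 * sqnorm D (fun T x => g x + f T x) - 2^-1 * sqnorm D f)%:E.
Proof.
move=> hl hz.
have off T u : DG r u -> T \notin D -> intT T (fun x => dv T x * u T x) = 0.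
  move=> hu TD; have cu : continuous (u T) by exact: Plt2_continuous (hu T).
  transitivity (intT T (fun=> 0)); last first.
    by rewrite /intT Rintegral_cst ?mul0r//; exact: measurable_tri.
  apply: intT_ae.
  - by apply: continuous_measurable2; exact: continuousMf.
  - exact: measurable_cst.
  - have [N1 [mN1 N10 s1]] := hz _ TD; have [N2 [mN2 N20 s2]] := gdv T.
    exists (N1 `|` N2); split; [exact: measurableU|exact: null_set_setU|].
    move=> x /= /not_implyP[Tx dx]; have [e|ne] := pselect (g x = dv T x); last first.
      by right; apply: s2 => /= /(_ Tx).
    by left; apply: s1 => /= /(_ Tx) g0; apply: dx; rewrite -e g0 mul0r.
have gE : sqnorm D (fun T x => g x + f T x) = sqnorm D (fun T x => dv T x + f T x).
  apply: eq_bigr => T TD; have cf : continuous (f T) by exact: Plt2_continuous (hf TD).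
  have mf := continuous_measurable2 cf.
  apply: intT_ae.
  - by apply: measurable_funX; exact: measurable_funD.
  - by apply: measurable_funX; apply: measurable_funD => //; exact: continuous_measurable2.
  - by apply: ae_mono (gdv T) => x e Tx; rewrite e.
have ch T (w : R * R -> R) : continuous w -> intT T (fun x => 2^-1 * w x ^+ 2) = 2^-1 * intT T (fun x => w x ^+ 2).
  move=> cw; rewrite intTZ// => x; under eq_fun do rewrite expr2.
  by apply: cvgM; exact: cw.
have A0 : 2^-1 * sqnorm D (fun T x => g x + f T x) - 2^-1 * sqnorm D f =
   \sum_(T in D) (intT T (fun x => 2^-1 * (dv T x + f T x) ^+ 2) - intT T (fun x => 2^-1 * f T x ^+ 2)).
  rewrite gE /sqnorm !mulr_sumr -sumrB; apply: eq_bigr => T TD.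
  have cf : continuous (f T) by exact: Plt2_continuous (hf TD).
  by rewrite !ch//; exact: continuousDf.
apply: conjugate_eq => [u hu|].
  rewrite hl// F_value// big1 ?add0r => [|T TD]; last exact: off.
  rewrite A0; apply: ler_sum => T TD; rewrite lerBlDr lerDl.
  by apply: Rintegral_ge0 => x _; rewrite mulr_ge0 ?invr_ge0// sqr_ge0.
pose u0 : broken M := fun T x => dv T x + fD T x.
have hu0 : DG r u0 by move=> T; exact: Plt2D.
exists u0 => //; rewrite hl// F_value// big1 ?add0r => [|T TD]; last exact: off.
rewrite A0; apply: eq_bigr => T TD; rewrite -[RHS]subr0; congr (_ - _).
rewrite /intT (eq_Rintegral _ (g := fun=> 0)).
  by rewrite Rintegral_cst ?mul0r//; exact: measurable_tri.
by move=> x _; rewrite /u0 /fD TD subrr expr0n mulr0.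
Qed.

(** On a triangle without data the functional is linear, so it is unbounded along
[u = t (div p)] unless the divergence vanishes there. *)
Lemma conjugate_F_pinfty l : (forall u, DG r u -> l u = lift_dv u) -> ~ zero_off D g ->
  conjugate (DG r) (F D f) l = +oo%E.
Proof.
move=> hl /existsNP[T0 /not_implyP[T0D nz]].
have c0 : 0 < intT T0 (fun x => dv T0 x * dv T0 x).
  rewrite lt0r; apply/andP; split; last by apply: Rintegral_ge0 => x _; rewrite -expr2 sqr_ge0.
  by apply/eqP => /intT_sq_eq0.
pose u (t : R) : broken M := fun T x => if T == T0 then t * dv T x else 0.
have hu t : DG r (u t).
  by move=> T; rewrite /u; case: eqP => _; [exact: Plt2Z|exact: Plt2_0].
apply: (@conjugate_pinfty _ _ _ _ _ u _ (- F D f (fun _ _ => 0)) c0) => [t _|t _]; first exact: hu.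
rewrite hl//; congr (_ + - _).
  rewrite /lift_dv (bigD1 T0)//= [X in _ + X]big1 ?addr0 => [|T TT0]; last first.
    rewrite /u (negbTE TT0) (_ : (fun x => _) = fun=> 0); last by apply/funext => x; rewrite mulr0.
    by rewrite /intT Rintegral_cst ?mul0r//; exact: measurable_tri.
  rewrite -intTZ//; last exact: continuousMf.
  by apply: eq_Rintegral => x _; rewrite /u eqxx; ring.
rewrite /F /sqnorm; congr (_ * _); apply: eq_bigr => T TD.
apply: eq_Rintegral => x _; rewrite /u; case: eqP => // e; move: TD T0D; rewrite e => ->.
by [].
Qed.

End ConjugateF.

(** * The dual problem *)

Section Scaling.
Context {R : realType}.
Variable M : mesh R.
Hypothesis hM : triangulation M.
Variables (r : nat) (s : \bar R) (nE : edge M -> R * R) (beta : R).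
Variables (phi : 'I_(ntri M) -> lattice r -> R * R -> R) (psi : 'I_r.+1 -> R -> R).
Hypotheses (hs : (1 <= s)%E) (hbeta : 0 < beta).
Hypothesis hphi : forall T, nodal_basis (Plt2 r) (@nodeT R M T r) (phi T).
Hypothesis hpsi : nodal_basis (Plt1 r.+1) (@nodeE R r) psi.
Variable p : field M.
Hypothesis cp1 : forall T, continuous (fun x => (p T x).1).
Hypothesis cp2 : forall T, continuous (fun x => (p T x).2).

(** The degrees of freedom are linear and the dual norm is homogeneous, so scaling
[p] by [1 / beta] divides both sides of the constraints by [beta]. *)
Lemma betaP_admissible : RT0 r p -> betaP s nE phi psi beta p <->
  admissible s nE phi psi (fun T x => beta^-1 *: p T x).
Proof.
move=> hp; have bi0 : 0 < beta^-1 by rewrite invr_gt0.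
have ET T i : sigmaT phi (fun T x => beta^-1 *: p T x) T i = beta^-1 *: sigmaT phi p T i.
  have cphi : continuous (phi T i) by exact: continuous_phi.
  congr pair; rewrite /= /GRing.scale/= -(intTZ hM); do ?exact: continuousMf;
    by apply: eq_Rintegral => x _; rewrite mulrCA.
have EE e j : sigmaE nE psi (fun T x => beta^-1 *: p T x) e j = beta^-1 * sigmaE nE psi p e j.
  rewrite /sigmaE -intEZ; last first.
    move=> t; apply: cvgM; first exact: (continuous_psi hpsi).
    exact: continuous_ntrace.
  by congr (_ * _); apply: eq_Rintegral => t _; rewrite /ntrace /dot /= /GRing.scale/=; ring.
have AT T i : (snorm (hoelder_conjugate s) (sigmaT phi (fun T x => beta^-1 *: p T x) T i)
    <= cT phi T i) = (snorm (hoelder_conjugate s) (sigmaT phi p T i) <= beta * cT phi T i).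
  by rewrite ET snormZ ?hoelder_conj_ge1// gtr0_norm// ler_pdivrMl.
have AE e j : (`|sigmaE nE psi (fun T x => beta^-1 *: p T x) e j| <= snorm s (nE e) * cE psi e j) =
   (`|sigmaE nE psi p e j| <= beta * snorm s (nE e) * cE psi e j).
  by rewrite EE normrM gtr0_norm// ler_pdivrMl// mulrA.
split=> [[_ h1 h2]|[h1 h2]].
  by split=> [T i|e ie j]; [rewrite AT|rewrite AE//; exact: h2].
by split=> // [T i|e ie j]; [rewrite -AT|rewrite -AE; exact: h2].
Qed.

End Scaling.

Unset Implicit Arguments.

(* D is the set of the triangles in Omega0. *)
Theorem theorem4p1 (R : realType) (M : mesh R) (D : {set 'I_(ntri M)})
    (r : nat) (s : \bar R) (beta : R) (f : broken M) (nE : edge M -> R * R)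
    (phi : 'I_(ntri M) -> lattice r -> R * R -> R) (psi : 'I_r.+1 -> R -> R)
    (hM : triangulation M) (hr : (r <= 4)%N) (hs : (1 <= s)%E)
    (hbeta : 0 < beta) (hf : DG_on D r f) (hn : unit_normals nE)
    (hphi : forall T, nodal_basis (Plt2 r) (@nodeT R M T r) (phi T))
    (hpsi : nodal_basis (Plt1 r.+1) (@nodeE R r) psi) :
  (forall u, DG r u ->
     primal s nE phi psi D beta f u =
       F D f u + beta * G s nE phi psi (Lam nE u)) /\
  exists C : R, forall p g, RT0 r p -> div_is p g ->
    (betaP s nE phi psi beta p /\ zero_off D g ->
       dual_objective s nE phi psi D beta f p =
         (2^-1 * sqnorm D (fun T x => g x + f T x) + C)%:E) /\
    (~ (betaP s nE phi psi beta p /\ zero_off D g) ->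
       dual_objective s nE phi psi D beta f p = +oo%E).
Proof.
split=> [u _|]; first exact: primal_split.
exists (- (2^-1 * sqnorm D f)) => p g hp hg.
have [hRT _] := hp.
have [a /choice[ax /choice[ay /choice[b /choice[bx /choice[by_ H]]]]]] := choice (RT_div hRT).
have hA T : has_partials (a T) (ax T) (ay T) by have [] := H T.
have hB T : has_partials (b T) (bx T) (by_ T) by have [] := H T.
have pE T x : p T x = (a T x, b T x) by have [_ _ ->] := H T.
have hdv T : Plt2 r.+1 (pdiv ax by_ T) by have [_ _ _] := H T.
have [cp1 cp2] : (forall T, continuous (fun x => (p T x).1)) /\ (forall T, continuous (fun x => (p T x).2)).
  by split=> T; have [] := continuous_p hA hB pE T.
have cq1 T : continuous (fun x => (beta^-1 *: p T x).1).
  by apply: continuousMf => //; exact: cst_continuous.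
have cq2 T : continuous (fun x => (beta^-1 *: p T x).2).
  by apply: continuousMf => //; exact: cst_continuous.
have gdv := ae_pdiv hM hA hB pE hg.
have mg := measurable_g hg.
have hl u : DG r u -> - pairing nE p (Lam nE u) = lift_dv (pdiv ax by_) u.
  move=> hu; rewrite (pairing_Lam hM hA hB pE hp hg hn) ?opprK// => T.
  by have [ux [uy [? _ _ _ _]]] := Plt2_partials (hu T); exists ux, uy.
have adm := betaP_admissible hM nE hs hbeta hphi hpsi cp1 cp2 hp.
rewrite /dual_objective; split=> [[hP hz]|nPz].
  rewrite (@conjugate_F_zero_off _ _ hM D r f _ _ hf hdv mg gdv _ hl hz).
  rewrite (conjugate_G0 hM hs hphi hpsi cq1 cq2 (adm.1 hP)).
  by rewrite mule0 adde0.
have [hA'|nA] := pselect (admissible s nE phi psi (fun T x => beta^-1 *: p T x)).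
  have nz : ~ zero_off D g by move=> hz; apply: nPz; split=> //; exact/adm.
  rewrite (@conjugate_F_pinfty _ _ hM D r f _ _ hdv gdv _ hl nz).
  by rewrite (conjugate_G0 hM hs hphi hpsi cq1 cq2 hA') mule0 adde0.
rewrite (conjugate_G_pinfty hM hs hphi hpsi cq1 cq2 nA) gt0_muley ?lte_fin//.
rewrite addey// gt_eqF//.
(* a conjugate of a function that is finite somewhere is not -oo *)
have h0 : DG r ((fun _ _ => 0) : broken M) by move=> T; exact: Plt2_0.
apply: lt_le_trans (conjugate_ge _ _ h0); exact: ltNyr.
Qed.
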